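(* Let $k\in\mathbb{R}$ and let $u$ be a weak solution of the Camassa--Holm equation $$(1-\partial_x^2)u_t+2ku_x+u(1-\partial_x^2)u_x+2u_x(1-\partial_x^2)u=0$$ with initial data $u_0$ such that the equation is locally well-posed, namely such that one of the following holds: (i) $u_0\in H^s(\mathbb{R})$ for some $s>3/2$; or (ii) $u_0\in H^1(\mathbb{R})$ and $u_0-u_{0,xx}$ is a positive Radon measure; where $u$ is the unique solution with initial data $u_0$ provided by the corresponding well-posedness result. If $u$ is $x$-symmetric, then $u$ is a traveling wave, i.e. there are $c\in\mathbb{R}$ and $U\colon\mathbb{R}\to\mathbb{R}$ with $u(t,x)=U(x-ct)$.
   Context: $\mathbb{R}_+=(0,\infty)$. A function $u(t,x)$ is a weak solution of the Camassa--Holm equation if $u\in C(\mathbb{R}_+,H^1(\mathbb{R}))$ and $$\iint_{\mathbb{R}_+\times\mathbb{R}}\Big[u\big((1-\partial_x^2)\varphi_t+2k\varphi_x\big)+u^2\Big(\tfrac{3\varphi_x}{2}-\tfrac{\varphi_{xxx}}{2}\Big)+u_x^2\,\tfrac{\varphi_x}{2}\Big]\,dt\,dx=0$$ for all $\varphi\in C_0^\infty(\mathbb{R}_+\times\mathbb{R})$. Well-posedness results referred to (known facts): Case (i): if $u_0\in H^s(\mathbb{R})$ with $s>3/2$, there exists $T>0$ depending only on $\|u_0\|_{H^s}$ such that there is a unique solution $u\in C([0,T],H^s(\mathbb{R}))$ with $u(0,\cdot)=u_0$. Case (ii): if $u_0\in H^1(\mathbb{R})$ and $u_0-u_{0,xx}$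 is a positive Radon measure, there is a unique global (weak) solution with $u(0,\cdot)=u_0$. If the solution is only considered on an interval of existence (case (i)), then $\mathbb{R}_+$ is replaced by that interval in the definitions of weak solution, $x$-symmetric and traveling wave. A solution $u$ is $x$-symmetric if there exists a function $\lambda\in C^1(\mathbb{R}_+)$ such that for every $t>0$, $u(t,x)=u(t,2\lambda(t)-x)$ for almost every $x\in\mathbb{R}$. *)

(* Defs.v *)
From HB Require Import structures.
From mathcomp Require Import all_boot all_order all_algebra.
From mathcomp Require Import all_classical all_reals all_analysis.

Set Implicit Arguments.
Unset Strict Implicit.
Unset Printing Implicit Defensive.

Import Order.TTheory GRing.Theory Num.Theory.
Import numFieldNormedType.Exports.

Local Open Scope classical_set_scope.
Local Open Scope ring_scope.

Section TestFunctions.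
Context {R : realType}.

Definition test_function (phi : R -> R) : Prop :=
  (forall n (x : R), derivable (derive1n n phi) x 1) /\
  exists M : R, forall x : R, M < `|x| -> phi x = 0.

Definition dt (phi : R -> R -> R) : R -> R -> R :=
  fun t x => derive1 (phi ^~ x) t.

Definition dx (phi : R -> R -> R) : R -> R -> R :=
  fun t x => derive1 (phi t) x.

(* [w] lists the variables of differentiation: [true] for t, [false] for x *)
Definition iter_partial (w : seq bool) (phi : R -> R -> R) : R -> R -> R :=
  foldr (fun b psi => if b then dt psi else dx psi) phi w.

Definition smooth2 (phi : R -> R -> R) : Prop :=
  forall w, let psi := iter_partial w phi in
    continuous (fun p : R * R => psi p.1 p.2) /\
    forall t x : R, derivable (psi ^~ x) t 1 /\ derivable (psi t) x 1.

(* C_c^oo(J x R) for J an open set of times *)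
Definition spacetime_test_function (J : set R) (phi : R -> R -> R) : Prop :=
  smooth2 phi /\
  exists a b M : R, `[a, b] `<=` J /\
    forall t x, ~ (a <= t <= b /\ `|x| <= M) -> phi t x = 0.

End TestFunctions.

Section FunctionSpaces.
Context {R : realType}.
Local Notation mu := (@lebesgue_measure R).

Definition L2 (f : R -> R) : Prop := f \in Lfun mu 2%:E.

Definition L2norm (f : R -> R) : \bar R := 'N[mu]_2%:E[EFin \o f].

Definition weak_derivative (f g : R -> R) : Prop :=
  forall phi, test_function phi ->
    \int[mu]_x (f x * derive1 phi x) = - \int[mu]_x (g x * phi x).

(* f is in H^1(R), with weak derivative g *)
Definition H1_with (f g : R -> R) : Prop :=
  [/\ L2 f, L2 g & weak_derivative f g].

Definition H1 (f : R -> R) : Prop := exists g, H1_with f g.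

(* u is in C(A, H^1(R)), with weak x-derivative ux *)
Definition continuous_H1_with (A : set R) (u ux : R -> R -> R) : Prop :=
  forall t, A t ->
    [/\ H1_with (u t) (ux t),
        L2norm (u r \- u t) @[r --> within A (nbhs t)] --> 0%E &
        L2norm (ux r \- ux t) @[r --> within A (nbhs t)] --> 0%E].

Definition continuous_H1 (A : set R) (u : R -> R -> R) : Prop :=
  exists ux, continuous_H1_with A u ux.

Definition cos_transform (phi : R -> R) : R -> R :=
  fun xi => \int[mu]_x (phi x * cos (x * xi)).

Definition sin_transform (phi : R -> R) : R -> R :=
  fun xi => \int[mu]_x (phi x * sin (x * xi)).

(* The L^2 Fourier transform of f, for the convention
   hat f (xi) = int f(x) e^{-i x xi} dx, is a - i b; it is determined by the
   duality  int (hat f) phi = int f (hat phi). *)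
Definition fourier_L2 (f a b : R -> R) : Prop :=
  [/\ L2 f, L2 a, L2 b &
    forall phi, test_function phi ->
      \int[mu]_xi (a xi * phi xi) = \int[mu]_x (f x * cos_transform phi x) /\
      \int[mu]_xi (b xi * phi xi) = \int[mu]_x (f x * sin_transform phi x)].

(* The squared H^s norm, for s >= 0.  Fourier transforms are unique almost
   everywhere, so the infimum ranges over at most one value, and it is +oo
   when f is not in H^s(R). *)
Definition Hs_normsq (s : R) (f : R -> R) : \bar R :=
  ereal_inf [set N | exists a b, fourier_L2 f a b /\
    N = (\int[mu]_xi ((1 + xi ^+ 2) `^ s * (a xi ^+ 2 + b xi ^+ 2))%:E)%E].

Definition Hs (s : R) (f : R -> R) : Prop := (Hs_normsq s f < +oo)%E.

Definition continuous_Hs (s : R) (A : set R) (u : R -> R -> R) : Prop :=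
  forall t, A t ->
    Hs s (u t) /\
    Hs_normsq s (u r \- u t) @[r --> within A (nbhs t)] --> 0%E.

(* The distribution f - f'' + C is a positive Radon measure. *)
Definition momentum_ge (C : R) (f : R -> R) : Prop :=
  exists nu : {measure set (measurableTypeR R) -> \bar R},
    (forall A : set R, compact A -> (nu A < +oo)%E) /\
    forall phi, test_function phi ->
      \int[mu]_x (f x * (phi x - derive1n 2 phi x)) + C * \int[mu]_x phi x =
      \int[nu]_x phi x.

End FunctionSpaces.

Section CamassaHolm.
Context {R : realType}.
Local Notation mu := (@lebesgue_measure R).

(* J is an open interval of times.  The double integral is written as an
   iterated one: its inner integral depends only on the classes in H^1(R) of
   the functions u t, so that no joint measurability of the chosen
   representatives is needed. *)
Definition weak_solution (k : R) (J : set R) (u : R -> R -> R) : Prop :=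
  exists ux, continuous_H1_with J u ux /\
    forall phi, spacetime_test_function J phi ->
      \int[mu]_(t in J) \int[mu]_x
        (u t x * (dt phi t x - dx (dx (dt phi)) t x + 2 * k * dx phi t x)
         + u t x ^+ 2 * (3 * dx phi t x / 2 - dx (dx (dx phi)) t x / 2)
         + ux t x ^+ 2 * (dx phi t x / 2)) = 0.

Definition ae_equal (f g : R -> R) : Prop := {ae mu, forall x, f x = g x}.

Definition Hs_solution (k s T : R) (u0 : R -> R) (u : R -> R -> R) : Prop :=
  [/\ continuous_Hs s `[0, T] u, weak_solution k `]0, T[ u
    & ae_equal (u 0) u0].

Definition unique_Hs_solution (k s T : R) (u0 : R -> R) (u : R -> R -> R)
    : Prop :=
  Hs_solution k s T u0 u /\
  forall v, Hs_solution k s T u0 v ->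
    forall t, 0 <= t <= T -> ae_equal (v t) (u t).

Definition global_solution (k : R) (u0 : R -> R) (u : R -> R -> R) : Prop :=
  [/\ continuous_H1 `[0, +oo[ u, weak_solution k `]0, +oo[ u
    & ae_equal (u 0) u0].

(* Every lower bound on the momentum u - u_xx valid on some [0, T] also holds
   for v there. *)
Definition keeps_momentum_bounds (u v : R -> R -> R) : Prop :=
  forall T C, (forall t, 0 <= t <= T -> momentum_ge C (u t)) ->
    forall t, 0 <= t <= T -> momentum_ge C (v t).

(* Uniqueness is required only among competitors that keep the lower bounds
   on the momentum enjoyed by u (positivity, for k = 0): this is implied by
   uniqueness among all global weak solutions, and is the uniqueness that the
   known results for positive momentum provide. *)
Definition unique_global_solution (k : R) (u0 : R -> R) (u : R -> R -> R)
    : Prop :=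
  global_solution k u0 u /\
  forall v, global_solution k u0 v -> keeps_momentum_bounds u v ->
    forall t, 0 <= t -> ae_equal (v t) (u t).

Definition x_symmetric (J : set R) (u : R -> R -> R) : Prop :=
  exists lambda : R -> R,
    (forall t, J t ->
      derivable lambda t 1 /\ {for t, continuous (derive1 lambda)}) /\
    forall t, J t -> ae_equal (u t) (fun x => u t (2 * lambda t - x)).

Definition traveling_wave (A : set R) (u : R -> R -> R) : Prop :=
  exists (c : R) (U : R -> R),
    forall t, A t -> ae_equal (u t) (fun x => U (x - c * t)).

End CamassaHolm.

(* Main.v *)
Require Import Defs.
From mathcomp Require Import all_boot all_order all_algebra.
From mathcomp Require Import all_classical all_reals all_analysis.
From mathcomp Require Import measurable_realfun.
From mathcomp Require Import ring lra.
Import Order.TTheory GRing.Theory Num.Theory.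
Import numFieldNormedType.Exports.
Local Open Scope classical_set_scope.
Local Open Scope ring_scope.

(** The idea is to freeze the symmetric solution at a time t0, to let its profile
    travel from then on at the speed of the axis of symmetry at t0, and to check
    that this is a solution too; uniqueness then identifies it with u.

    A curve u in H^1 is observed through its moments int u(t) (psi - psi''), which
    test the momentum u - u_xx.  Product test functions and the lemma of du
    Bois-Reymond show that the moments of a weak solution are differentiable,
    with derivative the flux
      F(t, psi) = int 2 k u psi' + u^2 (3 psi' / 2 - psi''' / 2) + u_x^2 psi' / 2
    (weak_evolution); conversely, a curve whose moments evolve in this way is a
    weak solution (evolution_weak).  If u is symmetric about lambda(t), its
    moment against g = psi - psi'' equals the one against g(2 lambda(t) - x).
    The flux is odd under reflection, so that comparing the two derivatives gives
      F(t, psi) = lambda'(t) int u(t) (psi - psi'')'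
    (symmetric_profile): at each time, u(t) satisfies the profile equation of a
    wave of speed lambda'(t).  Hence the curve that follows u up to t0 and is
    u(t0, x - lambda'(t0) (t - t0)) afterwards has moments that evolve by the flux
    (stopped_evolution) and is a weak solution (stopped_weak_solution).

    This competitor stays in the class where u is unique: translations are
    continuous in L^2 (L2_translation) and in H^s (Hs_translation), and keep lower
    bounds on the momentum (momentum_ge_shift).  So u itself travels at speed
    lambda'(t0) after t0, for each t0.  If lambda' took two values, a profile
    would be invariant under a nonzero translation, and a function of L^2 with
    this property is null (translation_invariant_eq0); so u is a single wave at
    positive times, or zero (rigid_motion).

    The initial time is reached by continuity.  In H^s, continuity is expressed
    by L^2 Fourier transforms, defined by duality; it yields the initial datum
    tested against transforms of test functions, which determine it because the
    transform is injective (fourier_injective).  Injectivity comes from the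
    autocorrelation of f, which is continuous, is the squared norm of f at 0, and
    is orthogonal to Fejer kernels if f is orthogonal to all transforms. *)

Set Implicit Arguments.
Unset Strict Implicit.
Unset Printing Implicit Defensive.

(** * Square-integrable functions *)

Section L2.
Context {R : realType}.
Local Notation mu := (@lebesgue_measure R).
Implicit Types f g h : R -> R.

Definition lint (f : R -> R) : R := \int[mu]_x f x.

Definition summable f := mu.-integrable [set: R] (EFin \o f).

Lemma summable_meas f : summable f -> measurable_fun setT f.
Proof. by move=> /integrableP[/measurable_EFinP]. Qed.

Lemma summableD f g : summable f -> summable g -> summable (fun x => f x + g x).
Proof.
move=> sf sg; rewrite /summable.
have -> : EFin \o (fun x => f x + g x) = (EFin \o f) \+ (EFin \o g) by [].
exact: integrableD.
Qed.

Lemma summableZ c f : summable f -> summable (fun x => c * f x).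
Proof.
move=> sf; rewrite /summable.
exact: (@integrableZl _ _ _ mu setT measurableT c (EFin \o f)).
Qed.

Lemma summableB f g : summable f -> summable g -> summable (fun x => f x - g x).
Proof.
move=> sf sg; have := summableD sf (summableZ (-1) sg).
by under eq_fun do rewrite mulN1r.
Qed.

Lemma le_summable f g : measurable_fun setT f -> summable g ->
  (forall x, `|f x| <= g x) -> summable f.
Proof.
move=> mf sg fg; apply: (le_integrable measurableT _ _ sg).
  exact/measurable_EFinP.
move=> x _ /=; rewrite lee_fin (le_trans (fg x)) //; exact: ler_norm.
Qed.

Lemma summable_norm f : summable f -> summable (fun x => `|f x|).
Proof. by move=> sf; exact: integrable_norm. Qed.

Lemma intD f g : summable f -> summable g ->
  lint (fun x => f x + g x) = lint f + lint g.
Proof. exact: RintegralD. Qed.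

Lemma intB f g : summable f -> summable g ->
  lint (fun x => f x - g x) = lint f - lint g.
Proof. exact: RintegralB. Qed.

Lemma intZ c f : summable f -> lint (fun x => c * f x) = c * lint f.
Proof. by move=> sf; exact: RintegralZl. Qed.

Lemma int_le f g : summable f -> summable g -> (forall x, f x <= g x) ->
  lint f <= lint g.
Proof. by move=> sf sg fg; apply: le_Rintegral => // x _; exact: fg. Qed.

Lemma int_norm_le f g : summable f -> summable g -> (forall x, `|f x| <= g x) ->
  `|lint f| <= lint g.
Proof.
move=> sf sg fg; apply: (le_trans (le_normr_Rintegral measurableT sf)).
by apply: int_le => //; exact: summable_norm.
Qed.

(** All further arguments go through the integral of the square, which is easier
    to estimate than the p-norm of the definition. *)
Lemma L2P f : L2 f <-> measurable_fun setT f /\ summable (fun x => f x ^+ 2).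
Proof.
split=> [Lf|[mf sf]].
  split; last exact: Lfun2_integrable_sqr.
  by move: Lf; rewrite /L2 inE => /andP[] /[!inE].
rewrite /L2 inE; apply/andP; split; rewrite inE//=.
rewrite /finite_norm unlock /Lnorm poweR_lty//.
move/integrableP : sf => [_]; congr (_ < _)%E.
apply: eq_integral => x _ /=.
by rewrite powR_mulrn// normrX.
Qed.

Definition norm2 f := Num.sqrt (lint (fun x => f x ^+ 2)).

Lemma norm2_ge0 f : 0 <= norm2 f. Proof. exact: sqrtr_ge0. Qed.

Lemma int_sqr_ge0 f : 0 <= lint (fun x => f x ^+ 2).
Proof. by apply: Rintegral_ge0 => x _; exact: sqr_ge0. Qed.

Lemma norm2_sqr f : norm2 f ^+ 2 = lint (fun x => f x ^+ 2).
Proof. by rewrite sqr_sqrtr// int_sqr_ge0. Qed.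

Lemma L2normE f : L2 f -> L2norm f = (norm2 f)%:E.
Proof.
move=> /L2P[mf sf]; rewrite /L2norm unlock /Lnorm /norm2.
transitivity ((\int[mu]_x (f x ^+ 2)%:E) `^ 2^-1)%E.
  congr (_ `^ _)%E; apply: eq_integral => x _ /=.
  by rewrite powR_mulrn// -normrX ger0_norm ?sqr_ge0.
rewrite -[X in (X `^ _)%E]fineK; last first.
  by apply: integrable_fin_num => //; exact: sf.
by rewrite poweR_EFin -powR12_sqrt// int_sqr_ge0.
Qed.

Lemma L2_meas f : L2 f -> measurable_fun setT f.
Proof. by move=> /L2P[]. Qed.

Lemma L2_summable_sqr f : L2 f -> summable (fun x => f x ^+ 2).
Proof. by move=> /L2P[]. Qed.

Lemma L2_mul f g : L2 f -> L2 g -> summable (fun x => f x * g x).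
Proof.
move=> /L2P[mf sf] /L2P[mg sg].
apply: (@le_summable _ (fun x => f x ^+ 2 + g x ^+ 2)).
- exact: measurable_funM.
- exact: summableD.
- move=> x; rewrite ler_norml; apply/andP; split.
    rewrite -subr_ge0 opprK.
    have -> : f x * g x + (f x ^+ 2 + g x ^+ 2) =
      ((f x + g x) ^+ 2 + f x ^+ 2 + g x ^+ 2) / 2 by field.
    by rewrite divr_ge0// !addr_ge0// sqr_ge0.
  rewrite -subr_ge0.
  have -> : f x ^+ 2 + g x ^+ 2 - f x * g x =
      ((f x - g x) ^+ 2 + f x ^+ 2 + g x ^+ 2) / 2 by field.
  by rewrite divr_ge0// !addr_ge0// sqr_ge0.
Qed.

Lemma L2D f g : L2 f -> L2 g -> L2 (fun x => f x + g x).
Proof.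
move=> Lf Lg; apply/L2P; split.
  by apply: measurable_funD; exact: L2_meas.
have -> : (fun x => (f x + g x) ^+ 2) =
  (fun x => (f x ^+ 2 + 2 * (f x * g x)) + g x ^+ 2).
  by apply/funext => x; ring.
apply: summableD; last exact: L2_summable_sqr.
apply: summableD; first exact: L2_summable_sqr.
by apply: summableZ; exact: L2_mul.
Qed.

Lemma L2Z c f : L2 f -> L2 (fun x => c * f x).
Proof.
move=> Lf; apply/L2P; split.
  by apply: measurable_funM => //; exact: L2_meas.
under eq_fun do rewrite exprMn.
by apply: summableZ; exact: L2_summable_sqr.
Qed.

Lemma L2B f g : L2 f -> L2 g -> L2 (fun x => f x - g x).
Proof.
move=> Lf Lg; have := L2D Lf (L2Z (-1) Lg).
by under eq_fun do rewrite mulN1r.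
Qed.

Lemma L2_mul_bounded f g C : L2 f -> measurable_fun setT g ->
  (forall x, `|g x| <= C) -> L2 (fun x => f x * g x).
Proof.
move=> Lf mg gC; apply/L2P; split.
  by apply: measurable_funM => //; exact: L2_meas.
apply: (@le_summable _ (fun x => C ^+ 2 * f x ^+ 2)).
- by apply: measurable_funX; apply: measurable_funM => //; exact: L2_meas.
- by apply: summableZ; exact: L2_summable_sqr.
- move=> x; rewrite ger0_norm ?sqr_ge0// exprMn mulrC ler_wpM2r ?sqr_ge0//.
  rewrite -[leLHS]ger0_norm ?sqr_ge0// normrX.
  have C0 : 0 <= C by exact: le_trans (gC x).
  by rewrite !expr2; exact: ler_pM.
Qed.

(** The quadratic form int (s f + t g)^2 in (s, t) is nonnegative, hence has
    nonpositive discriminant; evaluate it at (c, - b). *)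
Lemma cauchy_schwarz f g : L2 f -> L2 g ->
  `|lint (fun x => f x * g x)| <= norm2 f * norm2 g.
Proof.
move=> Lf Lg.
set a := lint (fun x => f x ^+ 2); set b := lint (fun x => f x * g x).
set c := lint (fun x => g x ^+ 2).
have q (s t : R) : 0 <= s ^+ 2 * a + (2 * s * t) * b + t ^+ 2 * c.
  have : 0 <= lint (fun x => (s * f x + t * g x) ^+ 2) by exact: int_sqr_ge0.
  have -> : (fun x => (s * f x + t * g x) ^+ 2) = (fun x =>
     (s ^+ 2 * f x ^+ 2 + (2 * s * t) * (f x * g x)) + t ^+ 2 * g x ^+ 2).
    by apply/funext => x; ring.
  have [[sf sg] sfg] := (L2_summable_sqr Lf, L2_summable_sqr Lg, L2_mul Lf Lg).
  rewrite intD; [|by apply: summableD; exact: summableZ|exact: summableZ].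
  rewrite intD; [|exact: summableZ|exact: summableZ].
  by rewrite !intZ.
have a0 : 0 <= a by exact: int_sqr_ge0.
have c0 : 0 <= c by exact: int_sqr_ge0.
rewrite -(@ler_pXn2r _ 2)// ?nnegrE ?mulr_ge0 ?norm2_ge0//.
rewrite exprMn !norm2_sqr -/a -/c -normrX ger0_norm ?sqr_ge0//.
have [c_eq0|c_neq0] := eqVneq c 0.
  have [-> |b_neq0] := eqVneq b 0; first by rewrite expr0n/= mulr_ge0.
  (* without a t^2 term the form is not bounded below unless b = 0 *)
  have := q b (- (a + 1) / 2).
  rewrite c_eq0.
  have -> : b ^+ 2 * a + 2 * b * (- (a + 1) / 2) * b + (- (a + 1) / 2) ^+ 2 * 0 =
    - b ^+ 2 by field.
  by rewrite oppr_ge0 mulr0.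
have c_gt0 : 0 < c by rewrite lt_neqAle eq_sym c_neq0.
have := q c (- b).
have -> : c ^+ 2 * a + 2 * c * - b * b + (- b) ^+ 2 * c = c * (a * c - b ^+ 2).
  by ring.
by rewrite pmulr_rge0// subr_ge0.
Qed.

Lemma norm2D f g : L2 f -> L2 g -> norm2 (fun x => f x + g x) <= norm2 f + norm2 g.
Proof.
move=> Lf Lg; rewrite -(@ler_pXn2r _ 2)// ?nnegrE ?addr_ge0 ?norm2_ge0//.
rewrite norm2_sqr.
have -> : (fun x => (f x + g x) ^+ 2) =
  (fun x => (f x ^+ 2 + 2 * (f x * g x)) + g x ^+ 2).
  by apply/funext => x; ring.
have [[sf sg] sfg] := (L2_summable_sqr Lf, L2_summable_sqr Lg, L2_mul Lf Lg).
rewrite intD; [|by apply: summableD => //; exact: summableZ|by []].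
rewrite intD; [|by []|exact: summableZ].
rewrite intZ// -!norm2_sqr sqrrD lerD2r lerD2l -[leRHS]mulr_natl ler_pM2l//.
by apply: le_trans (cauchy_schwarz Lf Lg); exact: ler_norm.
Qed.

Lemma norm2Z c f : L2 f -> norm2 (fun x => c * f x) = `|c| * norm2 f.
Proof.
move=> Lf; rewrite /norm2; under [X in lint X]eq_fun do rewrite exprMn.
rewrite intZ; last exact: L2_summable_sqr.
by rewrite sqrtrM ?sqr_ge0// sqrtr_sqr.
Qed.

Lemma norm2N f : norm2 (fun x => - f x) = norm2 f.
Proof. by rewrite /norm2; under eq_fun do rewrite sqrrN. Qed.

Lemma norm2_distC f g :
  norm2 (fun x => f x - g x) = norm2 (fun x => g x - f x).
Proof. by rewrite -norm2N; congr norm2; apply/funext => x; rewrite opprB. Qed.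

Lemma norm2_triangle h f g : L2 f -> L2 g -> L2 h ->
  norm2 (fun x => f x - g x) <=
  norm2 (fun x => f x - h x) + norm2 (fun x => h x - g x).
Proof.
move=> Lf Lg Lh; have := norm2D (L2B Lf Lh) (L2B Lh Lg).
by rewrite (_ : (fun x => _ + _) = (fun x => f x - g x))//; apply/funext => x; ring.
Qed.

Lemma norm2_mul_bounded f g C : L2 f -> measurable_fun setT g -> 0 <= C ->
  (forall x, `|g x| <= C) -> norm2 (fun x => f x * g x) <= C * norm2 f.
Proof.
move=> Lf mg C0 gC; rewrite -[X in X * _]ger0_norm// -norm2Z//.
rewrite /norm2 ler_wsqrtr// int_le//.
- by apply: L2_summable_sqr; exact: L2_mul_bounded gC.
- by apply: L2_summable_sqr; exact: L2Z.
- move=> x; rewrite !exprMn mulrC ler_wpM2r ?sqr_ge0//.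
  rewrite -[leLHS]ger0_norm ?sqr_ge0// normrX.
  by rewrite !expr2; exact: ler_pM.
Qed.

#[global] Instance lebesgue_ae_filter : Filter (nbhs (almost_everywhere mu)).
Proof. exact: (ae_filter_ringOfSetsType mu). Qed.

Lemma norm2_eq0 f : L2 f -> norm2 f = 0 -> ae_equal f (fun=> 0).
Proof.
move=> /L2P[mf sf] /eqP.
rewrite -(eqrXn2 (n := 2))// ?norm2_ge0// norm2_sqr expr0n/= => /eqP f0.
have /(ae_eq_integral_abs mu measurableT) : measurable_fun setT (fun x => (f x ^+ 2)%:E).
  by apply/measurable_EFinP; exact: measurable_funX.
move=> [+ _]; case.
  under eq_integral do rewrite gee0_abs ?lee_fin ?sqr_ge0//.
  rewrite -[LHS]fineK; first by congr EFin.
  exact: integrable_fin_num.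
move=> N [mN N0 sub]; exists N; split => //.
apply: subset_trans sub => x /= h1 h2; apply: h1.
by move: (h2 I) => [] /eqP; rewrite sqrf_eq0 => /eqP.
Qed.

Lemma ae_equal_refl f : ae_equal f f.
Proof. exact: aeW. Qed.

Lemma ae_equal_sym f g : ae_equal f g -> ae_equal g f.
Proof. by apply: filterS => x ->. Qed.

Lemma ae_equal_trans f g h : ae_equal f g -> ae_equal g h -> ae_equal f h.
Proof. by apply: filterS2 => x -> ->. Qed.

Lemma int_ae_eq f g : measurable_fun setT f -> measurable_fun setT g ->
  ae_equal f g -> lint f = lint g.
Proof.
move=> mf mg fg; rewrite /Rintegral; congr fine; apply: ae_eq_integral => //.
- exact/measurable_EFinP.
- exact/measurable_EFinP.
- by apply: filterS fg => x /= ->.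
Qed.

Lemma norm2_ae0 f : L2 f -> ae_equal f (fun=> 0) -> norm2 f = 0.
Proof.
move=> Lf f0; rewrite /norm2 (@int_ae_eq _ (fun=> 0)) ?/lint ?Rintegral_cst//=.
- by rewrite mul0r sqrtr0.
- by apply: measurable_funX; exact: L2_meas.
- by apply: filterS f0 => x ->; rewrite expr0n.
Qed.

End L2.

(** * Translations and reflections preserve Lebesgue measure *)

Section MeasurePreserving.
Context {R : realType}.
Local Notation mu := (@lebesgue_measure R).
Implicit Types (f g : R -> R) (phi : R -> R).

Definition preserving phi := measurable_fun setT phi /\
  forall A : set R, measurable A -> mu (phi @^-1` A) = mu A.

(** Lebesgue measure is determined by its values on intervals. *)
Lemma preserving_shift h : preserving (fun x => x + h).
Proof.
have mphi : measurable_fun setT (fun x : R => x + h) by exact: measurable_funD.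
split=> // A mA.
pose phi : measurableTypeR R -> measurableTypeR R := fun x => x + h.
have mphi' : measurable_fun setT phi by [].
apply/esym; rewrite -[RHS]/(pushforward mu phi A).
apply: lebesgue_measure_unique => //= _ [[a b]] _ <-.
rewrite /pushforward.
have -> : phi @^-1` [set` `]a, b]] = `]a - h, b - h]%classic.
  by apply/seteqP; split=> x /=; rewrite !in_itv/= /phi => /andP[? ?];
    apply/andP; split; lra.
rewrite !lebesgue_measure_itv/= !lte_fin ltrD2r.
by case: ifPn => // _; rewrite -!EFinD; congr EFin; ring.
Qed.

Lemma preserving_reflect c : preserving (fun x => c - x).
Proof.
have mphi : measurable_fun setT (fun x : R => c - x) by exact: measurable_funB.
split=> // A mA.
pose phi : measurableTypeR R -> measurableTypeR R := fun x => c - x.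
have mphi' : measurable_fun setT phi by [].
apply/esym; rewrite -[RHS]/(pushforward mu phi A).
apply: lebesgue_measure_unique => //= _ [[a b]] _ <-.
rewrite /pushforward.
have -> : phi @^-1` [set` `]a, b]] = `[c - b, c - a[%classic.
  by apply/seteqP; split=> x /=; rewrite !in_itv/= /phi => /andP[? ?];
    apply/andP; split; lra.
rewrite !lebesgue_measure_itv/= !lte_fin ltrD2l ltrN2.
by case: ifPn => // _; rewrite -!EFinD; congr EFin; ring.
Qed.

Lemma ge0_integral_preserving phi (f : R -> \bar R) : preserving phi ->
  measurable_fun setT f -> (forall x, (0 <= f x)%E) ->
  (\int[mu]_x f (phi x) = \int[mu]_x f x)%E.
Proof.
move=> [mphi pphi] mf f0.
pose psi : measurableTypeR R -> measurableTypeR R := phi.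
have mpsi : measurable_fun setT psi by [].
have := @ge0_integral_pushforward _ _ _ _ _ psi mpsi mu setT f measurableT mf
  (fun x _ => f0 x).
rewrite preimage_setT => <-.
by apply: eq_measure_integral => //= A mA _; exact: pphi.
Qed.

Lemma integral_preserving phi (f : R -> \bar R) : preserving phi ->
  measurable_fun setT f -> (\int[mu]_x f (phi x) = \int[mu]_x f x)%E.
Proof.
move=> pphi mf; rewrite [LHS]integralE [RHS]integralE.
rewrite -(@ge0_integral_preserving phi f^\+%E)//; last exact: measurable_funepos.
rewrite -(@ge0_integral_preserving phi f^\-%E)//; last exact: measurable_funeneg.
rewrite -[LHS]/(\int[mu]_x (f \o phi)^\+ x - \int[mu]_x (f \o phi)^\- x)%E.
by rewrite funepos_comp funeneg_comp.
Qed.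

Lemma lint_preserving phi f : preserving phi -> measurable_fun setT f ->
  lint (fun x => f (phi x)) = lint f.
Proof.
move=> pphi mf; rewrite /lint /Rintegral.
by rewrite (@integral_preserving phi (EFin \o f))//; exact/measurable_EFinP.
Qed.

Lemma meas_preserving phi f : preserving phi -> measurable_fun setT f ->
  measurable_fun setT (fun x => f (phi x)).
Proof.
move=> [mphi _] mf.
exact: (@measurableT_comp _ _ _ _ _ _ f _ phi).
Qed.

Lemma summable_preserving phi f : preserving phi -> summable f ->
  summable (fun x => f (phi x)).
Proof.
move=> pphi sf; have mf := summable_meas sf.
apply/integrableP; split.
  by apply/measurable_EFinP; exact: meas_preserving.
move/integrableP : sf => [_]; congr (_ < _)%E.
rewrite -(@ge0_integral_preserving phi (fun x => `|(f x)%:E|)%E)//.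
by apply: measurableT_comp => //; exact/measurable_EFinP.
Qed.

Lemma L2_preserving phi f : preserving phi -> L2 f -> L2 (fun x => f (phi x)).
Proof.
move=> pphi /L2P[mf sf]; apply/L2P; split; first exact: meas_preserving.
exact: (summable_preserving pphi sf).
Qed.

Lemma norm2_preserving phi f : preserving phi -> measurable_fun setT f ->
  norm2 (fun x => f (phi x)) = norm2 f.
Proof.
move=> pphi mf; rewrite /norm2 (lint_preserving (f := fun x => f x ^+ 2))//.
exact: measurable_funX.
Qed.

Lemma ae_preserving phi (P : R -> Prop) : preserving phi ->
  {ae mu, forall x, P x} -> {ae mu, forall x, P (phi x)}.
Proof.
move=> [mphi pphi] [N [mN N0 sub]].
exists (phi @^-1` N); split.
- by rewrite -[X in measurable X]setTI; exact: mphi.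
- by rewrite pphi.
- by move=> x /= nP; exact: sub.
Qed.

End MeasurePreserving.

(** * Derivatives and smooth functions *)

Section Derivatives.
Context {R : realType}.
Implicit Types (f g F : R -> R) (x d e : R).

Lemma near0_le (r : R) : 0 < r -> \forall h \near (0 : R), `|h| <= r.
Proof.
move=> r0; apply/nbhs_ballP; exists r => //= h; rewrite /ball/= sub0r normrN.
exact: ltW.
Qed.

(** The form of differentiability in which remainders can be estimated. *)
Lemma is_deriveP f x d : is_derive x (1 : R) f d <->
  forall e, 0 < e ->
    \forall h \near (0 : R), `|f (x + h) - f x - h * d| <= e * `|h|.
Proof.
split=> [[df fd] e e0|fd].
  have : h^-1 *: (f (h *: 1 + x) - f x) @[h --> 0^'] --> d.
    by rewrite -fd; exact: df.
  move/cvgrPdist_le => /(_ _ e0) /=.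
  move=> H0; have {}H0 : \forall t \near (0 : R), t != 0 ->
    `|d - t^-1 *: (f (t *: 1 + x) - f x)| <= e := H0.
  apply: filterS H0 => h /= H.
  have [->|h0] := eqVneq h 0; first by rewrite addr0 subrr mul0r subr0 normr0 mulr0.
  have := H h0; rewrite /GRing.scale /= mulr1 (addrC h) => {}H.
  have -> : f (x + h) - f x - h * d = - (d - h^-1 * (f (x + h) - f x)) * h by field.
  by rewrite normrM normrN ler_wpM2r.
have : h^-1 *: (f (h *: 1 + x) - f x) @[h --> 0^'] --> d.
  apply/cvgrPdist_le => e e0.
  suff H : \forall t \near (0 : R), t != 0 ->
    `|d - t^-1 *: (f (t *: 1 + x) - f x)| <= e by exact: H.
  near=> h => h0; rewrite /GRing.scale /= mulr1 (addrC h).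
  have -> : d - h^-1 * (f (x + h) - f x) =
    - (f (x + h) - f x - h * d) * h^-1 by field.
  rewrite normrM normrN normfV ler_pdivrMr ?normr_gt0//.
  by near: h; exact: fd.
move=> H; split; first by apply/cvg_ex; exists d.
exact/cvg_lim.
Unshelve. all: by end_near.
Qed.

Lemma is_derive_quadratic f x d C r : 0 < r ->
  (forall h, `|h| <= r -> `|f (x + h) - f x - h * d| <= C * h ^+ 2) ->
  is_derive x (1 : R) f d.
Proof.
move=> r0 fC; apply/is_deriveP => e e0.
pose C' := `|C| + 1.
have C'0 : 0 < C' by rewrite /C' ltr_wpDl.
near=> h.
have hr : `|h| <= r by near: h; exact: near0_le.
have he : `|h| <= e / C' by near: h; apply: near0_le; rewrite divr_gt0.
rewrite (le_trans (fC _ hr))// -normr_id -real_normK ?num_real// expr2.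
rewrite normr_id mulrA ler_wpM2r//.
rewrite ler_pdivlMr// in he; rewrite mulrC (le_trans _ he)// ler_wpM2l//.
by rewrite /C' (le_trans (ler_norm C))// lerDl.
Unshelve. all: by end_near.
Qed.

Lemma is_derive_continuous f x d : is_derive x (1 : R) f d ->
  {for x, continuous f}.
Proof.
by move=> [df _]; apply/differentiable_continuous/derivable1_diffP.
Qed.

Lemma is_derive1E f x d : is_derive x (1 : R) f d -> (derive1 f) x = d.
Proof. by move=> fd; rewrite derive1E derive_val. Qed.

Lemma derivable_is_derive f x : derivable f x 1 -> is_derive x (1 : R) f ((derive1 f) x).
Proof. by move=> df; rewrite derive1E; exact/derivableP. Qed.

Lemma is_deriveD1 f g x d e : is_derive x (1 : R) f d -> is_derive x (1 : R) g e ->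
  is_derive x (1 : R) (fun y => f y + g y) (d + e).
Proof. exact: is_deriveD. Qed.

Lemma is_deriveB1 f g x d e : is_derive x (1 : R) f d -> is_derive x (1 : R) g e ->
  is_derive x (1 : R) (fun y => f y - g y) (d - e).
Proof. exact: is_deriveB. Qed.

Lemma is_deriveM1 f g x d e : is_derive x (1 : R) f d -> is_derive x (1 : R) g e ->
  is_derive x (1 : R) (fun y => f y * g y) (d * g x + f x * e).
Proof.
move=> fd ge; have := is_deriveM fd ge.
by rewrite /GRing.scale/= addrC [g x * d]mulrC.
Qed.

Lemma is_derive_comp1 f g x d e : is_derive (g x) (1 : R) f d ->
  is_derive x (1 : R) g e -> is_derive x (1 : R) (fun y => f (g y)) (d * e).
Proof. exact: is_derive1_comp. Qed.

Lemma is_derive_cst1 (c x : R) : is_derive x (1 : R) (fun=> c) 0.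
Proof. exact: is_derive_cst. Qed.

Lemma is_deriveZ1 f c x d : is_derive x (1 : R) f d ->
  is_derive x (1 : R) (fun y => c * f y) (c * d).
Proof. by move=> fd; have := is_deriveM1 (is_derive_cst1 c x) fd; rewrite mul0r add0r. Qed.

Lemma is_derive_affine a b x : is_derive x (1 : R) (fun y => a * y + b) a.
Proof.
have := is_deriveD1 (is_deriveZ1 a (is_derive_id x (1 : R))) (is_derive_cst1 b x).
by rewrite mulr1 addr0.
Qed.

Lemma is_derive_near f g x d : (\forall y \near x, f y = g y) ->
  is_derive x (1 : R) f d -> is_derive x (1 : R) g d.
Proof.
move=> fg /is_deriveP fd; apply/is_deriveP => e e0.
have fgx : f x = g x by exact: nbhs_singleton fg.
have fg' : \forall h \near (0 : R), f (x + h) = g (x + h).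
  move: fg; rewrite (near_shift 0 x) subr0.
  by apply: filterS => h; rewrite /= addrC.
by apply: filterS2 fg' (fd e e0) => h <-; rewrite fgx.
Qed.

Lemma near_lt_cst (a b : R) : a < b -> \forall y \near a, y < b.
Proof. by move=> ab; apply: (lt_nbhsl ab). Qed.

Lemma near_gt_cst (a b : R) : b < a -> \forall y \near a, b < y.
Proof. by move=> ab; apply: (lt_nbhsr ab). Qed.

Lemma MVT_is_derive f (df : R -> R) a b : a <= b ->
  (forall x, is_derive x (1 : R) f (df x)) ->
  exists2 c, a <= c <= b & f b - f a = df c * (b - a).
Proof.
move=> ab fd.
have cf : {within `[a, b], continuous f}.
  by apply: continuous_subspaceT => x; exact: is_derive_continuous (fd x).
have [c] := @MVT_segment R f df a b ab (fun x _ => fd x) cf.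
by rewrite in_itv/= => cab ->; exists c.
Qed.

Lemma lipschitz_is_derive f (df : R -> R) C :
  (forall x, is_derive x (1 : R) f (df x)) -> (forall x, `|df x| <= C) ->
  forall x y, `|f y - f x| <= C * `|y - x|.
Proof.
move=> fd fC x y; wlog xy : x y / x <= y.
  move=> H; have [/H //|/ltW /H] := leP x y.
  by rewrite distrC (distrC y).
have [c _ ->] := MVT_is_derive xy fd.
by rewrite normrM ler_wpM2r.
Qed.

Lemma taylor1_is_derive f (df ddf : R -> R) C :
  (forall x, is_derive x (1 : R) f (df x)) ->
  (forall x, is_derive x (1 : R) df (ddf x)) ->
  (forall x, `|ddf x| <= C) ->
  forall x h, `|f (x + h) - f x - h * df x| <= C * h ^+ 2.
Proof.
move=> fd dfd ddfC x h.
pose g := fun y => f y - df x * y.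
have gd y : is_derive y (1 : R) g (df y - df x).
  have := is_deriveB1 (fd y) (is_deriveZ1 (df x) (is_derive_id y (1 : R))).
  by rewrite mulr1.
have -> : f (x + h) - f x - h * df x = g (x + h) - g x by rewrite /g; ring.
have C0 : 0 <= C by exact: le_trans (ddfC x).
wlog h0 : / 0 <= h.
  move=> H; have [/H //|h0] := leP 0 h.
  have xh : x + h <= x by lra.
  have [c /andP[c1 c2]] := MVT_is_derive xh gd.
  rewrite -opprB => /(congr1 -%R); rewrite opprK => ->.
  rewrite normrN normrM (_ : h ^+ 2 = `|h| * `|h|); last first.
    by rewrite -normrM -expr2 ger0_norm ?sqr_ge0.
  rewrite mulrA ler_pM//; last by rewrite opprD addrA subrr sub0r normrN.
  rewrite (le_trans (lipschitz_is_derive dfd ddfC x c))// ler_wpM2l//.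
  by rewrite ler_norml ltr0_norm//; apply/andP; split; lra.
have xh : x <= x + h by lra.
have [c /andP[c1 c2] ->] := MVT_is_derive xh gd.
rewrite normrM (_ : h ^+ 2 = `|h| * `|h|); last first.
  by rewrite -normrM -expr2 ger0_norm ?sqr_ge0.
rewrite mulrA ler_pM//; last by rewrite addrC addKr.
rewrite (le_trans (lipschitz_is_derive dfd ddfC x c))// ler_wpM2l//.
by rewrite ler_norml ger0_norm//; apply/andP; split; lra.
Qed.

End Derivatives.

Section Smooth.
Context {R : realType}.
Implicit Types (f g F : R -> R) (x d e : R).

Definition smooth (f : R -> R) : Prop := forall n x, derivable (derive1n n f) x 1.

Lemma smooth_is_derive f x : smooth f -> is_derive x (1 : R) f ((derive1 f) x).
Proof. by move=> sf; apply: derivable_is_derive; exact: (sf 0%N). Qed.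

Lemma smooth_derive f : smooth f -> smooth (derive1 f).
Proof. by move=> sf n x; rewrite -derive1Sn; exact: sf. Qed.

Lemma smooth_derive1n n f : smooth f -> smooth (derive1n n f).
Proof.
by elim: n => [//|n IH] sf; rewrite derive1nS; exact/smooth_derive/IH.
Qed.

Lemma smooth_primitive F f : (forall x, is_derive x (1 : R) F (f x)) ->
  smooth f -> smooth F.
Proof.
move=> Ff sf; have F'f : (derive1 F) = f by apply/funext => x; exact: is_derive1E.
move=> [|n] x; first by case: (Ff x).
by rewrite derive1Sn F'f; exact: sf.
Qed.

(** The way to prove smoothness when the derivatives are known only as members
    of a family. *)
Lemma smooth_closed (S : set (R -> R)) :
  (forall f, S f -> exists2 g, S g & forall x, is_derive x (1 : R) f (g x)) ->
  forall f, S f -> smooth f.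
Proof.
move=> SS f Sf n; elim: n f Sf => [|n IH] f Sf x; have [g Sg fg] := SS f Sf.
  by case: (fg x).
have f'g : (derive1 f) = g by apply/funext => y; exact: is_derive1E.
by rewrite derive1Sn f'g; exact: IH.
Qed.

Lemma smooth_continuous f : smooth f -> continuous f.
Proof. by move=> sf x; apply: is_derive_continuous (smooth_is_derive x sf). Qed.

Lemma smooth_cst c : smooth (fun=> c).
Proof.
apply: (@smooth_closed [set f | exists c, f = fun=> c]); last by exists c.
move=> _ [a ->]; exists (fun=> 0); first by exists 0.
by move=> x; exact: is_derive_cst1.
Qed.

(** The derivative of a product is a sum of two products of lower order: the
    induction that proves products smooth has to run over the order. *)
Definition derivable_upto k f :=
  forall j x, (j <= k)%N -> derivable (derive1n j f) x 1.

Lemma derivable_uptoD k f g : derivable_upto k f -> derivable_upto k g ->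
  derivable_upto k (fun x => f x + g x).
Proof.
move=> Df Dg j; elim: j k f g Df Dg => [|j IH] k f g Df Dg x jk.
  have := is_deriveD1 (derivable_is_derive (Df 0%N x isT))
    (derivable_is_derive (Dg 0%N x isT)).
  by case.
have -> : derive1n j.+1 (fun x => f x + g x) =
    derive1n j (fun x => derive1 f x + derive1 g x).
  rewrite derive1Sn; congr derive1n; apply/funext => y; apply: is_derive1E.
  by apply: is_deriveD1; apply: derivable_is_derive; [exact: (Df 0%N)|exact: (Dg 0%N)].
case: k jk Df Dg => // k; rewrite ltnS => jk Df Dg.
apply: (IH k) => // i y ik; rewrite -derive1Sn; [exact: Df|exact: Dg].
Qed.

Lemma smoothD f g : smooth f -> smooth g -> smooth (fun x => f x + g x).
Proof.
move=> sf sg n x; have su h : smooth h -> derivable_upto n h.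
  by move=> sh j y _; exact: sh.
have := @derivable_uptoD n f g (su _ sf) (su _ sg).
by move=> /(_ n x (leqnn n)).
Qed.

Lemma smoothM f g : smooth f -> smooth g -> smooth (fun x => f x * g x).
Proof.
move=> sf sg n x.
suff H : forall k f g, smooth f -> smooth g ->
  derivable_upto k (fun x => f x * g x) by exact: (H n).
move=> {x n f g sf sg} n; elim: n => [|k IH] f g sf sg [|j] x jk //.
- by case: (is_deriveM1 (smooth_is_derive x sf) (smooth_is_derive x sg)).
- by case: (is_deriveM1 (smooth_is_derive x sf) (smooth_is_derive x sg)).
have -> : derive1n j.+1 (fun x => f x * g x) =
    derive1n j (fun x => derive1 f x * g x + f x * derive1 g x).
  rewrite derive1Sn; congr derive1n; apply/funext => y; apply: is_derive1E.
  by apply: is_deriveM1; exact: smooth_is_derive.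
have := @derivable_uptoD k _ _ (IH _ _ (smooth_derive sf) sg)
  (IH _ _ sf (smooth_derive sg)).
by move=> /(_ j x jk).
Qed.

Lemma smoothZ c f : smooth f -> smooth (fun x => c * f x).
Proof. by move=> sf; exact: (@smoothM (fun=> c) f (@smooth_cst c) sf). Qed.

Lemma smoothB f g : smooth f -> smooth g -> smooth (fun x => f x - g x).
Proof.
move=> sf sg; have := smoothD sf (@smoothZ (-1) _ sg).
by under [X in smooth X]eq_fun do rewrite mulN1r.
Qed.

Lemma smooth_affine f a b : smooth f -> smooth (fun x => f (a * x + b)).
Proof.
move=> sf.
apply: (@smooth_closed [set h | exists2 p : R * (R -> R), smooth p.2
  & h = fun x => p.1 * p.2 (a * x + b)]); last first.
  by exists (1, f) => //; apply/funext => x; rewrite /= mul1r.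
move=> _ [[c g] /= sg ->]; exists (fun x => (c * a) * (derive1 g) (a * x + b)).
  by exists (c * a, derive1 g); [exact: smooth_derive|].
move=> x; rewrite -mulrA (mulrC a); apply: is_deriveZ1; apply: is_derive_comp1.
  exact: smooth_is_derive.
exact: is_derive_affine.
Qed.

Lemma smooth_sin_cos : smooth (@sin R) /\ smooth (@cos R).
Proof.
pose S : set (R -> R) := [set h | exists p : R * R,
  h = fun x => p.1 * sin x + p.2 * cos x].
have SS h : S h -> smooth h.
  apply: (@smooth_closed S) => _ [[a b] -> /=].
  exists (fun x => (- b) * sin x + a * cos x); first by exists (- b, a).
  move=> x; rewrite addrC mulNr -mulrN.
  by apply: is_deriveD1; apply: is_deriveZ1.
split; apply: SS.
  by exists (1, 0); apply/funext => x /=; ring.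
by exists (0, 1); apply/funext => x /=; ring.
Qed.

Lemma smooth_cosM y : smooth (fun x : R => cos (x * y)).
Proof.
have := @smooth_affine _ y 0 smooth_sin_cos.2.
by under eq_fun do rewrite addr0 mulrC.
Qed.

Lemma smooth_sinM y : smooth (fun x : R => sin (x * y)).
Proof.
have := @smooth_affine _ y 0 smooth_sin_cos.1.
by under eq_fun do rewrite addr0 mulrC.
Qed.

End Smooth.

(** * A smooth step *)

Section Bump.
Context {R : realType}.
Local Notation mu := (@lebesgue_measure R).
Implicit Types (f g F : R -> R) (x d e : R) (p : {poly R}).

Lemma primitive_exists f a : continuous f -> (forall x, x <= a -> f x = 0) ->
  exists2 F, forall x, is_derive x (1 : R) F (f x) &
    forall x, x <= a -> F x = 0.
Proof.
move=> cf f0; exists (fun x => \int[mu]_(t in `]-oo, x]) f t).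
  move=> x.
  have fi : mu.-integrable [set` `]-oo, x + 1]] (EFin \o f).
    apply/(integrable_mkcond _ _).2 => //.
    have -> : (EFin \o f) \_ `]-oo, x + 1] = (EFin \o f) \_ `[a, x + 1].
      apply/funext => y; rewrite !patchE.
      rewrite !mem_setE !in_itv/=.
      have [//|/ltW ya] := leP a y.
      by rewrite /= f0// if_same.
    apply/(integrable_mkcond _ _).1 => //.
    apply: continuous_compact_integrable; first exact: segment_compact.
    exact: continuous_subspaceT.
  have xx1 : x < x + 1 by rewrite ltrDl.
  have [dF F'] := continuous_FTC1 xx1 fi (ltNyr _) (cf x).
  by rewrite -F'; exact: derivable_is_derive.
move=> x xa; rewrite (@eq_Rintegral _ _ _ mu _ (fun=> 0)).
  by rewrite Rintegral_cst//= mul0r.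
by move=> y; rewrite inE/= in_itv/= => yx; rewrite f0// (le_trans yx).
Qed.

(** A polynomial in 1/x times e^(-1/x), extended by 0: the family that contains
    e^(-1/x) and is closed under differentiation. *)
Definition flat p x := if 0 < x then p.[x^-1] * expR (- x^-1) else 0.

Lemma poly_growth p : exists n C, 0 <= C /\ forall y, 1 <= y -> `|p.[y]| <= C * y ^+ n.
Proof.
elim/poly_ind: p => [|q c [n [C [C0 IH]]]].
  by exists 0%N, 0; split=> // y _; rewrite horner0 normr0 mul0r.
exists n.+1, (C + `|c|); split; first by rewrite addr_ge0.
move=> y y1; have y0 : 0 <= y by exact: le_trans y1.
rewrite hornerMXaddC (le_trans (ler_normD _ _))// mulrDl lerD//.
  by rewrite normrM (ger0_norm y0) exprSr mulrA ler_wpM2r// IH.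
by rewrite ler_peMr// exprn_ege1.
Qed.

(** Exponential decay beats every polynomial in 1/x; the quadratic bound gives
    differentiability at 0. *)
Lemma flat_quadratic p : exists C, forall h, `|h| <= 1 -> `|flat p h| <= C * h ^+ 2.
Proof.
have [n [C [C0 pC]]] := poly_growth p.
exists (C * n.+2`!%:R) => h h1; rewrite /flat; case: ifPn => [h0|_]; last first.
  by rewrite normr0 mulr_ge0 ?sqr_ge0// mulr_ge0.
rewrite gtr0_norm// in h1.
have y1 : 1 <= h^-1 by rewrite invf_ge1.
have y0 : 0 < h^-1 by rewrite invr_gt0.
rewrite normrM (ger0_norm (expR_ge0 _)).
have E : expR (- h^-1) <= n.+2`!%:R * h ^+ n.+2.
  rewrite expRN -[leRHS]invrK lef_pV2 ?posrE ?expR_gt0//; last first.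
    by rewrite invr_gt0 mulr_gt0 ?exprn_gt0// ltr0n fact_gt0.
  have := expR_ge1Dxn n.+1 (ltW y0); apply: le_trans.
  by rewrite invfM exprVn mulrC lerDr.
rewrite (le_trans (ler_pM _ _ (pC _ y1) E)) ?expR_ge0//.
have -> : C * h^-1 ^+ n * (n.+2`!%:R * h ^+ n.+2) =
  C * n.+2`!%:R * h ^+ 2 * (h^-1 ^+ n * h ^+ n).
  by rewrite [h ^+ n.+2](_ : _ = h ^+ 2 * h ^+ n); [ring|rewrite -exprD].
by rewrite -exprMn mulVf ?gt_eqF// expr1n mulr1.
Qed.

Lemma flat_is_derive p x :
  is_derive x (1 : R) (flat p) (flat ('X^2 * (p - p^`())) x).
Proof.
have [x0|x0|->] := ltgtP x 0.
- have -> : flat ('X^2 * (p - p^`())) x = 0 by rewrite /flat ltNge (ltW x0).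
  apply: (@is_derive_near _ (fun=> 0)).
  by apply: filterS (near_lt_cst x0) => y y0; rewrite /flat ltNge (ltW y0).
- have -> : flat ('X^2 * (p - p^`())) x =
    ('X^2 * (p - p^`())).[x^-1] * expR (- x^-1) by rewrite /flat x0.
  apply: (@is_derive_near _ (fun y => p.[y^-1] * expR (- y^-1))).
    by apply: filterS (near_gt_cst x0) => y y0; rewrite /flat y0.
  have xn0 : x != 0 by rewrite gt_eqF.
  have dV : is_derive x (1 : R) (fun y => y^-1) (- (x^-1 ^+ 2)).
    apply: DeriveDef; first exact: (@derivableV _ _ id).
    rewrite (@deriveV _ _ id)//.
    by rewrite derive_id /GRing.scale/= mulr1 exprVn.
  have dp : is_derive x (1 : R) (fun y => p.[y^-1]) (p^`().[x^-1] * - (x^-1 ^+ 2)).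
    exact: (is_derive_comp1 (is_derive_poly p x^-1) dV).
  have dN : is_derive x (1 : R) (fun y => - y^-1) (x^-1 ^+ 2).
    by have := is_deriveZ1 (-1) dV; rewrite mulN1r opprK; under eq_fun do rewrite mulN1r.
  have de : is_derive x (1 : R) (fun y => expR (- y^-1)) (expR (- x^-1) * x^-1 ^+ 2).
    exact: (@is_derive_comp1 R expR (fun y => - y^-1) x _ _ (is_derive_expR _) dN).
  have := is_deriveM1 dp de; congr is_derive.
  by rewrite hornerM hornerXn hornerD hornerN; ring.
- have -> q : flat q 0 = 0 by rewrite /flat ltxx.
  have [C fC] := flat_quadratic p.
  apply: (@is_derive_quadratic _ _ _ _ C 1) => // h h1.
  by rewrite add0r mulr0 subr0 {2}/flat ltxx subr0 fC.
Qed.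

Lemma smooth_flat p : smooth (flat p).
Proof.
apply: (@smooth_closed R [set f | exists q, f = flat q]); last by exists p.
move=> _ [q ->]; exists (flat ('X^2 * (q - q^`()))).
  by exists ('X^2 * (q - q^`())).
by move=> x; exact: flat_is_derive.
Qed.

(** The normalized primitive of the bump e^(-1/x) e^(-1/(1-x)) on ]0, 1[. *)
Lemma smooth_step_exists : exists H : R -> R,
  [/\ smooth H, forall x, x <= 0 -> H x = 0, forall x, 1 <= x -> H x = 1
    & forall x, 0 <= derive1 H x].
Proof.
pose b x : R := flat 1 x * flat 1 (1 - x).
have sb : smooth b.
  apply: smoothM; first exact: smooth_flat.
  have := @smooth_affine _ _ (-1) 1 (@smooth_flat 1).
  by under eq_fun do rewrite mulN1r addrC.
have b_ge0 x : 0 <= b x.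
  by rewrite /b /flat; apply: mulr_ge0; case: ifP => // _;
    rewrite hornerE ?mul1r expR_ge0.
have b0 x : x <= 0 -> b x = 0 by rewrite /b /flat ltNge => ->; rewrite mul0r.
have b1 x : 1 <= x -> b x = 0.
  by rewrite /b /flat subr_gt0 ltNge [X in _ * if X then _ else _]ltNge => ->; rewrite mulr0.
have b_gt0 x : 0 < x < 1 -> 0 < b x.
  move=> /andP[x0 x1]; rewrite /b /flat x0 subr_gt0 x1 -polyC1 !hornerC !mul1r.
  by rewrite mulr_gt0 ?expR_gt0.
have [F dF F0] := primitive_exists (smooth_continuous sb) b0.
have F1 : 0 < F 1.
  have cF : {within `[0, 1 : R], continuous F}.
    by apply: continuous_subspaceT => x; exact: is_derive_continuous (dF x).
  have [c] := @MVT R F b 0 1 ltr01 (fun x _ => dF x) cF.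
  rewrite in_itv/= => c01; rewrite (F0 0)// !subr0 mulr1 => ->.
  exact: b_gt0.
have dH x : is_derive x (1 : R) (fun y => (F 1)^-1 * F y) ((F 1)^-1 * b x).
  exact: is_deriveZ1.
exists (fun x => (F 1)^-1 * F x); split.
- exact: smooth_primitive dH (smoothZ sb).
- by move=> x x0; rewrite (F0 x x0) mulr0.
- move=> x x1.
  have [c /andP[c1 _]] := MVT_is_derive x1 dF.
  rewrite b1// mul0r => /eqP; rewrite subr_eq0 => /eqP ->.
  by rewrite mulVf// gt_eqF.
- move=> x; rewrite (is_derive1E (dH x)) mulr_ge0// invr_ge0.
  exact: ltW.
Qed.

End Bump.

(** * Dominated convergence and test functions *)

Section Dominated.
Context {R : realType}.
Local Notation mu := (@lebesgue_measure R).

Lemma lint_dominated (f_ : nat -> R -> R) (f g : R -> R) :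
  (forall n, measurable_fun setT (f_ n)) -> measurable_fun setT f ->
  summable g -> (forall n x, `|f_ n x| <= g x) ->
  (forall x, f_ n x @[n --> \oo] --> f x) ->
  lint (f_ n) @[n --> \oo] --> lint f.
Proof.
move=> mf_ mf sg fg cvgf.
have mf_' n : measurable_fun setT (EFin \o f_ n).
  by apply/measurable_EFinP; exact: mf_.
have mf' : measurable_fun setT (EFin \o f) by apply/measurable_EFinP; exact: mf.
have cvg' : {ae mu, forall x, setT x -> (EFin \o f_ n) x @[n --> \oo] --> (EFin \o f) x}.
  by apply: aeW => x _; apply: cvg_EFin; [exact: nearW|exact: cvgf].
have dom : {ae mu, forall x n, setT x -> (`|(EFin \o f_ n) x| <= (EFin \o g) x)%E}.
  by apply: aeW => x n _ /=; rewrite lee_fin.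
have [sf _ cvg_int] := @dominated_convergence _ _ R mu setT measurableT _ _ _
  mf_' mf' cvg' sg dom.
apply: fine_cvg; rewrite fineK//; exact: integrable_fin_num.
Qed.

Lemma lint_continuous_at (f : R -> R -> R) (g : R -> R) (a r : R) : 0 < r ->
  (forall l, `|l - a| < r -> measurable_fun setT (f l)) ->
  (forall x, continuous (fun l => f l x)) ->
  summable g -> (forall l, `|l - a| < r -> forall x, `|f l x| <= g x) ->
  {for a, continuous (fun l => lint (f l))}.
Proof.
move=> r0 mf cf sg fg.
have near_a l : `]a - r, a + r[%classic l -> `|l - a| < r.
  by rewrite /= in_itv/= ltr_norml => /andP[? ?]; apply/andP; split; lra.
have sf l : `]a - r, a + r[%classic l -> summable (f l).
  by move=> /near_a ar; apply: le_summable sg (fg l ar); exact: mf.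
have caf : {ae mu, forall y : R, setT y ->
    {in `]a - r, a + r[%classic, continuous (f ^~ y)}}.
  by apply: aeW => y _ l _; exact: cf.
have ubf l : `]a - r, a + r[%classic l ->
    {ae mu, forall y : R, setT y -> `|f l y| <= g y}.
  by move=> /near_a ar; apply: aeW => y _; exact: fg.
have := @continuity_under_integral R _ _ mu f setT measurableT (a - r) (a + r)
  sf caf g sg ubf.
by apply; rewrite inE/= in_itv/=; apply/andP; split; lra.
Qed.

Lemma lint_continuous (f : R -> R -> R) (g : R -> R) :
  (forall l, measurable_fun setT (f l)) ->
  (forall x, continuous (fun l => f l x)) ->
  summable g -> (forall l x, `|f l x| <= g x) ->
  continuous (fun l => lint (f l)).
Proof.
by move=> mf cf sg fg l; apply: (@lint_continuous_at f g l 1) => // r _; exact: fg.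
Qed.

End Dominated.

Section CompactSupport.
Context {R : realType}.
Local Notation mu := (@lebesgue_measure R).
Implicit Types (f g phi : R -> R) (M C : R).

Definition supported M f := forall x, M < `|x| -> f x = 0.

Lemma supported_bounded M f : continuous f -> supported M f ->
  exists2 C, 0 <= C & forall x, `|f x| <= C.
Proof.
move=> cf sf; have [M0|M0] := leP 0 M; last first.
  exists 0 => // x; rewrite sf ?normr0//.
  exact: lt_le_trans M0 (normr_ge0 _).
have MM : - M <= M by lra.
have cnf : {within `[- M, M], continuous (fun x => `|f x|)}.
  by apply: continuous_subspaceT => x; apply: continuous_comp; [exact: cf|exact: norm_continuous].
have [c _ cmax] := EVT_max MM cnf.
exists `|f c| => // x; have [xM|xM] := leP `|x| M.
  by apply: cmax; rewrite in_itv/= -ler_norml.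
by rewrite sf// normr0.
Qed.

Definition box M : R -> R := \1_(`[- M, M]).

Lemma box_meas M : measurable_fun setT (box M).
Proof. exact: measurable_indic. Qed.

Lemma summable_indic_itv (a b : R) (b0 b1 : bool) :
  summable (\1_[set` Interval (BSide b0 a) (BSide b1 b)]).
Proof. exact: integrable_indic_itv. Qed.

Lemma box_summable M : summable (box M).
Proof. exact: summable_indic_itv. Qed.

Lemma box_sqr M x : box M x ^+ 2 = box M x.
Proof. by rewrite /box indicE; case: (_ \in _); rewrite ?expr1n ?expr0n. Qed.

Lemma box_L2 M : L2 (box M).
Proof.
apply/L2P; split; first exact: box_meas.
under [X in summable X]eq_fun do rewrite box_sqr.
exact: box_summable.
Qed.

Lemma boxE M x : box M x = ((`|x| <= M)%R)%:R.
Proof. by rewrite /box indicE mem_setE in_itv/= -ler_norml. Qed.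

Lemma supported_mul_box M f x : supported M f -> f x * box M x = f x.
Proof.
move=> sf; rewrite boxE; have [_|/sf ->] := leP `|x| M; first by rewrite mulr1.
by rewrite mul0r.
Qed.

Lemma supported_L2 M C f : measurable_fun setT f -> supported M f ->
  (forall x, `|f x| <= C) -> L2 f.
Proof.
move=> mf sf fC; have := L2_mul_bounded (box_L2 M) mf fC.
by under [X in L2 X]eq_fun do rewrite mulrC supported_mul_box//.
Qed.

Lemma supported_summable M C f : measurable_fun setT f -> supported M f ->
  (forall x, `|f x| <= C) -> summable f.
Proof.
move=> mf sf fC; have := L2_mul (supported_L2 mf sf fC) (box_L2 M).
by under [X in summable X]eq_fun do rewrite supported_mul_box//.
Qed.

Lemma test_functionP phi : test_function phi <->
  smooth phi /\ exists M, supported M phi.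
Proof. by []. Qed.

Lemma test_function_smooth phi : test_function phi -> smooth phi.
Proof. by case. Qed.

Lemma test_function_continuous phi : test_function phi -> continuous phi.
Proof. by move=> /test_function_smooth; exact: smooth_continuous. Qed.

Lemma test_function_meas phi : test_function phi -> measurable_fun setT phi.
Proof.
by move=> /test_function_continuous; exact: continuous_measurable_fun.
Qed.

Lemma test_function_L2 phi : test_function phi -> L2 phi.
Proof.
move=> tphi; have [_ [M sM]] := tphi.
have [C _ hC] := supported_bounded (test_function_continuous tphi) sM.
exact: supported_L2 (test_function_meas tphi) sM hC.
Qed.

Lemma test_function_summable phi : test_function phi -> summable phi.
Proof.
move=> tphi; have [_ [M sM]] := tphi.
have [C _ hC] := supported_bounded (test_function_continuous tphi) sM.
exact: supported_summable (test_function_meas tphi) sM hC.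
Qed.

Lemma test_function_bounded phi : test_function phi ->
  exists2 C, 0 <= C & forall x, `|phi x| <= C.
Proof.
move=> tphi; have [_ [M sM]] := tphi.
exact: supported_bounded (test_function_continuous tphi) sM.
Qed.

Lemma supported_derive M phi : (forall x, derivable phi x 1) ->
  supported M phi -> supported M (derive1 phi).
Proof.
move=> dphi sM x Mx; apply: is_derive1E.
apply: (@is_derive_near _ (fun=> 0)).
have : {for x, continuous (fun y : R => `|y|)} by exact: norm_continuous.
move=> /cvgr_gt -/(_ _ Mx); apply: filterS => y /= My.
by rewrite sM.
Qed.

Lemma test_function_derive phi : test_function phi -> test_function (derive1 phi).
Proof.
move=> [sphi [M sM]]; apply/test_functionP; split; first exact: smooth_derive.
by exists M; apply: supported_derive => // x; exact: (sphi 0%N).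
Qed.

Lemma test_function_derive1n n phi : test_function phi ->
  test_function (derive1n n phi).
Proof.
by elim: n => [//|n IH] tphi; rewrite derive1nS; exact/test_function_derive/IH.
Qed.

Lemma test_function_affine a b phi : a != 0 -> test_function phi ->
  test_function (fun x => phi (a * x + b)).
Proof.
move=> a0 [sphi [M sM]]; apply/test_functionP; split.
  exact: (@smooth_affine _ _ a b sphi).
exists ((M + `|b|) / `|a|) => x; rewrite ltr_pdivrMr ?normr_gt0// => Mx; apply: sM.
have := ler_normB (a * x + b) b; rewrite addrK normrM => H.
by rewrite -(ltrD2r `|b|); apply: lt_le_trans H; rewrite mulrC.
Qed.

Lemma test_function_shift b phi : test_function phi ->
  test_function (fun x => phi (x + b)).
Proof.
move=> /(@test_function_affine 1 b _ (oner_neq0 _)).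
by under eq_fun do rewrite mul1r.
Qed.

Lemma test_function_reflect b phi : test_function phi ->
  test_function (fun x => phi (b - x)).
Proof.
have n1 : -1 != 0 :> R by rewrite oppr_eq0 oner_eq0.
move=> /(@test_function_affine (-1) b _ n1).
by under eq_fun do rewrite mulN1r addrC.
Qed.

Lemma test_functionM phi f : test_function phi -> smooth f ->
  test_function (fun x => phi x * f x).
Proof.
move=> [sphi [M sM]] sf; apply/test_functionP; split; first exact: (smoothM sphi sf).
by exists M => x Mx; rewrite sM// mul0r.
Qed.

Lemma test_functionD phi psi : test_function phi -> test_function psi ->
  test_function (fun x => phi x + psi x).
Proof.
move=> [sphi [M sM]] [spsi [N sN]]; apply/test_functionP; split; first exact: (smoothD sphi spsi).
exists (Num.max M N) => x; rewrite gt_max => /andP[Mx Nx].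
by rewrite sM// sN// addr0.
Qed.

Lemma test_functionZ c phi : test_function phi -> test_function (fun x => c * phi x).
Proof.
move=> [sphi [M sM]]; apply/test_functionP; split.
  exact: (@smoothZ _ c phi).
by exists M => x Mx; rewrite sM// mulr0.
Qed.

Lemma test_functionB phi psi : test_function phi -> test_function psi ->
  test_function (fun x => phi x - psi x).
Proof.
move=> tphi tpsi; have := test_functionD tphi (@test_functionZ (-1) _ tpsi).
by under eq_fun do rewrite mulN1r.
Qed.

End CompactSupport.

(** * The fundamental lemma of the calculus of variations *)

Section Window.
Context {R : realType}.
Local Notation mu := (@lebesgue_measure R).
Variable H : R -> R.
Hypotheses (sH : smooth H) (H0 : forall x, x <= 0 -> H x = 0)
  (H1 : forall x, 1 <= x -> H x = 1) (dH_ge0 : forall x, 0 <= derive1 H x).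

Lemma step_mono x y : x <= y -> H x <= H y.
Proof.
move=> xy; have [c _ HE] := MVT_is_derive xy (fun z => smooth_is_derive z sH).
by rewrite -subr_ge0 HE mulr_ge0// subr_ge0.
Qed.

Lemma step_ge0 x : 0 <= H x.
Proof.
have [x0|x0] := leP x 0; first by rewrite H0.
by rewrite -(H0 (lexx 0)) step_mono// ltW.
Qed.

Lemma step_le1 x : H x <= 1.
Proof.
have [x1|x1] := leP 1 x; first by rewrite H1.
by rewrite -(H1 (lexx 1)) step_mono// ltW.
Qed.

Lemma derive_step_supp x : x <= 0 \/ 1 <= x -> derive1 H x = 0.
Proof.
(* outside [0, 1] the step is locally constant; at the end points its
   derivative is a limit of such values *)
have lt0 y : y < 0 -> derive1 H y = 0.
  move=> y0; apply: is_derive1E; apply: (@is_derive_near _ (fun=> 0)).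
  by apply: filterS (near_lt_cst y0) => z z0; rewrite H0// ltW.
have gt1 y : 1 < y -> derive1 H y = 0.
  move=> y1; apply: is_derive1E; apply: (@is_derive_near _ (fun=> 1)).
  by apply: filterS (near_gt_cst y1) => z z1; rewrite H1// ltW.
have cH : continuous (derive1 H) by exact: smooth_continuous (smooth_derive sH).
have lim (y : R) (s : R) : (forall n : nat, derive1 H (y + s / n.+1%:R) = 0) ->
    derive1 H y = 0.
  move=> Hn.
  have : derive1 H (y + s / n.+1%:R) @[n --> \oo] --> derive1 H y.
    apply: continuous_cvg; first exact: cH.
    rewrite -[X in _ --> X]addr0; apply: cvgD; first exact: cvg_cst.
    by rewrite -[X in _ --> X](mulr0 s); apply: cvgMr; exact: cvg_harmonic.
  under eq_fun do rewrite Hn.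
  by move/cvg_lim => <- //; rewrite lim_cst.
case; rewrite le_eqVlt => /orP[/eqP xE|].
- by apply: (lim _ (-1)) => n; apply: lt0; rewrite xE add0r mulN1r oppr_lt0 invr_gt0.
- exact: lt0.
- by apply: (lim _ 1) => n; apply: gt1; rewrite -xE ltrDl mul1r invr_gt0.
- exact: gt1.
Qed.

(** A step rising between a and a + 1/(n+1), written as H of an affine function. *)
Definition step_at (a : R) (n : nat) t := H (n.+1%:R * t + - (n.+1%:R * a)).

Lemma step_atE a n t : step_at a n t = H (n.+1%:R * (t - a)).
Proof. by rewrite /step_at mulrBr. Qed.

Lemma step_at_left a n t : t <= a -> step_at a n t = 0.
Proof. by move=> ta; rewrite step_atE H0// mulr_ge0_le0// subr_le0. Qed.

Lemma step_at_right a n t : a + n.+1%:R^-1 <= t -> step_at a n t = 1.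
Proof.
move=> ta; rewrite step_atE H1// -ler_pdivrMl// mulr1.
by rewrite lerBrDr addrC.
Qed.

Lemma smooth_step_at a n : smooth (step_at a n).
Proof. exact: (@smooth_affine _ H _ _ sH). Qed.

Lemma step_at_is_derive a n t :
  is_derive t (1 : R) (step_at a n) (n.+1%:R * derive1 H (n.+1%:R * (t - a))).
Proof.
rewrite mulrBr mulrC.
exact: (@is_derive_comp1 _ H _ t _ _ (smooth_is_derive _ sH) (is_derive_affine _ _ t)).
Qed.

Definition window (a b : R) n t := step_at a n t - step_at b n t.

Lemma window_supp a b n t : a <= b -> ~ (a < t < b + n.+1%:R^-1) -> window a b n t = 0.
Proof.
move=> ab /negP; rewrite negb_and -!leNgt /window => /orP[ta|bt].
  by rewrite !step_at_left ?subrr// (le_trans ta).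
rewrite !step_at_right ?subrr//.
by rewrite (le_trans _ bt)// lerD2r.
Qed.

Lemma window_test a b n : a <= b -> test_function (window a b n).
Proof.
move=> ab; split.
  exact: (@smoothB _ _ _ (@smooth_step_at a n) (@smooth_step_at b n)).
exists (Num.max `|a| `|b + n.+1%:R^-1|) => t; rewrite gt_max => /andP[ta tb].
apply: window_supp => // /andP[t1 t2].
have [t0|t0] := leP 0 t.
  move: tb; rewrite (ger0_norm t0) => /lt_trans /(_ t2).
  by rewrite ltNge ler_norm.
move: ta; rewrite (ltr0_norm t0) => H2.
have : - t < - a by rewrite ltrN2.
move=> H3; have := lt_trans H2 H3.
by rewrite ltNge -normrN ler_norm.
Qed.

Lemma window_norm a b n t : a <= b -> `|window a b n t| <= \1_(`[a, b + 1]) t.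
Proof.
move=> ab; rewrite indicE mem_setE in_itv/=.
have [_|] := boolP (a <= t <= b + 1).
  rewrite (_ : true%:R = 1 :> R)// /window !step_atE ler_norml.
  have [h1 h2] := (step_ge0 (n.+1%:R * (t - a)), step_le1 (n.+1%:R * (t - a))).
  have [h3 h4] := (step_ge0 (n.+1%:R * (t - b)), step_le1 (n.+1%:R * (t - b))).
  by apply/andP; split; lra.
move=> /negP nt; rewrite window_supp ?normr0// => /andP[t1 t2]; apply: nt.
rewrite (ltW t1)/= ltW// (lt_le_trans t2)// lerD2l invf_le1//.
by rewrite ler1n.
Qed.

Lemma step_at_cvg a t : step_at a n t @[n --> \oo] --> (\1_(`]a, +oo[) t : R).
Proof.
rewrite indicE mem_setE in_itv/= andbT.
have [at_|ta] := ltP a t; last first.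
  under eq_fun do rewrite step_at_left//.
  exact: cvg_cst.
have ta0 : 0 < t - a by rewrite subr_gt0.
apply: cvg_near_cst; near=> n; rewrite step_at_right// -lerBrDl.
by apply/ltW; near: n; exact: (near_infty_natSinv_lt (PosNum ta0)).
Unshelve. all: by end_near.
Qed.

Lemma window_cvg a b t : a <= b ->
  window a b n t @[n --> \oo] --> (\1_(`]a, b]) t : R).
Proof.
move=> ab; have -> : \1_(`]a, b]) t = \1_(`]a, +oo[) t - \1_(`]b, +oo[) t :> R.
  rewrite !indicE !mem_setE !in_itv/= !andbT.
  have [ta|ta] := ltP a t; have [tb|tb] := ltP b t => //=; rewrite ?subrr ?subr0//.
  by have := lt_le_trans (le_lt_trans ab tb) ta; rewrite ltxx.
by apply: cvgB; exact: step_at_cvg.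
Qed.

Lemma window_int_cvg (g : R -> R) (a b : R) : a <= b -> measurable_fun setT g ->
  summable (fun t => \1_(`[a, b + 1]) t * `|g t|) ->
  lint (fun t => g t * window a b n t) @[n --> \oo] -->
  lint (fun t => g t * \1_(`]a, b]) t).
Proof.
move=> ab mg sg.
apply: (lint_dominated (g := fun t => \1_(`[a, b + 1]) t * `|g t|)) => //.
- move=> n; apply: measurable_funM => //.
  exact: test_function_meas (window_test n ab).
- by apply: measurable_funM => //; exact: measurable_indic.
- by move=> n t; rewrite normrM mulrC ler_wpM2r// window_norm.
- by move=> t; apply: cvgMr; exact: window_cvg.
Qed.

End Window.

Section Fundamental.
Context {R : realType}.
Local Notation mu := (@lebesgue_measure R).

Lemma L2_summable_itv (g : R -> R) (a b : R) (b0 b1 : bool) : L2 g ->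
  summable (fun t => \1_[set` Interval (BSide b0 a) (BSide b1 b)] t * `|g t|).
Proof.
move=> Lg; set D := [set` _].
have mD : measurable_fun setT (\1_D : R -> R) by apply: measurable_indic; exact: measurable_itv.
have LD : L2 (\1_D : R -> R).
  apply/L2P; split=> //.
  have -> : (fun x => (\1_D x : R) ^+ 2) = \1_D.
    by apply/funext => x; rewrite indicE; case: (_ \in _); rewrite ?expr1n ?expr0n.
  exact: summable_indic_itv.
have := summable_norm (L2_mul LD Lg).
by under [X in summable X -> _]eq_fun do rewrite normrM indicE normr_nat -indicE.
Qed.

(** By Lebesgue differentiation, g is almost everywhere the derivative of its
    primitive, which vanishes. *)
Lemma int_itv0_ae0 (g : R -> R) : L2 g ->
  (forall a b, a <= b -> lint (fun t => g t * \1_(`]a, b]) t) = 0) ->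
  ae_equal g (fun=> 0).
Proof.
move=> Lg g0; have mg := L2_meas Lg.
have ig (D : set R) : measurable D -> (exists M, D `<=` `[- M, M]) ->
    mu.-integrable D (EFin \o g).
  move=> mD [M DM].
  have := L2_summable_itv (- M) M true false Lg => sM.
  apply: (@integrableS _ _ _ mu `[- M, M]) => //.
  apply/(integrable_mkcond _ _).2 => //.
  apply: (le_integrable measurableT _ _ sM).
    by apply/(measurable_restrictT _ _).1 => //; apply/measurable_EFinP; exact: measurable_funS mg.
  move=> x _; rewrite /= patchE indicE; case: ifP => _ /=.
    by rewrite mul1r normr_id.
  by rewrite mul0r normr0.
have ae_n (n : nat) : {ae mu, forall x : R, - n%:R < x -> g x = 0}.
  have lig : locally_integrable setT g.
    split=> //; first exact: openT.
    move=> K _ cK; have [M [Mreal KM]] := compact_bounded cK.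
    have /integrableP[_] : mu.-integrable K (EFin \o g).
      apply: ig; first exact: compact_measurable.
      exists (`|M| + 1) => x Kx; rewrite /= in_itv/= -ler_norml.
      by apply: (KM (`|M| + 1)) => //; rewrite (le_lt_trans (ler_norm M))// ltrDl.
    by [].
  have iy y : mu.-integrable [set` Interval (BRight (- n%:R)) (BRight y)] (EFin \o g).
    apply: ig; first exact: measurable_itv.
    exists (Num.max n%:R `|y|) => x; rewrite /= !in_itv/= => /andP[nx xy].
    rewrite -ler_norml le_max; have [x0|x0] := leP 0 x.
      by rewrite [X in _ || X](_ : _ = true) ?orbT// ger0_norm// (le_trans xy)// ler_norm.
    by rewrite ltr0_norm// lerNl (ltW nx).
  have := FTC1 iy lig.
  apply: filterS => x h nx.
  have [|_ <-] := h; first by move: nx; rewrite -lte_fin; exact.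
  apply: is_derive1E; rewrite [X in is_derive _ _ X](_ : _ = fun=> 0).
    exact: is_derive_cst1.
  apply/funext => y; have [yn|yn] := leP y (- n%:R).
    by rewrite set_itv_ge ?Rintegral_set0// bnd_simp -leNgt.
  rewrite -(g0 _ _ (ltW yn)) Rintegral_mkcond /lint; congr Rintegral.
  by apply/funext => z; rewrite patchE indicE; case: ifP; rewrite ?mulr1 ?mulr0.
have := ae_foralln ae_n; apply: filterS => x /(_ (Num.truncn (- x)).+1); apply.
by rewrite ltrNl; exact: truncnS_gt.
Qed.

(** Smooth windows approximate the indicators of intervals. *)
Lemma test_int0_ae0 (g : R -> R) : L2 g ->
  (forall phi, test_function phi -> lint (fun x => g x * phi x) = 0) ->
  ae_equal g (fun=> 0).
Proof.
move=> Lg g0; have [H [sH H0 H1 dH]] := @smooth_step_exists R.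
apply: int_itv0_ae0 => // a b ab.
have := window_int_cvg sH H0 H1 dH ab (L2_meas Lg)
  (L2_summable_itv a (b + 1) true false Lg).
have -> : (fun n => lint (fun t => g t * window H a b n t)) = (fun=> 0).
  by apply/funext => n; rewrite g0//; exact: window_test.
by move/cvg_lim => <- //; rewrite lim_cst.
Qed.

End Fundamental.

(** * The lemma of du Bois-Reymond *)

Section DuBoisReymond.
Context {R : realType}.
Local Notation mu := (@lebesgue_measure R).
Implicit Types (f g F : R -> R).

Lemma FTC2_is_derive F f a b : a <= b -> (forall x, is_derive x (1 : R) F (f x)) ->
  {within `[a, b], continuous f} -> \int[mu]_(x in `[a, b]) f x = F b - F a.
Proof.
rewrite le_eqVlt => /orP[/eqP ->|ab] dF cf.
  by rewrite set_itv1 Rintegral_set1 subrr.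
rewrite /Rintegral (@continuous_FTC2 _ f F)//.
- have cF x : {for x, continuous F} by exact: is_derive_continuous (dF x).
  split=> [x _||]; first by case: (dF x).
  + by apply: cvg_at_right_filter; exact: cF.
  + by apply: cvg_at_left_filter; exact: cF.
- by move=> x _; exact: is_derive1E.
Qed.

Lemma within_itv_integrable f a b : {within `[a, b], continuous f} ->
  mu.-integrable `[a, b] (EFin \o f).
Proof.
by move=> cf; apply: continuous_compact_integrable => //; exact: segment_compact.
Qed.

Lemma withinM f g (A : set R) : {within A, continuous f} -> {within A, continuous g} ->
  {within A, continuous (fun x => f x * g x)}.
Proof. by move=> cf cg x; apply: continuousM; [exact: cf|exact: cg]. Qed.

Variable H : R -> R.
Hypotheses (sH : smooth H) (H0 : forall x, x <= 0 -> H x = 0)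
  (H1 : forall x, 1 <= x -> H x = 1) (dH_ge0 : forall x, 0 <= derive1 H x).

Lemma derive_step_at d n t :
  derive1 (step_at H d n) t = n.+1%:R * derive1 H (n.+1%:R * (t - d)).
Proof. exact/is_derive1E/step_at_is_derive. Qed.

Lemma step_at_derive_continuous d n : continuous (derive1 (step_at H d n)).
Proof. exact/smooth_continuous/smooth_derive/smooth_step_at. Qed.

(** The derivatives of the steps at d are nonnegative, have integral one and
    concentrate at d from the right. *)
Lemma step_int_cvg f c d e : c <= d -> d < e ->
  {within `[c, e], continuous f} -> {for d, continuous f} ->
  \int[mu]_(t in `[c, e]) (derive1 (step_at H d n) t * f t) @[n --> \oo] --> f d.
Proof.
move=> cd de cf fd; apply/cvgrPdist_le => eps eps0.
have de0 : 0 < e - d by rewrite subr_gt0.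
move/cvgrPdist_le : (fd) => /(_ _ eps0) /nbhs_ballP[del /= del0 fdel].
have csf n : {within `[c, e], continuous (derive1 (step_at H d n))}.
  by apply: continuous_subspaceT; exact: step_at_derive_continuous.
near=> n.
have ne : d + n.+1%:R^-1 <= e.
  rewrite -lerBrDl; apply: ltW; near: n.
  exact: (near_infty_natSinv_lt (PosNum de0)).
have nd : n.+1%:R^-1 < del by near: n; exact: (near_infty_natSinv_lt (PosNum del0)).
have intS : \int[mu]_(t in `[c, e]) derive1 (step_at H d n) t = 1.
  have sd x : is_derive x (1 : R) (step_at H d n) (derive1 (step_at H d n) x).
    by apply: smooth_is_derive; exact: smooth_step_at.
  rewrite (FTC2_is_derive (le_trans cd (ltW de)) sd (csf n)).
  by rewrite (step_at_right H1 ne) (step_at_left H0 _ cd) subr0.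
have iS := within_itv_integrable (csf n).
have iSf := within_itv_integrable (withinM (csf n) cf).
have -> : f d = \int[mu]_(t in `[c, e]) (derive1 (step_at H d n) t * f d).
  by rewrite RintegralZr// intS mul1r.
have iSd : mu.-integrable `[c, e] (EFin \o (fun t => derive1 (step_at H d n) t * f d)).
  apply: within_itv_integrable; apply: withinM; first exact: csf.
  by apply: continuous_subspaceT => x; exact: cvg_cst.
rewrite -RintegralB//.
have iSB : mu.-integrable `[c, e] (EFin \o (fun t =>
    derive1 (step_at H d n) t * f d - derive1 (step_at H d n) t * f t)).
  exact: (@integrableB _ _ _ mu _ _ (EFin \o _) (EFin \o _)).
rewrite (le_trans (le_normr_Rintegral _ iSB))//.
rewrite -[leRHS]mul1r -intS -RintegralZr//.
apply: le_Rintegral => //.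
- exact: integrable_norm.
- apply: within_itv_integrable; apply: withinM; first exact: csf.
  by apply: continuous_subspaceT => x; exact: cvg_cst.
move=> t _; rewrite -mulrBr normrM.
have s0 : 0 <= derive1 (step_at H d n) t.
  by rewrite derive_step_at mulr_ge0.
rewrite (ger0_norm s0).
have [td|td] := leP t d.
  rewrite derive_step_at derive_step_supp ?mulr0 ?mul0r//; left.
  by rewrite mulr_ge0_le0// subr_le0.
have [dt1|dt1] := leP (d + n.+1%:R^-1) t.
  rewrite derive_step_at derive_step_supp ?mulr0 ?mul0r//; right.
  by rewrite -ler_pdivrMl// mulr1 lerBrDl.
rewrite ler_wpM2l//; apply: fdel; rewrite /ball/= ltr0_norm ?subr_lt0// opprB.
by rewrite ltrBlDl (lt_trans dt1)// ltrD2l.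
Unshelve. all: by end_near.
Qed.

(** Testing with windows that shrink to the indicator of ]c, d] turns the weak
    identity into f d - f c = int_c^d g; the
    fundamental theorem of calculus then differentiates f. *)
Lemma dubois_reymond (J : set R) f g : open J ->
  (forall t, J t -> {for t, continuous f}) ->
  (forall t, J t -> {for t, continuous g}) ->
  (forall rho, test_function rho ->
    (exists a b, `[a, b] `<=` J /\ forall t, ~ (a <= t <= b) -> rho t = 0) ->
    \int[mu]_(t in J) (derive1 rho t * f t + rho t * g t) = 0) ->
  forall t, J t -> is_derive t (1 : R) f (g t).
Proof.
move=> oJ cf cg weak t0 Jt0.
have [r /= r0 rJ] : exists2 r : R, 0 < r & `[t0 - r, t0 + r] `<=` J.
  have /nbhs_ballP[r /= r0 rJ] := open_nbhs_nbhs (conj oJ Jt0).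
  exists (r / 2); first by rewrite divr_gt0.
  move=> t /=; rewrite in_itv/= => /andP[h1 h2]; apply: rJ.
  by rewrite /ball/= ltr_norml; apply/andP; split; lra.
set c := t0 - r in rJ *; set e := t0 + r in rJ *.
have ct : c < t0 by rewrite /c; lra.
have te : t0 < e by rewrite /e; lra.
have within_cvg (h : R -> R) : (forall t, J t -> {for t, continuous h}) ->
    {within `[c, e], continuous h}.
  move=> ch; apply: continuous_in_subspaceT => x; rewrite inE => cx.
  exact/ch/rJ.
have cf' := within_cvg _ cf; have cg' := within_cvg _ cg.
have increment d : c <= d -> d < e ->
    f d - f c = lint (fun t => (g \_ `[c, e]) t * \1_(`]c, d]) t).
  move=> cd de.
  have de0 : 0 < e - d by rewrite subr_gt0.
  have mge : measurable_fun setT (g \_ `[c, e]).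
    apply/(measurable_restrictT _ _).1 => //.
    by apply: subspace_continuous_measurable_fun.
  have sge : summable (fun t => \1_(`[c, d + 1]) t * `|(g \_ `[c, e]) t|).
    have sg : summable (g \_ `[c, e]).
      rewrite /summable -restrict_EFin; apply/(integrable_mkcond _ _).1 => //.
      exact: within_itv_integrable.
    apply: (le_summable _ (summable_norm sg)).
      by apply: measurable_funM; [exact: measurable_indic|exact: measurableT_comp].
    move=> t; rewrite normrM normr_id ler_piMl// indicE.
    by case: (_ \in _); rewrite ?normr1 ?normr0.
  have lim_g := window_int_cvg sH H0 H1 dH_ge0 cd mge sge.
  have lim_c := step_int_cvg (lexx c) (lt_trans ct te) cf' (cf _ (rJ _ _)).
  have lim_d := step_int_cvg cd de cf' (cf _ (rJ _ _)).
  have ce : c <= e by exact: ltW (lt_trans ct te).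
  have inc : `[c, e]%classic c by rewrite /= in_itv/= lexx ce.
  have ind : `[c, e]%classic d by rewrite /= in_itv/= cd ltW.
  have : \int[mu]_(t in `[c, e]) (derive1 (step_at H c n) t * f t) -
      \int[mu]_(t in `[c, e]) (derive1 (step_at H d n) t * f t) +
      lint (fun t => (g \_ `[c, e]) t * window H c d n t) @[n --> \oo] -->
      f c - f d + lint (fun t => (g \_ `[c, e]) t * \1_(`]c, d]) t).
    apply: cvgD => //; apply: cvgB; [exact: lim_c|exact: lim_d].
  have H00 : \forall n \near \oo, 0 =
      \int[mu]_(t in `[c, e]) (derive1 (step_at H c n) t * f t) -
      \int[mu]_(t in `[c, e]) (derive1 (step_at H d n) t * f t) +
      lint (fun t => (g \_ `[c, e]) t * window H c d n t).
    near=> n.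
    have ne : d + n.+1%:R^-1 <= e.
      rewrite -lerBrDl; apply: ltW; near: n.
      exact: (near_infty_natSinv_lt (PosNum de0)).
    have wd t : is_derive t (1 : R) (window H c d n)
        (derive1 (step_at H c n) t - derive1 (step_at H d n) t).
      by apply: is_deriveB1; apply: smooth_is_derive; exact: smooth_step_at.
    have wsupp t : ~ (c <= t <= e) -> window H c d n t = 0.
      move=> nt; apply: (window_supp H0 H1) => // /andP[t1 t2]; apply: nt.
      by rewrite (ltW t1) (le_trans (ltW t2)).
    have dwsupp t : ~ (c <= t <= e) -> derive1 (window H c d n) t = 0.
      move=> /negP; rewrite negb_and -!ltNge => nt.
      apply: is_derive1E; apply: (@is_derive_near _ (fun=> 0)).
      case/orP: nt => [/near_lt_cst|/near_gt_cst]; apply: filterS => y yc.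
        by rewrite wsupp// leNgt yc.
      by rewrite wsupp// [X in _ && X]leNgt yc andbF.
    have := weak _ (window_test sH H0 H1 n cd) _.
    rewrite (_ : \int[mu]_(t in J) _ = \int[mu]_(t in `[c, e])
      (derive1 (window H c d n) t * f t + window H c d n t * g t)); last first.
      rewrite [LHS]Rintegral_mkcond [RHS]Rintegral_mkcond.
      congr Rintegral; apply/funext => t; rewrite !patchE mem_setE in_itv/=.
      have [ct_|nct] := boolP (c <= t <= e).
        by rewrite mem_set//; apply: rJ; rewrite /= in_itv.
      by case: ifP => // _; rewrite wsupp ?dwsupp ?mul0r ?addr0//; exact/negP.
    move=> <-; last by exists c, e.
    have isc m : mu.-integrable `[c, e] (EFin \o (fun t => derive1 (step_at H m n) t * f t)).
      apply: within_itv_integrable; apply: withinM => //.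
      by apply: continuous_subspaceT; exact: step_at_derive_continuous.
    have iwg : mu.-integrable `[c, e] (EFin \o (fun t => window H c d n t * g t)).
      apply: within_itv_integrable; apply: withinM => //.
      apply: continuous_subspaceT; exact/test_function_continuous/window_test.
    have -> : lint (fun t => (g \_ `[c, e]) t * window H c d n t) =
        \int[mu]_(t in `[c, e]) (window H c d n t * g t).
      rewrite [RHS]Rintegral_mkcond /lint; congr Rintegral.
      by apply/funext => t; rewrite !patchE; case: ifP; rewrite ?mul0r// mulrC.
    rewrite -RintegralB// -RintegralD//; last first.
      exact: (@integrableB _ _ _ mu _ _ (EFin \o _) (EFin \o _)).
    apply: eq_Rintegral => t _; rewrite (is_derive1E (wd t)).
    by rewrite mulrBl.
  move=> lim0.
  have lim0' : \int[mu]_(t in `[c, e]) (derive1 (step_at H c n) t * f t) -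
      \int[mu]_(t in `[c, e]) (derive1 (step_at H d n) t * f t) +
      lint (fun t => (g \_ `[c, e]) t * window H c d n t) @[n --> \oo] --> (0 : R).
    by apply: cvg_near_cst; apply: filterS H00 => n <-.
  have /eqP : f c - f d + lint (fun t => (g \_ `[c, e]) t * \1_(`]c, d]) t) = 0.
    by apply: (cvg_unique (@Rhausdorff R)) lim0 lim0'.
  by rewrite addr_eq0 => /eqP /(congr1 -%R); rewrite opprK opprB.
pose F y := \int[mu]_(t in `]c, y]) g t.
have ig : mu.-integrable [set` Interval (BRight c) (BRight e)] (EFin \o g).
  apply: integrableS (within_itv_integrable cg') => //.
  exact: subset_itv_oc_cc.
have ct' : (BRight c < BRight t0)%O by rewrite bnd_simp.
have [dF F'] := continuous_FTC1 te ig ct' (cg _ Jt0).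
have {dF F'}FE : is_derive t0 (1 : R) F (g t0).
  by rewrite -F'; exact: derivable_is_derive.
have FcE : is_derive t0 (1 : R) (fun y => F y + f c) (g t0).
  by rewrite -[g t0]addr0; exact: (is_deriveD1 FE (is_derive_cst1 (f c) t0)).
apply: (is_derive_near _ FcE).
near=> y; have cy : c < y by near: y; exact: near_gt_cst.
have ye : y < e by near: y; exact: near_lt_cst.
have -> : f y = (f y - f c) + f c by rewrite subrK.
rewrite (increment y (ltW cy) ye); congr (_ + _).
rewrite /F Rintegral_mkcond /lint; congr Rintegral.
apply/funext => t; rewrite !patchE indicE !mem_setE !in_itv/=.
have [h|_] := boolP (c < t <= y); last by rewrite mulr0.
rewrite mulr1; case: ifPn => // /negP; case.
by move: h => /andP[h1 h2]; rewrite (ltW h1) (le_trans h2)// ltW.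
Unshelve. all: by end_near.
Qed.

End DuBoisReymond.

(** * Continuity of translations in L^2 *)

Section Translation.
Context {R : realType}.
Local Notation mu := (@lebesgue_measure R).
Implicit Types (f g : R -> R) (M e h : R).

Lemma norm2_le f e : 0 <= e -> lint (fun x => f x ^+ 2) <= e ^+ 2 -> norm2 f <= e.
Proof.
move=> e0 fe; rewrite -(@ler_pXn2r _ 2)// ?nnegrE ?norm2_ge0//.
by rewrite norm2_sqr.
Qed.

(** Cut f off where |f| or |x| exceeds n, and let n grow. *)
Lemma L2_truncation f e : L2 f -> 0 < e -> exists M g,
  [/\ measurable_fun setT g, forall x, `|g x| <= M, supported M g
    & norm2 (fun x => f x - g x) <= e].
Proof.
move=> Lf e0; have mf := L2_meas Lf.
pose g n x := f x * \1_(`[- n%:R, n%:R]) (f x) * box n%:R x.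
have mg n : measurable_fun setT (g n).
  apply: measurable_funM; last exact: box_meas.
  apply: measurable_funM => //.
  have mI : measurable_fun setT (\1_(`[- n%:R, n%:R]) : R -> R).
    exact: measurable_indic.
  exact: (measurableT_comp mI mf).
have gE n x : g n x = if (`|f x| <= n%:R) && (`|x| <= n%:R) then f x else 0.
  rewrite /g boxE indicE mem_setE in_itv/= -ler_norml.
  by case: (`|f x| <= _); case: (`|x| <= _); rewrite ?mulr1 ?mulr0 ?mul0r.
have lim : lint (fun x => (f x - g n x) ^+ 2) @[n --> \oo] --> lint (fun=> 0 : R).
  apply: (lint_dominated (g := fun x => f x ^+ 2)).
  - by move=> n; apply: measurable_funX; exact: measurable_funB.
  - exact: measurable_cst.
  - exact: L2_summable_sqr.
  - move=> n x; rewrite gE; case: ifP => _.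
      by rewrite subrr expr0n/= normr0 sqr_ge0.
    by rewrite subr0 ger0_norm// sqr_ge0.
  - move=> x; apply: cvg_near_cst; near=> n; rewrite gE.
    have -> : (`|f x| <= n%:R) && (`|x| <= n%:R).
      apply/andP; split; near: n; exact: nbhs_infty_ger.
    by rewrite subrr expr0n.
have e20 : 0 < e ^+ 2 by rewrite exprn_gt0.
have l0 : lint (fun=> 0 : R) = 0 by rewrite /lint Rintegral_cst//= mul0r.
rewrite l0 in lim; move/cvgrPdist_le: lim => /(_ _ e20) [n _ /(_ n (leqnn n))].
rewrite /= sub0r normrN ger0_norm ?int_sqr_ge0// => ne.
exists n%:R, (g n); split=> //.
- by move=> x; rewrite gE; case: ifP => [/andP[]//|_]; rewrite normr0.
- by move=> x nx; rewrite gE (leNgt `|x|) nx andbF.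
- exact: norm2_le (ltW e0) ne.
Unshelve. all: by end_near.
Qed.

(** A continuous function close to g in L^1 of a bounded interval is moved little
    by small translations, by dominated convergence. *)
Lemma L1_translation g M e : measurable_fun setT g -> (forall x, `|g x| <= M) ->
  supported M g -> 0 < e ->
  \forall h \near (0 : R), lint (fun x => `|g (x + h) - g x|) <= e.
Proof.
move=> mg gM sg e0; have M0 : 0 <= M by exact: le_trans (gM 0).
have sumg : summable g := supported_summable mg sg gM.
pose N := M + 1 + 1.
have ig : mu.-integrable `[- N, N] (EFin \o g).
  by apply: integrableS sumg => //; exact: measurable_itv.
have [k_ [ck _]] := approximation_continuous_integrable (measurable_itv _)
  (compact_finite_measure (@segment_compact R (- N) N)) ig.
move/fine_cvgP => [_ /cvgrPdist_le].
have e30 : 0 < e / 3 by rewrite divr_gt0.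
move/(_ _ e30) => [n _ /(_ n (leqnn n))] /=.
set k := k_ n; have {}ck : continuous k by exact: ck.
rewrite sub0r normrN => gk.
have mk : measurable_fun setT k by exact: continuous_measurable_fun.
pose d x := box N x * `|g x - k x|.
have md : measurable_fun setT d.
  apply: measurable_funM; first exact: box_meas.
  by apply: measurableT_comp => //; exact: measurable_funB.
have [C C0 kC] : exists2 C, 0 <= C & forall x, `|x| <= N -> `|k x| <= C.
  have NN : - N <= N by rewrite /N; lra.
  have cnk : {within `[- N, N], continuous (fun x => `|k x|)}.
    by apply: continuous_subspaceT => x; apply: continuous_comp; [exact: ck|exact: norm_continuous].
  have [c _ cmax] := EVT_max NN cnk.
  by exists `|k c| => // x xN; apply: cmax; rewrite in_itv/= -ler_norml.
have sd : summable d.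
  apply: (le_summable md (summableZ (M + C) (box_summable N))) => x.
  rewrite /d boxE; have [xN|_] := leP `|x| N; last by rewrite mul0r mulr0 normr0.
  by rewrite mul1r mulr1 normr_id (le_trans (ler_normB _ _))// lerD// kC.
have dE : lint d <= e / 3.
  move: gk; apply: le_trans; rewrite ger0_norm; last first.
    by apply: fine_ge0; apply: integral_ge0 => x _; rewrite lee_fin.
  rewrite -[leRHS]/(\int[mu]_(x in `[- N, N]) `|g x - k x|) Rintegral_mkcond.
  rewrite /lint (_ : d = ((fun x => `|g x - k x|) \_ `[- N, N]))//.
  apply/funext => x; rewrite /d /box patchE indicE.
  by case: ifP => _; rewrite ?mul1r ?mul0r.
(* the continuous approximation is close to its translates *)
pose K h := lint (fun x => box (M + 1) x * `|k (x + h) - k x|).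
have mK h : measurable_fun setT (fun x => box (M + 1) x * `|k (x + h) - k x|).
  apply: measurable_funM; first exact: box_meas.
  apply: measurableT_comp => //; apply: measurable_funB => //.
  exact: meas_preserving (preserving_shift h) mk.
have domK h : `|h - 0| < 1 -> forall x,
    `|box (M + 1) x * `|k (x + h) - k x| | <= 2 * C * box (M + 1) x.
  rewrite subr0 => h1 x; rewrite boxE.
  have [xN|_] := leP `|x| (M + 1); last by rewrite mul0r mulr0 normr0.
  rewrite mul1r mulr1 normr_id (le_trans (ler_normB _ _))// mulr_natl mulr2n lerD//.
    by apply: kC; rewrite (le_trans (ler_normD _ _))// /N lerD// ltW.
  by apply: kC; rewrite (le_trans xN)// /N lerDl.
have sB := summableZ (2 * C) (box_summable (M + 1)).
have sK h : `|h - 0| < 1 -> summable (fun x => box (M + 1) x * `|k (x + h) - k x|).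
  by move=> h1; exact: le_summable (mK h) sB (domK h h1).
have cK : {for 0, continuous K}.
  apply: (lint_continuous_at (r := 1) ltr01 _ _ sB domK) => [h _|x]; first exact: mK.
  move=> h; apply: cvgMr; apply: cvg_norm; apply: cvgB; last exact: cvg_cst.
  have cxh : {for h, continuous (fun h => k (x + h))}.
    apply: continuous_comp; last exact: ck.
    by apply: continuousD; [exact: cvg_cst|exact: cvg_id].
  exact: cxh.
have K0 : K 0 = 0.
  rewrite /K; under eq_fun do rewrite addr0 subrr normr0 mulr0.
  by rewrite /lint Rintegral_cst//= mul0r.
move/cvgrPdist_le : cK => /(_ _ e30); rewrite K0 => nearK.
near=> h.
have h1 : `|h| < 1.
  near: h; apply/nbhs_ballP; exists 1 => //= h; rewrite /ball/= sub0r normrN.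
  by [].
have h10 : `|h - 0| < 1 by rewrite subr0.
have Kh : K h <= e / 3.
  apply: le_trans (ler_norm _) _; rewrite -normrN -sub0r; near: h; exact: nearK.
have sgh := summable_preserving (preserving_shift h) sumg.
have sdh := summable_preserving (preserving_shift h) sd.
apply: (@le_trans _ _ (lint (fun x => (d (x + h) +
  box (M + 1) x * `|k (x + h) - k x|) + d x))); last first.
  rewrite intD//; last by apply: summableD => //; exact: sK.
  rewrite intD//; last exact: sK.
  rewrite (lint_preserving (preserving_shift h) md).
  have -> : e = e / 3 + e / 3 + e / 3 by field.
  by apply: lerD => //; exact: lerD.
apply: int_le.
- exact: summable_norm (summableB sgh sumg).
- by apply: summableD => //; apply: summableD => //; exact: sK.
move=> x; rewrite /d !boxE.
have [xM|xM] := leP `|x| (M + 1); last first.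
  have xM' : M < `|x| by apply: lt_trans xM; rewrite ltrDl.
  have xhM : M < `|x + h|.
    have := ler_normB (x + h) h; rewrite addrK => H.
    have : M + 1 < `|x + h| + `|h| by exact: lt_le_trans xM H.
    by move=> H2; rewrite -(ltrD2r `|h|); apply: le_lt_trans H2; rewrite lerD2l ltW.
  by rewrite !sg// subrr normr0 mul0r addr0 addr_ge0// mulr_ge0.
have -> : `|x| <= N by rewrite (le_trans xM)// /N lerDl.
have -> : `|x + h| <= N.
  by rewrite (le_trans (ler_normD _ _))// /N lerD// ltW.
rewrite !mul1r.
have -> : g (x + h) - g x = (g (x + h) - k (x + h)) + (k (x + h) - k x) - (g x - k x).
  by ring.
by rewrite (le_trans (ler_normB _ _))// lerD2r ler_normD.
Unshelve. all: by end_near.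
Qed.

(** For g bounded by M, the square of g (x + h) - g x is at most 2 M times its
    absolute value, so the estimate in L^1 suffices. *)
Lemma L2_translation f : L2 f ->
  norm2 (fun x => f (x + h) - f x) @[h --> (0 : R)] --> (0 : R).
Proof.
move=> Lf; apply/cvgrPdist_le => e e0.
have e30 : 0 < e / 3 by rewrite divr_gt0.
have [M [g [mg gM sg fg]]] := L2_truncation Lf e30.
have M0 : 0 <= M by exact: le_trans (gM 0).
have e40 : 0 < (e / 3) ^+ 2 / (2 * M + 1).
  by rewrite divr_gt0 ?exprn_gt0// ltr_wpDl// mulr_ge0.
have Lg := supported_L2 mg sg gM.
near=> h; rewrite sub0r normrN ger0_norm ?norm2_ge0//.
have ph := preserving_shift h.
have Lfh := L2_preserving ph Lf; have Lgh := L2_preserving ph Lg.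
apply: le_trans (norm2_triangle Lfh Lf Lgh) _.
have -> : e = e / 3 + (e / 3 + e / 3) by field.
apply: lerD.
  rewrite (norm2_preserving (f := fun x => f x - g x) ph)//.
  by apply: measurable_funB => //; exact: L2_meas.
apply: le_trans (norm2_triangle Lgh Lf Lg) _.
apply: lerD; last by rewrite norm2_distC.
apply: norm2_le; first exact: ltW.
have Lgg := L2B Lgh Lg.
have sgg : summable (fun x => `|g (x + h) - g x|).
  apply: summable_norm; apply: summableB; last exact: (supported_summable mg sg gM).
  by apply: (summable_preserving ph); exact: (supported_summable mg sg gM).
apply: (@le_trans _ _ (lint (fun x => 2 * M * `|g (x + h) - g x|))).
  apply: int_le; [exact: L2_summable_sqr|exact: summableZ|].
  move=> x; rewrite -real_normK ?num_real// expr2 ler_wpM2r//.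
  by rewrite (le_trans (ler_normB _ _))// mulr_natl mulr2n lerD.
rewrite intZ//.
apply: (@le_trans _ _ ((2 * M + 1) * ((e / 3) ^+ 2 / (2 * M + 1)))); last first.
  by rewrite mulrC divfK// gt_eqF// ltr_wpDl// mulr_ge0.
apply: ler_pM; [by rewrite mulr_ge0|exact: Rintegral_ge0|by rewrite lerDl|].
near: h; exact: L1_translation mg gM sg e40.
Unshelve. all: by end_near.
Qed.

End Translation.

(** * Weak derivatives *)

Section WeakDerivative.
Context {R : realType}.
Local Notation mu := (@lebesgue_measure R).
Implicit Types (f g : R -> R).

Lemma derive1_shift f h : (forall x, derivable f x 1) ->
  derive1 (fun x => f (x + h)) = (fun x => derive1 f (x + h)).
Proof.
move=> df; apply/funext => x; apply: is_derive1E.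
have := @is_derive_comp1 _ f (fun y => 1 * y + h) x _ _
  (derivable_is_derive (df (1 * x + h))) (is_derive_affine 1 h x).
by rewrite mulr1 !mul1r; under eq_fun do rewrite mul1r.
Qed.

Lemma derive1_reflect f c : (forall x, derivable f x 1) ->
  derive1 (fun x => f (c - x)) = (fun x => - derive1 f (c - x)).
Proof.
move=> df; apply/funext => x; apply: is_derive1E.
have := @is_derive_comp1 _ f (fun y => -1 * y + c) x _ _
  (derivable_is_derive (df (-1 * x + c))) (is_derive_affine (-1) c x).
rewrite mulrN1 !mulN1r (addrC _ c).
by under eq_fun do rewrite mulN1r addrC.
Qed.

Lemma H1_with_shift f g h : H1_with f g ->
  H1_with (fun x => f (x + h)) (fun x => g (x + h)).
Proof.
move=> [Lf Lg fg]; have ph := preserving_shift h; split.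
- exact: L2_preserving ph Lf.
- exact: L2_preserving ph Lg.
- move=> phi tphi; have tphi' := test_function_shift (- h) tphi.
  have := fg _ tphi'.
  rewrite derive1_shift; last by move=> x; exact: (tphi.1 0%N).
  rewrite -[X in X = _ -> _]/(lint (fun x => f x * derive1 phi (x - h))).
  rewrite -[X in _ = - X -> _]/(lint (fun x => g x * phi (x - h))).
  rewrite -(lint_preserving (f := fun x => f x * derive1 phi (x - h)) ph); last first.
    apply: measurable_funM; first exact: L2_meas.
    exact: (meas_preserving (f := derive1 phi) (preserving_shift (- h))
      (test_function_meas (test_function_derive tphi))).
  rewrite -(lint_preserving (f := fun x => g x * phi (x - h)) ph); last first.
    apply: measurable_funM; first exact: L2_meas.
    exact: (meas_preserving (f := phi) (preserving_shift (- h)) (test_function_meas tphi)).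
  under [X in lint X]eq_fun do rewrite addrK.
  by under [X in _ = - lint X]eq_fun do rewrite addrK.
Qed.

Lemma H1_with_reflect f g c : H1_with f g ->
  H1_with (fun x => f (c - x)) (fun x => - g (c - x)).
Proof.
move=> [Lf Lg fg]; have ph := preserving_reflect c; split.
- exact: L2_preserving ph Lf.
- have := @L2Z _ (-1) _ (L2_preserving ph Lg).
  by under [X in L2 X]eq_fun do rewrite mulN1r.
- move=> phi tphi; have tphi' := test_function_reflect c tphi.
  have := fg _ tphi'.
  rewrite derive1_reflect; last by move=> x; exact: (tphi.1 0%N).
  rewrite -[X in X = _ -> _]/(lint (fun x => f x * - derive1 phi (c - x))).
  rewrite -[X in _ = - X -> _]/(lint (fun x => g x * phi (c - x))).
  have mdphi : measurable_fun setT (derive1 phi).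
    exact: (test_function_meas (test_function_derive tphi)).
  have mphi := test_function_meas tphi.
  have mf : measurable_fun setT (fun x => f x * derive1 phi (c - x)).
    by apply: measurable_funM; [exact: L2_meas|exact: meas_preserving ph mdphi].
  have mg : measurable_fun setT (fun x => g x * phi (c - x)).
    by apply: measurable_funM; [exact: L2_meas|exact: meas_preserving ph mphi].
  have Ldphi : L2 (fun x => derive1 phi (c - x)).
    exact: L2_preserving ph (test_function_L2 (test_function_derive tphi)).
  have Lphi : L2 (fun x => phi (c - x)).
    exact: L2_preserving ph (test_function_L2 tphi).
  have -> : (fun x => f x * - derive1 phi (c - x)) =
      (fun x => -1 * (f x * derive1 phi (c - x))).
    by apply/funext => x; ring.
  rewrite intZ; last exact: L2_mul.
  rewrite -(lint_preserving ph mf) -(lint_preserving ph mg).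
  rewrite mulN1r => /oppr_inj.
  under [X in lint X = _ -> _]eq_fun do rewrite subKr.
  under [X in _ = lint X -> _]eq_fun do rewrite subKr.
  rewrite -[X in _ -> X = _]/(lint (fun x => f (c - x) * derive1 phi x)) => ->.
  rewrite -[X in _ = - X]/(lint (fun x => - g (c - x) * phi x)).
  have -> : (fun x => - g (c - x) * phi x) = (fun x => -1 * (g (c - x) * phi x)).
    by apply/funext => x; ring.
  rewrite intZ ?mulN1r ?opprK//.
  by apply: L2_mul; [exact: L2_preserving ph Lg|exact: test_function_L2].
Qed.

(** The difference of the weak derivatives is orthogonal to all test functions. *)
Lemma weak_derivative_unique f g f' g' : H1_with f g -> H1_with f' g' ->
  ae_equal f f' -> ae_equal g g'.
Proof.
move=> [Lf Lg fg] [Lf' Lg' fg'] ff'.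
suff : ae_equal (fun x => g x - g' x) (fun=> 0).
  by apply: filterS => x /eqP; rewrite subr_eq0 => /eqP.
apply: test_int0_ae0; first exact: L2B.
move=> phi tphi; have Lphi := test_function_L2 tphi.
have Ldphi := test_function_L2 (test_function_derive tphi).
under [X in lint X]eq_fun do rewrite mulrBl.
rewrite intB; [|exact: L2_mul|exact: L2_mul].
have := fg _ tphi; have := fg' _ tphi.
rewrite -[X in X = _ -> _]/(lint (fun x => f' x * derive1 phi x)).
rewrite -[X in _ = - X -> _]/(lint (fun x => g' x * phi x)) => E'.
rewrite -[X in X = _ -> _]/(lint (fun x => f x * derive1 phi x)).
rewrite -[X in _ = - X -> _]/(lint (fun x => g x * phi x)) => E.
apply/eqP; rewrite subr_eq0 -eqr_opp -E -E'; apply/eqP; apply: int_ae_eq.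
- by apply: measurable_funM; exact: L2_meas.
- by apply: measurable_funM; exact: L2_meas.
- by apply: filterS ff' => x ->.
Qed.

End WeakDerivative.

(** * Quadratic functionals of curves in L^2 *)

Section Trilinear.
Context {R : realType}.
Local Notation mu := (@lebesgue_measure R).

Lemma trilinear_summable (f1 f2 g : R -> R) C : L2 f1 -> L2 f2 ->
  measurable_fun setT g -> (forall x, `|g x| <= C) ->
  summable (fun x => f1 x * f2 x * g x).
Proof.
move=> L1 L2' mg gC; have := L2_mul L1 (L2_mul_bounded L2' mg gC).
by under [X in summable X]eq_fun do rewrite mulrA.
Qed.

Lemma trilinear_bound (f1 f2 g : R -> R) C : L2 f1 -> L2 f2 ->
  measurable_fun setT g -> 0 <= C -> (forall x, `|g x| <= C) ->
  `|lint (fun x => f1 x * f2 x * g x)| <= C * norm2 f1 * norm2 f2.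
Proof.
move=> L1 L2' mg C0 gC; under eq_fun do rewrite -mulrA.
rewrite (le_trans (cauchy_schwarz L1 (L2_mul_bounded L2' mg gC)))//.
rewrite mulrAC [leRHS]mulrC ler_wpM2l ?norm2_ge0//.
exact: norm2_mul_bounded.
Qed.

Definition uniform_cvg {T} (F : set_system T) (g : T -> R -> R) (c : R -> R) :=
  forall e, 0 < e -> \forall t \near F, forall x, `|g t x - c x| <= e.

(** Products of two curves that converge in L^2 converge in L^1, and may be tested
    against uniformly convergent coefficients: the quadratic terms of the
    equation are continuous in time. *)
Lemma trilinear_cvg {T} {F : set_system T} {FF : Filter F}
  (f1 f2 g : T -> R -> R) (a b c : R -> R) C :
  L2 a -> L2 b -> measurable_fun setT c -> (forall x, `|c x| <= C) ->
  (\forall t \near F, L2 (f1 t)) -> (\forall t \near F, L2 (f2 t)) ->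
  (\forall t \near F, measurable_fun setT (g t)) ->
  norm2 (fun x => f1 t x - a x) @[t --> F] --> (0 : R) ->
  norm2 (fun x => f2 t x - b x) @[t --> F] --> (0 : R) ->
  uniform_cvg F g c ->
  lint (fun x => f1 t x * f2 t x * g t x) @[t --> F] -->
  lint (fun x => a x * b x * c x).
Proof.
move=> La Lb mc cC Lf1 Lf2 mg cvg1 cvg2 cvg3.
have C0 : 0 <= C by exact: le_trans (cC 0).
apply/cvgrPdist_le => e e0.
pose K := (C + 1) * (norm2 b + 1) + (C + 1) * norm2 a + norm2 a * norm2 b + 1.
have [na nb] := (norm2_ge0 a, norm2_ge0 b).
have K0 : 0 < K.
  by rewrite /K ltr_wpDl// !addr_ge0// !mulr_ge0// addr_ge0.
pose d := Num.min 1 (e / K).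
have d0 : 0 < d by rewrite lt_min ltr01 divr_gt0.
have d1 : d <= 1 by rewrite ge_min lexx.
have dK : d * K <= e by rewrite -ler_pdivlMr// ge_min lexx orbT.
move/cvgrPdist_le : cvg1 => /(_ _ d0) cvg1.
move/cvgrPdist_le : cvg2 => /(_ _ d0) cvg2.
near=> t.
have L1 : L2 (f1 t) by near: t.
have L2' : L2 (f2 t) by near: t.
have mgt : measurable_fun setT (g t) by near: t.
have n1 : norm2 (fun x => f1 t x - a x) <= d.
  by rewrite -[leLHS]ger0_norm ?norm2_ge0// -normrN -sub0r; near: t.
have n2 : norm2 (fun x => f2 t x - b x) <= d.
  by rewrite -[leLHS]ger0_norm ?norm2_ge0// -normrN -sub0r; near: t.
have n3 : forall x, `|g t x - c x| <= d by near: t; exact: cvg3.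
have gtC x : `|g t x| <= C + 1.
  rewrite -[g t x](subrK (c x)) (le_trans (ler_normD _ _))// addrC lerD//.
  exact: le_trans (n3 x) d1.
have nf2 : norm2 (f2 t) <= norm2 b + 1.
  have := norm2D Lb (L2B L2' Lb).
  rewrite (_ : (fun x => b x + _) = f2 t); last by apply/funext => x; rewrite subrKC.
  by move=> /le_trans; apply; rewrite lerD2l (le_trans n2).
have LB1 := L2B L1 La; have LB2 := L2B L2' Lb.
have mB : measurable_fun setT (fun x => g t x - c x) by exact: measurable_funB.
have E : lint (fun x => f1 t x * f2 t x * g t x) - lint (fun x => a x * b x * c x)
   = lint (fun x => (f1 t x - a x) * f2 t x * g t x) +
     lint (fun x => a x * (f2 t x - b x) * g t x) +
     lint (fun x => a x * b x * (g t x - c x)).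
  rewrite -intD; last 2 first.
  - exact: trilinear_summable LB1 L2' mgt gtC.
  - exact: trilinear_summable La LB2 mgt gtC.
  rewrite -intD; last 2 first.
  - apply: summableD; first exact: trilinear_summable LB1 L2' mgt gtC.
    exact: trilinear_summable La LB2 mgt gtC.
  - exact: trilinear_summable La Lb mB n3.
  rewrite -intB; last 2 first.
  - exact: trilinear_summable L1 L2' mgt gtC.
  - exact: trilinear_summable La Lb mc cC.
  by congr lint; apply/funext => x; ring.
rewrite distrC E; apply: le_trans dK.
have C10 : 0 <= C + 1 by rewrite addr_ge0.
have b1 := trilinear_bound LB1 L2' mgt C10 gtC.
have b2 := trilinear_bound La LB2 mgt C10 gtC.
have b3 := trilinear_bound La Lb mB (ltW d0) n3.
have h1 : (C + 1) * norm2 (fun x => f1 t x - a x) * norm2 (f2 t) <=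
    (C + 1) * d * (norm2 b + 1).
  by apply: ler_pM; rewrite ?mulr_ge0 ?norm2_ge0// ler_wpM2l.
have h2 : (C + 1) * norm2 a * norm2 (fun x => f2 t x - b x) <=
    (C + 1) * norm2 a * d.
  by rewrite ler_wpM2l// mulr_ge0.
rewrite (le_trans (ler_normD _ _))//.
rewrite (le_trans (lerD (le_trans (ler_normD _ _) (lerD (le_trans b1 h1) (le_trans b2 h2))) b3))//.
rewrite /K -subr_ge0.
by rewrite [leRHS](_ : _ = d); [exact: ltW|ring].
Unshelve. all: by end_near.
Qed.

Lemma L2norm_cvg0 {T} {F : set_system T} {FF : Filter F} (f : T -> R -> R) :
  (\forall t \near F, L2 (f t)) ->
  L2norm (f t) @[t --> F] --> 0%E <-> norm2 (f t) @[t --> F] --> (0 : R).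
Proof.
move=> Lf; have E : \forall t \near F, L2norm (f t) = (norm2 (f t))%:E.
  by apply: filterS Lf => t; exact: L2normE.
split=> [cvg0|cvg0].
  have : fine (L2norm (f t)) @[t --> F] --> (0 : R) by exact: fine_cvg.
  apply: cvg_trans; apply: near_eq_cvg; apply: filterS E => t /= ->.
  by [].
have : (norm2 (f t))%:E @[t --> F] --> (0 : R)%:E.
  by apply: cvg_EFin => //; exact: nearW.
apply: cvg_trans; apply: near_eq_cvg; apply: filterS E => t /= ->.
by [].
Qed.

End Trilinear.

Section Pairing.
Context {R : realType}.

(** The inner integral of the weak formulation at a fixed time, the test
    function entering through the coefficients of u, u^2 and u_x^2. *)
Definition pairing (f fx g1 g2 g3 : R -> R) : R :=
  lint (fun x => f x * g1 x + f x ^+ 2 * g2 x + fx x ^+ 2 * g3 x).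

Definition coefficient (M : R) (g : R -> R) := continuous g /\ supported M g.

Lemma coefficient_meas M g : coefficient M g -> measurable_fun setT g.
Proof. by move=> [cg _]; exact: continuous_measurable_fun. Qed.

Lemma coefficient_bounded M g : coefficient M g ->
  exists2 C, 0 <= C & forall x, `|g x| <= C.
Proof. by move=> [cg sg]; exact: supported_bounded cg sg. Qed.

Lemma mul_coefficient_box M g f : coefficient M g ->
  (fun x => f x * g x) = (fun x => f x * box M x * g x).
Proof.
by move=> [_ sg]; apply/funext => x; rewrite -mulrA (mulrC (box _ _)) supported_mul_box.
Qed.

Lemma coefficient_summable M f g : L2 f -> coefficient M g ->
  summable (fun x => f x * g x).
Proof.
move=> Lf cg; have [C _ gC] := coefficient_bounded cg.
rewrite (mul_coefficient_box _ cg).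
exact: trilinear_summable Lf (box_L2 M) (coefficient_meas cg) gC.
Qed.

Lemma coefficient_sqr_summable M f g : L2 f -> coefficient M g ->
  summable (fun x => f x ^+ 2 * g x).
Proof.
move=> Lf cg; have [C _ gC] := coefficient_bounded cg.
exact: (trilinear_summable Lf Lf (coefficient_meas cg) gC).
Qed.

(** Multiplied by the indicator of the support of its coefficient, the linear
    term becomes a trilinear one as well. *)
Lemma pairingE M f fx g1 g2 g3 : L2 f -> L2 fx -> coefficient M g1 ->
  coefficient M g2 -> coefficient M g3 ->
  pairing f fx g1 g2 g3 = lint (fun x => f x * box M x * g1 x) +
    lint (fun x => f x * f x * g2 x) + lint (fun x => fx x * fx x * g3 x).
Proof.
move=> Lf Lfx c1 c2 c3.
rewrite /pairing intD; last 2 first.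
- apply: summableD; first exact: coefficient_summable Lf c1.
  exact: coefficient_sqr_summable Lf c2.
- exact: coefficient_sqr_summable Lfx c3.
rewrite intD; [|exact: coefficient_summable Lf c1|exact: coefficient_sqr_summable Lf c2].
by rewrite (mul_coefficient_box _ c1).
Qed.

Lemma pairing_cvg {T} {F : set_system T} {FF : Filter F} M
  (f fx g1 g2 g3 : T -> R -> R) (a ax c1 c2 c3 : R -> R) :
  L2 a -> L2 ax -> coefficient M c1 -> coefficient M c2 -> coefficient M c3 ->
  (\forall t \near F, L2 (f t)) -> (\forall t \near F, L2 (fx t)) ->
  (forall t, coefficient M (g1 t)) -> (forall t, coefficient M (g2 t)) ->
  (forall t, coefficient M (g3 t)) ->
  norm2 (fun x => f t x - a x) @[t --> F] --> (0 : R) ->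
  norm2 (fun x => fx t x - ax x) @[t --> F] --> (0 : R) ->
  uniform_cvg F g1 c1 -> uniform_cvg F g2 c2 -> uniform_cvg F g3 c3 ->
  pairing (f t) (fx t) (g1 t) (g2 t) (g3 t) @[t --> F] --> pairing a ax c1 c2 c3.
Proof.
move=> La Lax cc1 cc2 cc3 Lf Lfx cg1 cg2 cg3 fa fxa u1 u2 u3.
rewrite (pairingE La Lax cc1 cc2 cc3).
have H : lint (fun x => f t x * box M x * g1 t x) +
    lint (fun x => f t x * f t x * g2 t x) +
    lint (fun x => fx t x * fx t x * g3 t x) @[t --> F] -->
    lint (fun x => a x * box M x * c1 x) +
    lint (fun x => a x * a x * c2 x) + lint (fun x => ax x * ax x * c3 x).
  have [C1 _ C1b] := coefficient_bounded cc1.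
  have [C2 _ C2b] := coefficient_bounded cc2.
  have [C3 _ C3b] := coefficient_bounded cc3.
  apply: cvgD; [apply: cvgD|].
  - apply: (trilinear_cvg (f2 := fun=> box M) La (box_L2 M) (coefficient_meas cc1) C1b) => //.
    + by apply: nearW => t; exact: box_L2.
    + by apply: nearW => t; exact: coefficient_meas (cg1 t).
    + have -> : (fun t : T => norm2 (fun x => box M x - box M x)) = fun=> 0.
        apply/funext => t; rewrite /norm2; under eq_fun do rewrite subrr expr0n/=.
        by rewrite /lint Rintegral_cst//= mul0r sqrtr0.
      exact: cvg_cst.
  - apply: (trilinear_cvg La La (coefficient_meas cc2) C2b) => //.
    by apply: nearW => t; exact: coefficient_meas (cg2 t).
  - apply: (trilinear_cvg Lax Lax (coefficient_meas cc3) C3b) => //.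
    by apply: nearW => t; exact: coefficient_meas (cg3 t).
apply: cvg_trans H; apply: near_eq_cvg; apply: filterS2 Lf Lfx => t Lft Lfxt.
by rewrite (pairingE Lft Lfxt (cg1 t) (cg2 t) (cg3 t)).
Qed.

End Pairing.

(** * From the weak formulation to the evolution of moments *)

Section Coefficients.
Context {R : realType}.
Implicit Types (f g phi psi : R -> R).

Lemma supported_derive1n M n phi : smooth phi -> supported M phi ->
  supported M (derive1n n phi).
Proof.
move=> sphi sM; elim: n => [//|n IH]; rewrite derive1nS.
by apply: supported_derive => // x; exact: sphi.
Qed.

Lemma test_coefficient psi : test_function psi ->
  exists M, forall n, coefficient M (derive1n n psi).
Proof.
move=> [spsi [M sM]]; exists M => n; split; last exact: supported_derive1n.
exact: (smooth_continuous (@smooth_derive1n _ n _ spsi)).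
Qed.

Lemma coefficientD M f g : coefficient M f -> coefficient M g ->
  coefficient M (fun x => f x + g x).
Proof.
move=> [cf sf] [cg sg]; split=> [x|x Mx]; first by apply: cvgD; [exact: cf|exact: cg].
by rewrite sf// sg// addr0.
Qed.

Lemma coefficientZ M c f : coefficient M f -> coefficient M (fun x => c * f x).
Proof.
move=> [cf sf]; split=> [x|x Mx]; first by apply: cvgMr; exact: cf.
by rewrite sf// mulr0.
Qed.

Lemma coefficientB M f g : coefficient M f -> coefficient M g ->
  coefficient M (fun x => f x - g x).
Proof.
move=> cf cg; have := coefficientD cf (@coefficientZ M (-1) _ cg).
by under [X in coefficient M X]eq_fun do rewrite mulN1r.
Qed.

Lemma coefficient0 M : coefficient M (fun=> 0 : R).
Proof. by split=> // x; exact: cvg_cst. Qed.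

(** Testing u against helmholtz psi is testing the momentum u - u_xx against psi. *)
Definition helmholtz psi x := psi x - derive1n 2 psi x.

(** The coefficient of u^2 in the weak formulation. *)
Definition flux2 psi x := 3 * derive1 psi x / 2 - derive1n 3 psi x / 2.

Lemma helmholtz_test psi : test_function psi -> test_function (helmholtz psi).
Proof.
by move=> tpsi; apply: test_functionB => //; exact: (@test_function_derive1n _ 2).
Qed.

Lemma test_functionsP psi : test_function psi -> exists M, [/\
  coefficient M (helmholtz psi), coefficient M (flux2 psi) &
  forall n, coefficient M (derive1n n psi)].
Proof.
move=> /test_coefficient[M cM]; exists M; split=> //.
- exact: coefficientB (cM 0%N) (cM 2%N).
- have := coefficientB (@coefficientZ M (3 / 2) _ (cM 1%N)) (@coefficientZ M 2^-1 _ (cM 3%N)).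
  rewrite /flux2; congr coefficient; apply/funext => x.
  by rewrite -[derive1n 1 psi]/(derive1 psi); field.
Qed.

(** The part of the weak formulation without time derivatives, for a test function
    of x alone. *)
Definition flux (k : R) (f fx psi : R -> R) : R :=
  pairing f fx (fun x => 2 * k * derive1 psi x) (flux2 psi)
    (fun x => derive1 psi x / 2).

Lemma lint_pairing f fx g : lint (fun x => f x * g x) =
  pairing f fx g (fun=> 0) (fun=> 0).
Proof. by congr lint; apply/funext => x; rewrite !mulr0 !addr0. Qed.

Lemma uniform_cvg_cst {T} (F : set_system T) {FF : Filter F} g :
  uniform_cvg F (fun=> g) g.
Proof. by move=> e e0; apply: nearW => t x; rewrite subrr normr0 ltW. Qed.

End Coefficients.

Section Evolution.
Context {R : realType}.
Local Notation mu := (@lebesgue_measure R).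
Variables (k : R) (J : set R) (u ux : R -> R -> R).
Hypotheses (oJ : open J) (cu : continuous_H1_with J u ux).

Lemma near_J t : J t -> \forall r \near t, J r.
Proof. by move=> Jt; exact: open_nbhs_nbhs. Qed.

Lemma H1_L2 t : J t -> L2 (u t). Proof. by move=> /cu[[]]. Qed.
Lemma H1_L2x t : J t -> L2 (ux t). Proof. by move=> /cu[[]]. Qed.

Lemma near_L2 t : J t -> \forall r \near t, L2 (u r).
Proof. by move=> /near_J; apply: filterS => r; exact: H1_L2. Qed.
Lemma near_L2x t : J t -> \forall r \near t, L2 (ux r).
Proof. by move=> /near_J; apply: filterS => r; exact: H1_L2x. Qed.

Lemma within_open_cvg t (f : R -> \bar R) (l : \bar R) : J t ->
  f r @[r --> within J (nbhs t)] --> l -> f r @[r --> t] --> l.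
Proof.
move=> Jt fl A /fl; rewrite /nbhs/= /within/=.
by apply: filterS2 (near_J Jt) => r Jr; exact.
Qed.

Lemma H1_cvg t : J t -> norm2 (fun x => u r x - u t x) @[r --> t] --> (0 : R).
Proof.
move=> Jt; have [_ cvgu _] := cu Jt.
apply/(L2norm_cvg0 (f := fun r x => u r x - u t x)).
  by apply: filterS (near_L2 Jt) => r Lr; apply: L2B => //; exact: H1_L2.
exact: within_open_cvg.
Qed.

Lemma H1_cvgx t : J t -> norm2 (fun x => ux r x - ux t x) @[r --> t] --> (0 : R).
Proof.
move=> Jt; have [_ _ cvgu] := cu Jt.
apply/(L2norm_cvg0 (f := fun r x => ux r x - ux t x)).
  by apply: filterS (near_L2x Jt) => r Lr; apply: L2B => //; exact: H1_L2x.
exact: within_open_cvg.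
Qed.

Lemma pairing_time_cvg t M (g1 g2 g3 : R -> R -> R) : J t ->
  (forall r, coefficient M (g1 r)) -> (forall r, coefficient M (g2 r)) ->
  (forall r, coefficient M (g3 r)) ->
  uniform_cvg (nbhs t) g1 (g1 t) -> uniform_cvg (nbhs t) g2 (g2 t) ->
  uniform_cvg (nbhs t) g3 (g3 t) ->
  {for t, continuous (fun r => pairing (u r) (ux r) (g1 r) (g2 r) (g3 r))}.
Proof.
move=> Jt c1 c2 c3 u1 u2 u3.
apply: (pairing_cvg (H1_L2 Jt) (H1_L2x Jt) (c1 t) (c2 t) (c3 t) (near_L2 Jt)
  (near_L2x Jt) c1 c2 c3 (H1_cvg Jt) (H1_cvgx Jt) u1 u2 u3).
Qed.

Lemma moment_continuous t M g : J t -> coefficient M g ->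
  {for t, continuous (fun r => lint (fun x => u r x * g x))}.
Proof.
move=> Jt cg.
have E : (fun r => lint (fun x => u r x * g x)) =
    (fun r => pairing (u r) (ux r) g (fun=> 0) (fun=> 0)).
  by apply/funext => r; exact: lint_pairing.
have tr (F G : R -> R) : F = G -> {for t, continuous G} -> {for t, continuous F}.
  by move=> ->.
apply: (tr _ _ E).
apply: (@pairing_time_cvg t M (fun=> g) (fun=> fun=> 0) (fun=> fun=> 0) Jt);
  try (move=> _; exact: coefficient0); try exact: uniform_cvg_cst.
by move=> _.
Qed.

Lemma flux_continuous t psi : J t -> test_function psi ->
  {for t, continuous (fun r => flux k (u r) (ux r) psi)}.
Proof.
move=> Jt /test_functionsP[M [_ c2 cM]].
have c1 : coefficient M (fun x => 2 * k * derive1 psi x).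
  exact: (@coefficientZ _ M (2 * k) _ (cM 1%N)).
have c3 : coefficient M (fun x => derive1 psi x / 2).
  have := @coefficientZ _ M 2^-1 _ (cM 1%N).
  by congr coefficient; apply/funext => x; rewrite mulrC.
apply: (@pairing_time_cvg t M (fun=> _) (fun=> _) (fun=> _) Jt (fun=> c1)
  (fun=> c2) (fun=> c3)); exact: uniform_cvg_cst.
Qed.

(** For a product test function rho(t) psi(x), with a = rho'(t) and b = rho(t). *)
Lemma moment_flux_split t psi a b : J t -> test_function psi ->
  lint (fun x => u t x * (a * psi x - a * derive1n 2 psi x + 2 * k * (b * derive1 psi x))
    + u t x ^+ 2 * (3 * (b * derive1 psi x) / 2 - (b * derive1n 3 psi x) / 2)
    + ux t x ^+ 2 * ((b * derive1 psi x) / 2)) =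
  a * lint (fun x => u t x * helmholtz psi x) + b * flux k (u t) (ux t) psi.
Proof.
move=> Jt /test_functionsP[M [c0 c2 cM]].
have c1 : coefficient M (fun x => 2 * k * derive1 psi x).
  exact: (@coefficientZ _ M (2 * k) _ (cM 1%N)).
have c3 : coefficient M (fun x => derive1 psi x / 2).
  have := @coefficientZ _ M 2^-1 _ (cM 1%N).
  by congr coefficient; apply/funext => x; rewrite mulrC.
have s0 := coefficient_summable (H1_L2 Jt) c0.
have s1 : summable (fun x => u t x * (2 * k * derive1 psi x) +
    u t x ^+ 2 * flux2 psi x + ux t x ^+ 2 * (derive1 psi x / 2)).
  apply: summableD; first apply: summableD.
  - exact: coefficient_summable (H1_L2 Jt) c1.
  - exact: coefficient_sqr_summable (H1_L2 Jt) c2.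
  - exact: coefficient_sqr_summable (H1_L2x Jt) c3.
rewrite /flux /pairing -(intZ a s0) -(intZ b s1) -intD; [|exact: summableZ|exact: summableZ].
congr lint; apply/funext => x; rewrite /helmholtz /flux2.
move: (derive1n 2 psi x) (derive1n 3 psi x) (derive1 psi x) => p2 p3 p1.
by field.
Qed.

Lemma iter_partial_product (w : seq bool) (rho psi : R -> R) :
  smooth rho -> smooth psi ->
  iter_partial w (fun t x => rho t * psi x) = fun t x =>
    derive1n (count id w) rho t * derive1n (count negb w) psi x.
Proof.
move=> srho spsi; elim: w => [//|b w IH] /=; rewrite IH.
case: b; apply/funext => t; apply/funext => x; rewrite ?add0n ?add1n derive1nS.
  rewrite /dt mulrC; have := is_deriveZ1 (derive1n (count negb w) psi x)
    (smooth_is_derive t (@smooth_derive1n _ (count id w) _ srho)).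
  by move=> /is_derive1E <-; congr (derive1 _ t); apply/funext => y; rewrite mulrC.
rewrite /dx; have := is_deriveZ1 (derive1n (count id w) rho t)
  (smooth_is_derive x (@smooth_derive1n _ (count negb w) _ spsi)).
by move=> /is_derive1E <-.
Qed.

Lemma product_test_function rho psi : test_function rho -> test_function psi ->
  (exists a b, `[a, b] `<=` J /\ forall t, ~ (a <= t <= b) -> rho t = 0) ->
  spacetime_test_function J (fun t x => rho t * psi x).
Proof.
move=> [srho _] [spsi [M sM]] [a [b [abJ rho0]]]; split; last first.
  exists a, b, M; split=> // t x nab.
  have [tab|/negP/rho0 ->] := boolP (a <= t <= b); last by rewrite mul0r.
  have [xM|/sM ->] := leP `|x| M; last by rewrite mulr0.
  by exfalso; exact: nab.
move=> w; rewrite (iter_partial_product w srho spsi) /=; split.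
  move=> p; apply: cvgM.
    apply: (@continuous_comp _ _ _ fst (derive1n (count id w) rho) p); first exact: cvg_fst.
    exact: (smooth_continuous (@smooth_derive1n _ _ _ srho)).
  apply: (@continuous_comp _ _ _ snd (derive1n (count negb w) psi) p); first exact: cvg_snd.
  exact: (smooth_continuous (@smooth_derive1n _ _ _ spsi)).
move=> t x; split.
  have := is_deriveZ1 (derive1n (count negb w) psi x)
    (smooth_is_derive t (@smooth_derive1n _ (count id w) _ srho)).
  by under [X in is_derive _ _ X]eq_fun do rewrite mulrC; case.
by have := is_deriveZ1 (derive1n (count id w) rho t)
  (smooth_is_derive x (@smooth_derive1n _ (count negb w) _ spsi)); case.
Qed.

(** Product test functions rho(t) psi(x) reduce the weak formulation to one in t
    alone, to which the lemma of du Bois-Reymond applies. *)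
Lemma weak_evolution :
  (forall phi, spacetime_test_function J phi ->
    \int[mu]_(t in J) \int[mu]_x
      (u t x * (dt phi t x - dx (dx (dt phi)) t x + 2 * k * dx phi t x)
       + u t x ^+ 2 * (3 * dx phi t x / 2 - dx (dx (dx phi)) t x / 2)
       + ux t x ^+ 2 * (dx phi t x / 2)) = 0) ->
  forall psi, test_function psi -> forall t, J t ->
    is_derive t (1 : R) (fun r => lint (fun x => u r x * helmholtz psi x))
      (flux k (u t) (ux t) psi).
Proof.
move=> weak psi tpsi; have [H [sH H0 H1 dH]] := @smooth_step_exists R.
apply: (dubois_reymond sH H0 H1 dH (f := fun r => lint (fun x => u r x * helmholtz psi x))
  (g := fun t => flux k (u t) (ux t) psi) oJ).
- move=> t Jt; have [M [c0 _ _]] := test_functionsP tpsi.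
  exact: moment_continuous Jt c0.
- by move=> t Jt; exact: flux_continuous.
- move=> rho trho rhoJ; pose phi t x := rho t * psi x.
  have W p1 p2 p3 p4 : dt phi = p1 -> dx phi = p2 -> dx (dx (dt phi)) = p3 ->
      dx (dx (dx phi)) = p4 ->
      \int[mu]_(t in J) \int[mu]_x
        (u t x * (p1 t x - p3 t x + 2 * k * p2 t x)
         + u t x ^+ 2 * (3 * p2 t x / 2 - p4 t x / 2)
         + ux t x ^+ 2 * (p2 t x / 2)) = 0.
    move=> <- <- <- <-.
    exact: (weak phi (product_test_function trho tpsi rhoJ)).
  have P w : iter_partial w phi = _ :=
    iter_partial_product w (test_function_smooth trho) (test_function_smooth tpsi).
  have := W _ _ _ _ (P [:: true]) (P [:: false]) (P [:: false; false; true])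
    (P [:: false; false; false]).
  move=> W0; rewrite -[RHS]W0.
  apply: eq_Rintegral => t; rewrite inE => Jt.
  exact/esym/(moment_flux_split _ _ Jt tpsi).
Qed.

End Evolution.

(** * Moments against a moving test function *)

Section MomentDerivative.
Context {R : realType}.
Implicit Types (f g : R -> R).

Lemma near_shift0 (P : R -> Prop) (t : R) : (\forall r \near t, P r) ->
  \forall h \near (0 : R), P (t + h).
Proof.
rewrite (near_shift 0 t) subr0; apply: filterS => h; by rewrite /= addrC.
Qed.

(** Differentiability of G at t in the supremum norm. *)
Definition uniform_derive (G : R -> R -> R) (t : R) (Gdot : R -> R) :=
  forall e, 0 < e -> \forall h \near (0 : R), forall x,
    `|G (t + h) x - G t x - h * Gdot x| <= e * `|h|.

(** Leibniz rule for the moments of a curve in L^2 against a moving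
    coefficient: the curve need only be continuous in norm. *)
Lemma moment_derive (w G : R -> R -> R) (Gdot : R -> R) (t M b : R) :
  (\forall r \near t, L2 (w r)) ->
  norm2 (fun x => w r x - w t x) @[r --> t] --> (0 : R) ->
  (\forall r \near t, coefficient M (G r)) -> coefficient M Gdot ->
  uniform_derive G t Gdot ->
  is_derive t (1 : R) (fun r => lint (fun x => w r x * G t x)) b ->
  is_derive t (1 : R) (fun r => lint (fun x => w r x * G r x))
    (b + lint (fun x => w t x * Gdot x)).
Proof.
move=> nL cw nG cGd uG /is_deriveP db; apply/is_deriveP => e e0.
have Lt : L2 (w t) by exact: nbhs_singleton nL.
have cGt : coefficient M (G t) by exact: nbhs_singleton nG.
have [C C0 GdC] := coefficient_bounded cGd.
pose K := norm2 (box M : R -> R).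
have K0 : 0 <= K by exact: norm2_ge0.
have N0 := norm2_ge0 (w t).
have p1 : 0 < (norm2 (w t) + 1) * K + 1 by rewrite ltr_wpDl// mulr_ge0// addr_ge0.
have p2 : 0 < C * K + 1 by rewrite ltr_wpDl// mulr_ge0.
have e30 : 0 < e / 3 by rewrite divr_gt0.
pose e2 := e / 3 / ((norm2 (w t) + 1) * K + 1).
have e20 : 0 < e2 by rewrite divr_gt0.
pose d := Num.min 1 (e / 3 / (C * K + 1)).
have d0 : 0 < d by rewrite lt_min ltr01 divr_gt0.
move/cvgrPdist_le : cw => /(_ _ d0) /near_shift0 cw.
have {}nL := near_shift0 nL; have {}nG := near_shift0 nG.
near=> h.
have Lh : L2 (w (t + h)) by near: h.
have cGh : coefficient M (G (t + h)) by near: h.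
have wd : norm2 (fun x => w (t + h) x - w t x) <= d.
  by rewrite -[leLHS]ger0_norm ?norm2_ge0// -normrN -sub0r; near: h.
have Gh x : `|G (t + h) x - G t x - h * Gdot x| <= e2 * `|h|.
  by move: x; near: h; exact: uG.
have b1 : `|lint (fun x => w (t + h) x * G t x) - lint (fun x => w t x * G t x) - h * b|
    <= e / 3 * `|h| by near: h; exact: db.
pose D x := G (t + h) x - G t x - h * Gdot x.
have cD : coefficient M D.
  exact: (coefficientB (coefficientB cGh cGt) (@coefficientZ _ M h _ cGd)).
have LB := L2B Lh Lt.
have E : lint (fun x => w (t + h) x * G (t + h) x) - lint (fun x => w t x * G t x)
    - h * (b + lint (fun x => w t x * Gdot x)) =
  (lint (fun x => w (t + h) x * G t x) - lint (fun x => w t x * G t x) - h * b)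
  + lint (fun x => w (t + h) x * D x)
  + h * lint (fun x => (w (t + h) x - w t x) * Gdot x).
  have -> : (fun x => w (t + h) x * D x) = (fun x => (w (t + h) x * G (t + h) x -
      w (t + h) x * G t x) - h * (w (t + h) x * Gdot x)).
    by apply/funext => x; rewrite /D; ring.
  have -> : (fun x => (w (t + h) x - w t x) * Gdot x) = (fun x => w (t + h) x * Gdot x -
      w t x * Gdot x) by apply/funext => x; rewrite mulrBl.
  have s1 := coefficient_summable Lh cGh; have s2 := coefficient_summable Lh cGt.
  have s3 := coefficient_summable Lh cGd; have s4 := coefficient_summable Lt cGd.
  rewrite [in RHS]intB; [|exact: summableB|exact: summableZ].
  by rewrite intB// intZ// intB//; ring.
have he0 : 0 <= e2 * `|h| by rewrite mulr_ge0// ltW.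
have b2 : `|lint (fun x => w (t + h) x * D x)| <= e / 3 * `|h|.
  rewrite (mul_coefficient_box _ cD).
  apply: le_trans (trilinear_bound Lh (box_L2 M) (coefficient_meas cD) he0 Gh) _.
  have nh : norm2 (w (t + h)) <= norm2 (w t) + 1.
    have := norm2D Lt LB.
    rewrite (_ : (fun x => w t x + _) = w (t + h)); last by apply/funext => x; rewrite subrKC.
    by move=> /le_trans; apply; rewrite lerD2l (le_trans wd)// ge_min lexx.
  have : norm2 (w (t + h)) * K <= (norm2 (w t) + 1) * K + 1.
    by rewrite (@le_trans _ _ ((norm2 (w t) + 1) * K))// ?lerDl// ler_wpM2r.
  move=> H; rewrite -mulrA (le_trans (ler_wpM2l he0 H))//.
  by rewrite mulrAC /e2 divfK// gt_eqF.
have b3 : `|h * lint (fun x => (w (t + h) x - w t x) * Gdot x)| <= e / 3 * `|h|.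
  rewrite normrM mulrC ler_wpM2r// (mul_coefficient_box _ cGd).
  apply: le_trans (trilinear_bound LB (box_L2 M) (coefficient_meas cGd) C0 GdC) _.
  have dK : d * (C * K + 1) <= e / 3 by rewrite -ler_pdivlMr// ge_min lexx orbT.
  apply: le_trans dK; rewrite mulrAC mulrC -/K.
  by apply: ler_pM => //; rewrite ?norm2_ge0 ?mulr_ge0// lerDl.
rewrite E (le_trans (ler_normD _ _))//.
rewrite (le_trans (lerD (ler_normD _ _) (lexx _)))//.
rewrite (le_trans (lerD (lerD b1 b2) b3))//.
rewrite (_ : e / 3 * `|h| + e / 3 * `|h| + e / 3 * `|h| = e * `|h|)//.
by field.
Unshelve. all: by end_near.
Qed.

Lemma coefficient_affine M s a g : s = 1 \/ s = -1 -> coefficient M g ->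
  coefficient (M + `|a|) (fun x => g (a + s * x)).
Proof.
move=> s1 [cg sg]; split=> [x|x Mx].
  apply: continuous_comp; last exact: cg.
  by apply: cvgD; [exact: cvg_cst|apply: cvgMr; exact: cvg_id].
apply: sg; have := ler_normB (a + s * x) a; rewrite addrAC subrr add0r normrM.
have -> : `|s| = 1 by case: s1 => ->; rewrite ?normrN normr1.
rewrite mul1r => H; rewrite -(ltrD2r `|a|); exact: lt_le_trans Mx H.
Qed.

Lemma coefficient_le M N g : M <= N -> coefficient M g -> coefficient N g.
Proof.
by move=> MN [cg sg]; split=> // x Nx; apply: sg; exact: le_lt_trans Nx.
Qed.

Lemma uniform_derive_path (g : R -> R) (a : R -> R) (t s da : R) :
  test_function g -> is_derive t (1 : R) a da ->
  uniform_derive (fun r x => g (a r + s * x)) t (fun x => da * derive1 g (a t + s * x)).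
Proof.
move=> tg /is_deriveP dera e e0.
have tg1 := test_function_derive tg; have tg2 := test_function_derive tg1.
have [C1 C10 g1C] := test_function_bounded tg1.
have [C2 C20 g2C] := test_function_bounded tg2.
have T := taylor1_is_derive (fun x => smooth_is_derive x tg.1)
  (fun x => smooth_is_derive x tg1.1) g2C.
(* with q = a (t + h) - a t, the error is at most C1 |q - h da| + C2 q^2 *)
have q1 : 0 < C1 + 1 by rewrite ltr_wpDl.
pose e1 := Num.min 1 (e / 2 / (C1 + 1)).
have e10 : 0 < e1 by rewrite lt_min ltr01 !divr_gt0.
pose L := `|da| + 1.
have L0 : 0 < L by rewrite ltr_wpDl.
have q2 : 0 < C2 * L ^+ 2 + 1 by rewrite ltr_wpDl// mulr_ge0// sqr_ge0.
near=> h => x.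
have hq : `|a (t + h) - a t - h * da| <= e1 * `|h| by near: h; exact: dera.
have hh : `|h| <= e / 2 / (C2 * L ^+ 2 + 1).
  by near: h; apply: near0_le; rewrite !divr_gt0.
set q := a (t + h) - a t in hq *.
have qL : `|q| <= L * `|h|.
  have -> : q = (q - h * da) + h * da by rewrite subrK.
  rewrite (le_trans (ler_normD _ _))// /L mulrDl addrC lerD//.
    by rewrite normrM mulrC.
  by rewrite (le_trans hq)// ler_wpM2r// ge_min lexx.
have -> : g (a (t + h) + s * x) - g (a t + s * x) - h * (da * derive1 g (a t + s * x)) =
  (g (a t + s * x + q) - g (a t + s * x) - q * derive1 g (a t + s * x)) +
  (q - h * da) * derive1 g (a t + s * x).
  have -> : a t + s * x + q = a (t + h) + s * x by rewrite /q; ring.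
  by ring.
rewrite (le_trans (ler_normD _ _))//.
have -> : e * `|h| = e / 2 * `|h| + e / 2 * `|h| by field.
apply: lerD.
  rewrite (le_trans (T _ _))//.
  apply: (@le_trans _ _ (C2 * (L * `|h|) ^+ 2)).
    rewrite ler_wpM2l// -[leLHS]real_normK ?num_real// lerXn2r// nnegrE mulr_ge0//.
    exact: ltW.
  rewrite exprMn mulrA expr2 mulrA ler_wpM2r//.
  rewrite ler_pdivlMr// in hh; apply: le_trans hh.
  by rewrite mulrC ler_wpM2l// lerDl.
rewrite normrM (le_trans (ler_pM _ _ hq (g1C _)))//.
rewrite mulrAC ler_wpM2r//.
have : e1 * (C1 + 1) <= e / 2 by rewrite -ler_pdivlMr// ge_min lexx orbT.
by apply: le_trans; rewrite ler_wpM2l// ?lerDl// ltW.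
Unshelve. all: by end_near.
Qed.

Lemma moment_path (w : R -> R -> R) (g a : R -> R) (t s da b : R) :
  s = 1 \/ s = -1 -> test_function g -> is_derive t (1 : R) a da ->
  (\forall r \near t, L2 (w r)) ->
  norm2 (fun x => w r x - w t x) @[r --> t] --> (0 : R) ->
  is_derive t (1 : R) (fun r => lint (fun x => w r x * g (a t + s * x))) b ->
  is_derive t (1 : R) (fun r => lint (fun x => w r x * g (a r + s * x)))
    (b + da * lint (fun x => w t x * derive1 g (a t + s * x))).
Proof.
move=> s1 tg dera nL cw db.
have [M cM] := test_coefficient tg.
have Lt : L2 (w t) by exact: nbhs_singleton nL.
have cM1 : coefficient (M + (`|a t| + 1)) (fun x => derive1 g (a t + s * x)).
  apply: (coefficient_le _ (coefficient_affine (a t) s1 (cM 1%N))).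
  by rewrite lerD2l lerDl.
have -> : da * lint (fun x => w t x * derive1 g (a t + s * x)) =
    lint (fun x => w t x * (da * derive1 g (a t + s * x))).
  rewrite -intZ; last exact: coefficient_summable Lt cM1.
  by congr lint; apply/funext => x; ring.
apply: (@moment_derive w (fun r x => g (a r + s * x)) _ t (M + (`|a t| + 1))) => //.
- have := is_derive_continuous dera; move=> /cvgrPdist_le /(_ _ ltr01).
  apply: filterS => r ar.
  apply: (coefficient_le _ (coefficient_affine (a r) s1 (cM 0%N))).
  rewrite lerD2l -[a r](subrK (a t)) (le_trans (ler_normD _ _))//.
  by rewrite addrC lerD2l distrC.
- exact: (@coefficientZ _ _ da _ cM1).
- exact: uniform_derive_path.
Qed.

End MomentDerivative.

(** * The profile equation of a symmetric solution *)

Section Symmetry.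
Context {R : realType}.
Implicit Types (f g psi : R -> R).

Lemma derive1n_affine n psi s a : smooth psi ->
  derive1n n (fun x => psi (a + s * x)) = fun x => s ^+ n * derive1n n psi (a + s * x).
Proof.
move=> spsi; elim: n => [|n IH].
  by apply/funext => x; rewrite /= expr0 mul1r.
rewrite derive1nS IH; apply/funext => x; apply: is_derive1E.
have := is_deriveZ1 (s ^+ n) (@is_derive_comp1 _ (derive1n n psi) (fun y => s * y + a) x _ _
  (smooth_is_derive _ (@smooth_derive1n _ n _ spsi)) (is_derive_affine s a x)).
rewrite -derive1nS (addrC (s * x)) (mulrC _ s) mulrA -exprSr.
by under [X in is_derive _ _ X]eq_fun do rewrite (addrC (s * _)).
Qed.

Lemma helmholtz_affine psi s a x : s ^+ 2 = 1 -> smooth psi ->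
  helmholtz (fun x => psi (a + s * x)) x = helmholtz psi (a + s * x).
Proof.
by move=> s2 spsi; rewrite /helmholtz (@derive1n_affine 2)// s2 mul1r.
Qed.

Lemma test_function_add_mul a s psi : s = 1 \/ s = -1 -> test_function psi ->
  test_function (fun x => psi (a + s * x)).
Proof.
move=> s1 tpsi; have s0 : s != 0 by case: s1 => ->; rewrite ?oppr_eq0 oner_eq0.
have := test_function_affine a s0 tpsi.
by under [X in test_function X -> _]eq_fun do rewrite addrC.
Qed.

Lemma flux_meas k M f fx psi : L2 f -> L2 fx -> (forall n, coefficient M (derive1n n psi)) ->
  measurable_fun setT (fun x => f x * (2 * k * derive1 psi x) +
    f x ^+ 2 * flux2 psi x + fx x ^+ 2 * (derive1 psi x / 2)).
Proof.
move=> /L2_meas mf /L2_meas mfx cM.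
have m1 : measurable_fun setT (derive1 psi) := coefficient_meas (cM 1%N).
have m3 : measurable_fun setT (derive1n 3 psi) := coefficient_meas (cM 3%N).
apply: measurable_funD; [apply: measurable_funD|].
- by apply: measurable_funM => //; exact: measurable_funM.
- apply: measurable_funM; first exact: measurable_funX.
  apply: measurable_funB; apply: measurable_funM => //.
  exact: measurable_funM.
- by apply: measurable_funM; [exact: measurable_funX|exact: measurable_funM].
Qed.

(** The flux is odd under reflection: it contains an odd number of
    x-derivatives of the test function, and u_x enters through its square. *)
Lemma flux_reflect k c f fx psi : L2 f -> L2 fx -> test_function psi ->
  ae_equal f (fun x => f (c - x)) -> ae_equal fx (fun x => - fx (c - x)) ->
  flux k f fx (fun x => psi (c + -1 * x)) = - flux k f fx psi.
Proof.
move=> Lf Lfx tpsi fs fxs; have [M cM] := test_coefficient tpsi.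
have n1 : (-1 : R) = 1 \/ (-1 : R) = -1 by right.
have tpsi' := test_function_add_mul c n1 tpsi.
have [M' cM'] := test_coefficient tpsi'.
have pc := preserving_reflect c.
have mF := flux_meas k Lf Lfx cM.
have mF' := flux_meas k Lf Lfx cM'.
have sF : summable (fun x => f x * (2 * k * derive1 psi x) +
    f x ^+ 2 * flux2 psi x + fx x ^+ 2 * (derive1 psi x / 2)).
  have [N [_ c2 cN]] := test_functionsP tpsi.
  apply: summableD; first apply: summableD.
  - exact: (coefficient_summable Lf (@coefficientZ _ N (2 * k) _ (cN 1%N))).
  - exact: (coefficient_sqr_summable Lf c2).
  - have := coefficient_sqr_summable Lfx (@coefficientZ _ N 2^-1 _ (cN 1%N)).
    by under [X in summable X -> _]eq_fun do rewrite (mulrC 2^-1).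
rewrite /flux /pairing -[RHS]mulN1r -intZ//.
rewrite -(lint_preserving (f := fun x => -1 * _) pc); last exact: measurable_funM.
apply: int_ae_eq => //.
  exact: (measurable_funM (measurable_cst _) (meas_preserving pc mF)).
have D n x := congr1 (fun f => f x) (@derive1n_affine n psi (-1) c tpsi.1).
apply: filterS2 fs fxs => x fx1 fx2.
have D1 : derive1 (fun x => psi (c + -1 * x)) x = (-1) ^+ 1 * derive1 psi (c + -1 * x).
  exact: (D 1%N x).
rewrite /flux2 D1 (D 3%N x) {1 2}fx1 fx2 (_ : c + -1 * x = c - x); last by rewrite mulN1r.
move: (derive1 psi _) (derive1n 3 psi _) (f _) (fx _) => p1 p3 q1 q2.
by field.
Qed.

Lemma flux_shift k h f fx psi : L2 f -> L2 fx -> test_function psi ->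
  flux k (fun x => f (x - h)) (fun x => fx (x - h)) psi =
  flux k f fx (fun x => psi (h + 1 * x)).
Proof.
move=> Lf Lfx tpsi; have [M cM] := test_coefficient tpsi.
have mF := flux_meas k (L2_preserving (preserving_shift (- h)) Lf)
  (L2_preserving (preserving_shift (- h)) Lfx) cM.
rewrite /flux /pairing -(lint_preserving (preserving_shift h) mF).
have D n x := congr1 (fun f => f x) (@derive1n_affine n psi 1 h tpsi.1).
congr lint; apply/funext => x.
have D1 : derive1 (fun x => psi (h + 1 * x)) x = 1 ^+ 1 * derive1 psi (h + 1 * x).
  exact: (D 1%N x).
rewrite /flux2 addrK D1 (D 3%N x) mul1r !expr1n !mul1r (addrC x).
by [].
Qed.

Variables (k : R) (J : set R) (u ux : R -> R -> R) (lambda : R -> R).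
Hypotheses (oJ : open J) (cu : continuous_H1_with J u ux).
Hypothesis evol : forall psi, test_function psi -> forall t, J t ->
  is_derive t (1 : R) (fun r => lint (fun x => u r x * helmholtz psi x))
    (flux k (u t) (ux t) psi).
Hypothesis lambda_derive : forall t, J t -> derivable lambda t 1.
Hypothesis sym : forall t, J t -> ae_equal (u t) (fun x => u t (2 * lambda t - x)).

(** The symmetry of u t, moved to the test function. *)
Lemma symmetric_moment t g : J t -> measurable_fun setT g ->
  lint (fun x => u t x * g (2 * lambda t + -1 * x)) = lint (fun x => u t x * g x).
Proof.
move=> Jt mg; have Lt := H1_L2 cu Jt; have mt := L2_meas Lt.
have mug : measurable_fun setT (fun x => u t x * g x) by exact: measurable_funM.
have pr := preserving_reflect (2 * lambda t).
rewrite -(lint_preserving pr mug); apply: int_ae_eq.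
- apply: measurable_funM => //.
  have := meas_preserving pr mg.
  by under [X in measurable_fun _ X]eq_fun do rewrite -mulN1r.
- exact: meas_preserving pr mug.
- by apply: filterS (sym Jt) => x E; rewrite mulN1r {1}E.
Qed.

(** With g = helmholtz psi, the moments of u t against g and against its
    reflection g (2 lambda t - .) coincide, hence have the same derivative F.
    For the second one, the flux contributes - F because it is odd under
    reflection, and the motion of the axis contributes 2 lambda' int u g'.  Thus
    F = lambda' int u g', the weak equation of a wave of speed lambda'. *)
Lemma symmetric_profile t psi : J t -> test_function psi ->
  flux k (u t) (ux t) psi =
  derive1 lambda t * lint (fun x => u t x * derive1 (helmholtz psi) x).
Proof.
move=> Jt tpsi; set c := 2 * lambda t.
have n1 : (-1 : R) = 1 \/ (-1 : R) = -1 by right.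
have tg := helmholtz_test tpsi.
have Lt := H1_L2 cu Jt; have Ltx := H1_L2x cu Jt.
have symx : ae_equal (ux t) (fun x => - ux t (c - x)).
  have [Ht _ _] := cu Jt.
  exact: weak_derivative_unique Ht (H1_with_reflect c Ht) (sym Jt).
have dl : is_derive t (1 : R) (fun r => 2 * lambda r) (2 * derive1 lambda t).
  by apply: is_deriveZ1; apply: derivable_is_derive; exact: lambda_derive.
have d1 := evol (test_function_add_mul c n1 tpsi) Jt.
have {d1}d1 : is_derive t (1 : R)
    (fun r => lint (fun x => u r x * helmholtz psi (c + -1 * x)))
    (- flux k (u t) (ux t) psi).
  rewrite -(flux_reflect k Lt Ltx tpsi (sym Jt) symx).
  have n12 : (-1 : R) ^+ 2 = 1 by rewrite sqrrN expr1n.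
  have E : helmholtz (fun x => psi (c + -1 * x)) = (fun x => helmholtz psi (c + -1 * x)).
    by apply/funext => x; exact: (helmholtz_affine c x n12 tpsi.1).
  by rewrite E in d1; exact: d1.
have d2 := moment_path n1 tg dl (near_L2 oJ cu Jt) (H1_cvg oJ cu Jt) d1.
have d3 : is_derive t (1 : R) (fun r => lint (fun x => u r x * helmholtz psi x))
    (- flux k (u t) (ux t) psi + 2 * derive1 lambda t *
      lint (fun x => u t x * derive1 (helmholtz psi) (2 * lambda t + -1 * x))).
  apply: (is_derive_near _ d2); apply: filterS (near_J oJ Jt) => r Jr.
  exact: (symmetric_moment Jr (test_function_meas tg)).
have half (X F L L' d : R) : X = F -> X = - F + 2 * d * L' -> L' = L -> F = d * L.
  by move=> -> FE <-; lra.
exact: (half _ _ _ _ _ (is_derive1E (evol tpsi Jt)) (is_derive1E d3)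
  (symmetric_moment Jt (test_function_meas (test_function_derive tg)))).
Qed.

End Symmetry.

(** * Replacing a solution by a travelling wave after a given time *)

Section StoppedWave.
Context {R : realType}.

Lemma lint_shift_moment (f g : R -> R) h : measurable_fun setT f ->
  measurable_fun setT g ->
  lint (fun x => f (x - h) * g x) = lint (fun x => f x * g (h + 1 * x)).
Proof.
move=> mf mg; have ph := preserving_shift h.
have m : measurable_fun setT (fun x : R => f (x - h) * g x).
  apply: measurable_funM => //.
  exact: (meas_preserving (preserving_shift (- h)) mf).
rewrite -(lint_preserving ph m); congr lint; apply/funext => x.
by rewrite addrK mul1r addrC.
Qed.

Variables (t0 c : R).

(** The competitor for uniqueness: u up to time t0, and from then on the
    profile u t0 travelling at speed c.  Writing both regimes with min and max
    makes continuity at t0 automatic. *)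
Definition stopped (u : R -> R -> R) (r x : R) : R :=
  u (Num.min r t0) (x - c * Num.max (r - t0) 0).

Lemma stopped_before u r : r <= t0 -> stopped u r = u r.
Proof.
move=> rt; apply/funext => x; rewrite /stopped (min_idPl rt) (max_idPr _) ?subr_le0//.
by rewrite mulr0 subr0.
Qed.

Lemma stopped_after u r : t0 <= r -> stopped u r = fun x => u t0 (x - c * (r - t0)).
Proof.
move=> tr; apply/funext => x; rewrite /stopped (min_idPr tr) (max_idPl _)//.
by rewrite subr_ge0.
Qed.

Lemma min_within_cvg (A : set R) (t : R) : A t0 -> A t ->
  Num.min r t0 @[r --> within A (nbhs t)] --> within A (nbhs (Num.min t t0)).
Proof.
move=> At0 At P [e /= e0 eP].
have : \forall r \near t, `|r - t| < e.
  by apply/nbhs_ballP; exists e => //= r; rewrite /ball/= distrC.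
apply: filterS => r rt Ar; apply: eP.
  rewrite /ball/=; have [h1|h1] := leP t t0; have [h2|h2] := leP r t0.
  - by rewrite distrC.
  - rewrite ler0_norm ?subr_le0// opprB; apply: le_lt_trans rt.
    by rewrite (le_trans _ (ler_norm _))// lerD2r ltW.
  - rewrite ger0_norm ?subr_ge0//; apply: le_lt_trans rt.
    by rewrite distrC (le_trans _ (ler_norm _))// lerD2r ltW.
  - by rewrite subrr normr0.
by have [_|_] := leP r t0.
Qed.

Lemma delay_cvg (A : set R) (t : R) :
  c * Num.max (t - t0) 0 - c * Num.max (r - t0) 0 @[r --> within A (nbhs t)] --> (0 : R).
Proof.
have cvgt : c * Num.max (t - t0) 0 - c * Num.max (r - t0) 0 @[r --> t] -->
    c * Num.max (t - t0) 0 - c * Num.max (t - t0) 0.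
  apply: cvgB; first exact: cvg_cst.
  apply: cvgMr.
  apply: (@continuous_max _ _ (fun r : R => r - t0) (fun=> 0)); last exact: cvg_cst.
  by apply: cvgB; [exact: cvg_id|exact: cvg_cst].
rewrite subrr in cvgt; apply: cvg_trans cvgt; apply: cvg_app; exact: cvg_within.
Qed.

Lemma L2_stopped (A : set R) u r : A t0 -> (forall t, A t -> L2 (u t)) -> A r ->
  L2 (stopped u r).
Proof.
move=> At0 Lu Ar; apply: (L2_preserving (preserving_shift _)); apply: Lu.
by have [_|_] := leP r t0.
Qed.

(** The change of the stopped wave between two times is a translate of the change
    of u plus the change of a fixed function under a small translation. *)
Lemma stopped_norm2_cvg (A : set R) u t : A t0 -> A t -> (forall t, A t -> L2 (u t)) ->
  (forall s, A s -> norm2 (fun x => u r x - u s x) @[r --> within A (nbhs s)] --> (0 : R)) ->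
  norm2 (fun x => stopped u r x - stopped u t x) @[r --> within A (nbhs t)] --> (0 : R).
Proof.
move=> At0 At Lu cu.
have Am s : A s -> A (Num.min s t0) by move=> As; have [_|_] := leP s t0.
have cu1 : norm2 (fun x => u (Num.min r t0) x - u (Num.min t t0) x)
    @[r --> within A (nbhs t)] --> (0 : R).
  exact: cvg_comp (min_within_cvg At0 At) (cu _ (Am _ At)).
have cu2 : norm2 (fun x => u (Num.min t t0) (x + (c * Num.max (t - t0) 0 -
      c * Num.max (r - t0) 0)) - u (Num.min t t0) x)
    @[r --> within A (nbhs t)] --> (0 : R).
  exact: cvg_comp (@delay_cvg A t) (L2_translation (Lu _ (Am _ At))).
apply: (@squeeze_cvgr _ _ _ _ (fun=> 0) (fun r =>
    norm2 (fun x => u (Num.min r t0) x - u (Num.min t t0) x) +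
    norm2 (fun x => u (Num.min t t0) (x + (c * Num.max (t - t0) 0 -
      c * Num.max (r - t0) 0)) - u (Num.min t t0) x))); last 2 first.
- exact: cvg_cst.
- by rewrite -[X in _ --> X](addr0 0); exact: cvgD.
have : \forall r \near within A (nbhs t), A r by exact: withinT.
apply: filterS => r Ar; rewrite norm2_ge0/=.
set ar := c * Num.max (r - t0) 0; set at_ := c * Num.max (t - t0) 0.
have Lr := Lu _ (Am _ Ar); have Lt := Lu _ (Am _ At).
have pr := preserving_shift (- ar); have pt := preserving_shift at_.
have L1 := L2_preserving pr Lr; have L2' := L2_preserving pr Lt.
have L3 := L2_preserving (preserving_shift (- at_)) Lt.
apply: le_trans (norm2_triangle L1 L3 L2') _; apply: lerD.
  rewrite (norm2_preserving (f := fun x => u (Num.min r t0) x - u (Num.min t t0) x) pr)//.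
  by apply: measurable_funB; exact: L2_meas.
rewrite -(norm2_preserving pt); last by apply: measurable_funB; exact: L2_meas.
under [X in norm2 X <= _]eq_fun do rewrite addrK -addrA.
exact: lexx.
Qed.

Lemma stopped_H1 (A : set R) u ux : A t0 -> continuous_H1_with A u ux ->
  continuous_H1_with A (stopped u) (stopped ux).
Proof.
move=> At0 cu t At.
have Am s : A s -> A (Num.min s t0) by move=> As; have [_|_] := leP s t0.
have Lu s : A s -> L2 (u s) by move=> /cu[[]].
have Lux s : A s -> L2 (ux s) by move=> /cu[[]].
have nearA : \forall r \near within A (nbhs t), A r by exact: withinT.
have cvgn f : (forall s, A s -> L2 (f s)) -> (forall s, A s ->
    L2norm (f r \- f s) @[r --> within A (nbhs s)] --> 0%E) ->
    L2norm (stopped f r \- stopped f t) @[r --> within A (nbhs t)] --> 0%E.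
  move=> Lf cf; apply/(L2norm_cvg0 (f := fun r x => stopped f r x - stopped f t x)).
    by apply: filterS nearA => r Ar; apply: L2B; exact: (L2_stopped At0 Lf).
  apply: stopped_norm2_cvg => // s As.
  apply/(L2norm_cvg0 (f := fun r x => f r x - f s x)); last exact: cf.
  have : \forall r \near within A (nbhs s), A r by exact: withinT.
  by apply: filterS => r Ar; apply: L2B; exact: Lf.
split.
- by have [H _ _] := cu _ (Am _ At); exact: H1_with_shift.
- by apply: cvgn => // s /cu[].
- by apply: cvgn => // s /cu[].
Qed.

Lemma is_derive_glue (f g : R -> R) (t d : R) : f t0 = g t0 ->
  (t <= t0 -> is_derive t (1 : R) f d) -> (t0 <= t -> is_derive t (1 : R) g d) ->
  is_derive t (1 : R) (fun r => if r <= t0 then f r else g r) d.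
Proof.
move=> fg df dg; have [tt0|t0t|tE] := ltgtP t t0.
- apply: (is_derive_near _ (df (ltW tt0))).
  by apply: filterS (near_lt_cst tt0) => r /ltW ->.
- apply: (is_derive_near _ (dg (ltW t0t))).
  by apply: filterS (near_gt_cst t0t) => r; rewrite ltNge => /negbTE ->.
have tl : t <= t0 by rewrite tE.
have tr : t0 <= t by rewrite tE.
move: (df tl) (dg tr) => /is_deriveP df' /is_deriveP dg'.
apply/is_deriveP => e e0; apply: filterS2 (df' e e0) (dg' e e0) => h hf hg.
by rewrite tl; case: ifP => _ //; rewrite tE fg -tE.
Qed.

Variables (k : R) (J : set R) (u ux : R -> R -> R).
Hypotheses (oJ : open J) (cu : continuous_H1_with J u ux) (Jt0 : J t0).
Hypothesis evol : forall psi, test_function psi -> forall t, J t ->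
  is_derive t (1 : R) (fun r => lint (fun x => u r x * helmholtz psi x))
    (flux k (u t) (ux t) psi).
Hypothesis profile : forall psi, test_function psi ->
  flux k (u t0) (ux t0) psi = c * lint (fun x => u t0 x * derive1 (helmholtz psi) x).

(** The moment of a moving profile is a moment of the fixed profile against a
    moving test function, whose derivative the profile equation identifies as
    the flux. *)
Lemma traveling_evolution psi t : test_function psi ->
  is_derive t (1 : R)
    (fun r => lint (fun x => u t0 (x - c * (r - t0)) * helmholtz psi x))
    (flux k (fun x => u t0 (x - c * (t - t0))) (fun x => ux t0 (x - c * (t - t0))) psi).
Proof.
move=> tpsi; have Lt := H1_L2 cu Jt0; have Ltx := H1_L2x cu Jt0.
have tg := helmholtz_test tpsi; have p1 : (1 : R) = 1 \/ (1 : R) = -1 by left.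
have -> : (fun r => lint (fun x => u t0 (x - c * (r - t0)) * helmholtz psi x)) =
    (fun r => lint (fun x => u t0 x * helmholtz psi (c * (r - t0) + 1 * x))).
  apply/funext => r.
  exact: (lint_shift_moment _ (L2_meas Lt) (test_function_meas tg)).
rewrite (flux_shift _ _ Lt Ltx tpsi) (profile (test_function_add_mul _ p1 tpsi)).
have da : is_derive t (1 : R) (fun r => c * (r - t0)) c.
  have := is_deriveZ1 c (is_derive_affine 1 (- t0) t).
  by rewrite mulr1; under [X in is_derive _ _ X]eq_fun do rewrite mul1r.
have n0 : norm2 (fun x => u t0 x - u t0 x) @[r --> t] --> (0 : R).
  have -> : norm2 (fun x => u t0 x - u t0 x) = 0.
    rewrite /norm2; under eq_fun do rewrite subrr expr0n/=.
    by rewrite /lint Rintegral_cst//= mul0r sqrtr0.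
  exact: cvg_cst.
have nL : nbhs (t : R) (fun _ : R => L2 (u t0)) by apply: filterE => _; exact: Lt.
have o2 : (1 : R) ^+ 2 = 1 by rewrite expr1n.
have E : derive1 (helmholtz (fun x => psi (c * (t - t0) + 1 * x))) =
    (fun x => derive1 (helmholtz psi) (c * (t - t0) + 1 * x)).
  have -> : helmholtz (fun x => psi (c * (t - t0) + 1 * x)) =
      (fun x => helmholtz psi (c * (t - t0) + 1 * x)).
    by apply/funext => y; exact: (helmholtz_affine _ y o2 tpsi.1).
  have := @derive1n_affine _ 1 (helmholtz psi) 1 (c * (t - t0)) tg.1.
  move=> H; apply: etrans H _; apply/funext => x.
  by rewrite expr1n mul1r.
rewrite E -[X in is_derive _ _ _ X]add0r.
exact: (@moment_path R (fun=> u t0) (helmholtz psi) (fun r => c * (r - t0)) t 1 c 0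
  p1 tg da nL n0 (is_derive_cst1 _ t)).
Qed.

(** At t0 the derivatives from both sides agree: both are the flux of u t0. *)
Lemma stopped_evolution psi t : test_function psi -> J t ->
  is_derive t (1 : R) (fun r => lint (fun x => stopped u r x * helmholtz psi x))
    (flux k (stopped u t) (stopped ux t) psi).
Proof.
move=> tpsi Jt.
have -> : (fun r => lint (fun x => stopped u r x * helmholtz psi x)) = (fun r =>
    if r <= t0 then lint (fun x => u r x * helmholtz psi x)
    else lint (fun x => u t0 (x - c * (r - t0)) * helmholtz psi x)).
  apply/funext => r; have [rt|/ltW tr] := leP r t0; first by rewrite stopped_before.
  by rewrite stopped_after.
have agree : lint (fun x => u t0 x * helmholtz psi x) =
    lint (fun x => u t0 (x - c * (t0 - t0)) * helmholtz psi x).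
  by congr lint; apply/funext => x; rewrite subrr mulr0 subr0.
have left_ : t <= t0 -> is_derive t (1 : R)
    (fun r => lint (fun x => u r x * helmholtz psi x))
    (flux k (stopped u t) (stopped ux t) psi).
  by move=> tt0; rewrite (stopped_before u tt0) (stopped_before ux tt0);
    exact: (evol tpsi Jt).
have right_ : t0 <= t -> is_derive t (1 : R)
    (fun r => lint (fun x => u t0 (x - c * (r - t0)) * helmholtz psi x))
    (flux k (stopped u t) (stopped ux t) psi).
  by move=> t0t; rewrite (stopped_after u t0t) (stopped_after ux t0t);
    exact: (traveling_evolution t tpsi).
exact: (@is_derive_glue (fun r => lint (fun x => u r x * helmholtz psi x))
  (fun r => lint (fun x => u t0 (x - c * (r - t0)) * helmholtz psi x))
  t _ agree left_ right_).
Qed.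

End StoppedWave.

(** * Test functions of time and space *)

Section Spacetime.
Context {R : realType}.
Implicit Types (phi : R -> R -> R).

Lemma smooth2_dt phi : smooth2 phi -> smooth2 (dt phi).
Proof.
move=> sphi w; have := sphi (rcons w true).
by rewrite /iter_partial foldr_rcons.
Qed.

Lemma smooth2_dx phi : smooth2 phi -> smooth2 (dx phi).
Proof.
move=> sphi w; have := sphi (rcons w false).
by rewrite /iter_partial foldr_rcons.
Qed.

Lemma smooth2_is_derive_t phi t x : smooth2 phi ->
  is_derive t (1 : R) (phi ^~ x) (dt phi t x).
Proof. by move=> /(_ [::])[_ /(_ t x)[d _]]; exact: derivable_is_derive. Qed.

Lemma smooth2_is_derive_x phi t x : smooth2 phi ->
  is_derive x (1 : R) (phi t) (dx phi t x).
Proof. by move=> /(_ [::])[_ /(_ t x)[_ d]]; exact: derivable_is_derive. Qed.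

Lemma smooth2_continuous phi : smooth2 phi -> continuous (fun p : R * R => phi p.1 p.2).
Proof. by move=> /(_ [::])[]. Qed.

Lemma smooth2_smooth phi t : smooth2 phi -> smooth (phi t).
Proof.
move=> sphi n; have -> : derive1n n (phi t) = iter_partial (nseq n false) phi t.
  by elim: n => [//|n IH]; rewrite derive1nS IH.
by move=> x; have [_ /(_ t x)[]] := sphi (nseq n false).
Qed.

Lemma dist_halves (p q p' q' e : R) : p' = q' -> `|q - q'| <= e / 2 ->
  `|p - p'| <= e / 2 -> `|q - p| <= e.
Proof.
move=> -> qq pq; rewrite (_ : q - p = (q - q') - (p - q')); last by ring.
by rewrite (le_trans (ler_normB _ _))// [e]splitr lerD.
Qed.

(** Symmetry of mixed partial derivatives: the second difference of phi over a
    small square is h^2 times either of them at some nearby point. *)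
Lemma dt_dx_commute phi : smooth2 phi -> dt (dx phi) = dx (dt phi).
Proof.
move=> sphi; apply/funext => t; apply/funext => x; apply/eqP.
rewrite -subr_eq0 -normr_eq0 eq_le normr_ge0 andbT; apply/ler_addgt0Pr => e e0.
rewrite add0r.
have e20 : 0 < e / 2 by rewrite divr_gt0.
have near_close (psi : R -> R -> R) : smooth2 psi -> exists2 d : R, 0 < d &
    forall s y, `|s - t| < d -> `|y - x| < d -> `|psi t x - psi s y| <= e / 2.
  move=> /smooth2_continuous /(_ (t, x)) /cvgrPdist_le /(_ _ e20) /nbhs_ballP[d /= d0 dP].
  exists d => // s y st yx; apply: (dP (s, y)).
  by split; rewrite /ball/= distrC.
have stx := smooth2_dt (smooth2_dx sphi); have sxt := smooth2_dx (smooth2_dt sphi).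
have [d1 d10 H1] := near_close _ stx; have [d2 d20 H2] := near_close _ sxt.
pose h := Num.min d1 d2 / 2.
have m0 : 0 < Num.min d1 d2 by rewrite lt_min d10.
have h0 : 0 < h by rewrite divr_gt0.
have hm : h < Num.min d1 d2 by rewrite ltr_pdivrMr// mulr_natr mulr2n ltrDl.
have hd1 : h < d1 by rewrite (lt_le_trans hm)// ge_min lexx.
have hd2 : h < d2 by rewrite (lt_le_trans hm)// ge_min lexx orbT.
have th : t <= t + h by rewrite lerDl ltW.
have xh : x <= x + h by rewrite lerDl ltW.
have close (p q : R) : p <= q <= p + h -> `|q - p| <= h.
  by move=> /andP[pq qh]; rewrite ger0_norm ?subr_ge0// lerBlDl.
have [s1 s1t E1] := MVT_is_derive th (fun s => is_deriveB1
  (smooth2_is_derive_t s (x + h) sphi) (smooth2_is_derive_t s x sphi)).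
have [y1 y1x E1'] := MVT_is_derive xh (fun y => smooth2_is_derive_x s1 y (smooth2_dt sphi)).
have [y2 y2x E2] := MVT_is_derive xh (fun y => is_deriveB1
  (smooth2_is_derive_x (t + h) y sphi) (smooth2_is_derive_x t y sphi)).
have [s2 s2t E2'] := MVT_is_derive th (fun s => smooth2_is_derive_t s y2 (smooth2_dx sphi)).
rewrite E1' in E1; rewrite E2' in E2.
have alg (A B C D p q d d' : R) : d != 0 -> d' != 0 -> A - B - (C - D) = p * d * d' ->
    A - C - (B - D) = q * d' * d -> p = q.
  move=> dn0 dn0' e1 e2; apply: (mulIf dn0); apply: (mulIf dn0').
  by rewrite -e1 -(mulrAC q) -e2; ring.
have xhx : x + h - x != 0 by rewrite addrC addKr gt_eqF.
have tht : t + h - t != 0 by rewrite addrC addKr gt_eqF.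
have E : dx (dt phi) s1 y1 = dt (dx phi) s2 y2 := alg _ _ _ _ _ _ _ _ xhx tht E1 E2.
have b1 := H1 s2 y2 (le_lt_trans (close _ _ s2t) hd1) (le_lt_trans (close _ _ y2x) hd1).
have b2 := H2 s1 y1 (le_lt_trans (close _ _ s1t) hd2) (le_lt_trans (close _ _ y1x) hd2).
exact: (dist_halves E b1 b2).
Qed.

Variables (a b M : R).

Definition stsupported phi := forall t x, ~ (a <= t <= b /\ `|x| <= M) -> phi t x = 0.

Lemma stsupported_t phi t : stsupported phi -> ~ (a <= t <= b) -> phi t = fun=> 0.
Proof. by move=> sphi nt; apply/funext => x; apply: sphi => -[]. Qed.

Lemma stsupported_x phi t : stsupported phi -> supported M (phi t).
Proof. by move=> sphi x Mx; apply: sphi => -[_]; rewrite leNgt Mx. Qed.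

Lemma stsupported_dt phi : smooth2 phi -> stsupported phi -> stsupported (dt phi).
Proof.
move=> sphi supp t x ntx; apply: is_derive1E.
have [tab|/negP ntab] := boolP (a <= t <= b).
  have Mx : M < `|x| by rewrite ltNge; apply/negP => xM; exact: ntx.
  have -> : phi ^~ x = fun=> 0.
    by apply/funext => s; exact: (stsupported_x s supp Mx).
  exact: is_derive_cst1.
apply: (@is_derive_near _ (fun=> 0)).
move: ntab => /negP; rewrite negb_and -!ltNge => /orP[/near_lt_cst|/near_gt_cst];
  apply: filterS => s hs; rewrite supp// => -[/andP[s1 s2] _].
  by rewrite ltNge s1 in hs.
by rewrite ltNge s2 in hs.
Qed.

Lemma stsupported_dx phi : smooth2 phi -> stsupported phi -> stsupported (dx phi).
Proof.
move=> sphi supp t x ntx.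
have [tab|/negP ntab] := boolP (a <= t <= b).
  have Mx : M < `|x| by rewrite ltNge; apply/negP => xM; exact: ntx.
  have dphi y : derivable (phi t) y 1 by case: (smooth2_is_derive_x t y sphi).
  exact: (supported_derive dphi (@stsupported_x phi t supp) Mx).
apply: is_derive1E; rewrite (stsupported_t supp ntab); exact: is_derive_cst1.
Qed.

(** Explicit bounds on the support, inherited by all partial derivatives. *)
Definition sttest phi := smooth2 phi /\ stsupported phi.

Lemma sttest_dt phi : sttest phi -> sttest (dt phi).
Proof. by move=> [s1 s2]; split; [exact: smooth2_dt|exact: stsupported_dt]. Qed.

Lemma sttest_dx phi : sttest phi -> sttest (dx phi).
Proof. by move=> [s1 s2]; split; [exact: smooth2_dx|exact: stsupported_dx]. Qed.

Lemma sttest_bounded phi : sttest phi -> exists2 C, 0 <= C & forall t x, `|phi t x| <= C.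
Proof.
move=> [sphi supp].
have cK : compact (`[a, b] `*` `[- M, M] : set (R * R)).
  by apply: compact_setX; exact: segment_compact.
have cphi : {within `[a, b] `*` `[- M, M], continuous (fun p : R * R => phi p.1 p.2)}.
  by apply: continuous_subspaceT; exact: smooth2_continuous.
have /compact_bounded[N [_ NP]] := continuous_compact cphi cK.
exists (`|N| + 1); first by rewrite addr_ge0.
move=> t x; have [tx|ntx] := pselect (a <= t <= b /\ `|x| <= M); last first.
  by rewrite supp// normr0 addr_ge0.
apply: (NP (`|N| + 1)); first by rewrite (le_lt_trans (ler_norm N))// ltrDl.
exists (t, x) => //=; move: tx => [tab xM]; split; first by rewrite /= in_itv.
by rewrite /= in_itv/= -ler_norml.
Qed.

Lemma sttest_coefficient phi t : sttest phi -> coefficient M (phi t).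
Proof.
move=> [sphi supp]; split; last exact: stsupported_x.
by move=> x; exact: is_derive_continuous (smooth2_is_derive_x t x sphi).
Qed.

Lemma sttest_test phi t : sttest phi -> test_function (phi t).
Proof.
move=> [sphi supp]; apply/test_functionP; split; first exact: (@smooth2_smooth phi t sphi).
by exists M; exact: (@stsupported_x phi t supp).
Qed.

(** By the mean value theorem: the t-derivative is bounded. *)
Lemma sttest_uniform_cvg phi t : sttest phi -> uniform_cvg (nbhs t) phi (phi t).
Proof.
move=> tphi e e0; have [C C0 dC] := sttest_bounded (sttest_dt tphi).
have C10 : 0 < C + 1 by rewrite ltr_wpDl.
have : \forall r \near t, `|r - t| < e / (C + 1).
  by apply/nbhs_ballP; exists (e / (C + 1)); rewrite /= ?divr_gt0// => r; rewrite /ball/= distrC.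
apply: filterS => r rt x.
have := lipschitz_is_derive (fun s => smooth2_is_derive_t s x tphi.1) (fun s => dC s x) t r.
move=> /le_trans; apply; rewrite ltr_pdivlMr// in rt.
by apply: le_trans (ltW rt); rewrite mulrC ler_wpM2l// lerDl.
Qed.

(** By the first order Taylor estimate: the second t-derivative is bounded. *)
Lemma sttest_uniform_derive phi t : sttest phi -> uniform_derive phi t (dt phi t).
Proof.
move=> tphi e e0; have [C C0 dC] := sttest_bounded (sttest_dt (sttest_dt tphi)).
have C10 : 0 < C + 1 by rewrite ltr_wpDl.
have : \forall h \near (0 : R), `|h| <= e / (C + 1) by apply: near0_le; rewrite divr_gt0.
apply: filterS => h hC x.
have := taylor1_is_derive (fun s => smooth2_is_derive_t s x tphi.1)
  (fun s => smooth2_is_derive_t s x (smooth2_dt tphi.1)) (fun s => dC s x) t h.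
move=> /le_trans; apply; rewrite -real_normK ?num_real// expr2 mulrA ler_wpM2r//.
rewrite ler_pdivlMr// in hC; apply: le_trans hC.
by rewrite mulrC ler_wpM2l// lerDl.
Qed.

Lemma uniform_cvgD (F : set_system R) {FF : Filter F} (f g : R -> R -> R) c d :
  uniform_cvg F f c -> uniform_cvg F g d ->
  uniform_cvg F (fun t x => f t x + g t x) (fun x => c x + d x).
Proof.
move=> uf ug e e0; have e20 : 0 < e / 2 by rewrite divr_gt0.
apply: filterS2 (uf _ e20) (ug _ e20) => t hf hg x.
by rewrite opprD addrACA (le_trans (ler_normD _ _))// [e]splitr lerD.
Qed.

Lemma uniform_cvgZ (F : set_system R) {FF : Filter F} (k : R) (f : R -> R -> R) c :
  uniform_cvg F f c -> uniform_cvg F (fun t x => k * f t x) (fun x => k * c x).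
Proof.
move=> uf e e0; have k10 : 0 < `|k| + 1 by rewrite ltr_wpDl.
have ek : 0 < e / (`|k| + 1) by rewrite divr_gt0.
apply: filterS (uf _ ek) => t hf x; rewrite -mulrBr normrM.
rewrite (le_trans (ler_wpM2l _ (hf x)))//.
rewrite mulrA ler_pdivrMr// mulrC.
by apply: ler_wpM2l; [exact: ltW|rewrite lerDl].
Qed.

Lemma uniform_deriveB (F G : R -> R -> R) t dF dG : uniform_derive F t dF ->
  uniform_derive G t dG -> uniform_derive (fun t x => F t x - G t x) t (fun x => dF x - dG x).
Proof.
move=> uF uG e e0; have e20 : 0 < e / 2 by rewrite divr_gt0.
apply: filterS2 (uF _ e20) (uG _ e20) => h hF hG x.
have -> : F (t + h) x - G (t + h) x - (F t x - G t x) - h * (dF x - dG x) =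
  (F (t + h) x - F t x - h * dF x) - (G (t + h) x - G t x - h * dG x) by ring.
rewrite (le_trans (ler_normB _ _))//.
have -> : e * `|h| = e / 2 * `|h| + e / 2 * `|h| by field.
by rewrite lerD.
Qed.

End Spacetime.

(** * From the evolution of moments to the weak formulation *)

Section EvolutionWeak.
Context {R : realType}.
Local Notation mu := (@lebesgue_measure R).

Lemma pairing_add (M : R) (f fx g1 g1' g2 g3 : R -> R) : L2 f -> L2 fx ->
  coefficient M g1 -> coefficient M g1' -> coefficient M g2 -> coefficient M g3 ->
  pairing f fx g1 g2 g3 + lint (fun x => f x * g1' x) =
  pairing f fx (fun x => g1' x + g1 x) g2 g3.
Proof.
move=> Lf Lfx c1 c1' c2 c3; rewrite /pairing -intD; last 2 first.
- apply: summableD; first apply: summableD.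
  + exact: coefficient_summable Lf c1.
  + exact: coefficient_sqr_summable Lf c2.
  + exact: coefficient_sqr_summable Lfx c3.
- exact: coefficient_summable Lf c1'.
by congr lint; apply/funext => x; ring.
Qed.

Lemma FTC2_itv (F f : R -> R) (a b : R) : a < b ->
  (forall x, a <= x <= b -> is_derive x (1 : R) F (f x)) ->
  (forall x, a <= x <= b -> {for x, continuous f}) ->
  \int[mu]_(x in `[a, b]) f x = F b - F a.
Proof.
move=> ab dF cf; rewrite /Rintegral (@continuous_FTC2 _ f F)//.
- by apply: continuous_in_subspaceT => x; rewrite inE/= in_itv/=; exact: cf.
- have aab : a <= a <= b by rewrite lexx ltW.
  have bab : a <= b <= b by rewrite lexx ltW.
  split=> [x||].
  + by rewrite in_itv/= => /andP[/ltW ax /ltW xb]; case: (dF x); rewrite ?ax.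
  + by apply: cvg_at_right_filter; exact: is_derive_continuous (dF _ aab).
  + by apply: cvg_at_left_filter; exact: is_derive_continuous (dF _ bab).
- move=> x; rewrite in_itv/= => /andP[/ltW ax /ltW xb].
  by apply: is_derive1E; apply: dF; rewrite ax.
Qed.

Lemma continuous_right_zero (f : R -> R) (b : R) : {for b, continuous f} ->
  (forall t, b < t -> f t = 0) -> f b = 0.
Proof.
move=> cf f0; have lim1 : f r @[r --> b^'+] --> f b by exact: cvg_at_right_filter.
have lim2 : f r @[r --> b^'+] --> (0 : R).
  by apply: cvg_near_cst; near=> r; apply: f0; near: r; exact: nbhs_right_gt.
exact: (cvg_unique (@Rhausdorff R) lim1 lim2).
Unshelve. all: by end_near.
Qed.

Lemma continuous_left_zero (f : R -> R) (a : R) : {for a, continuous f} ->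
  (forall t, t < a -> f t = 0) -> f a = 0.
Proof.
move=> cf f0; have lim1 : f r @[r --> a^'-] --> f a by exact: cvg_at_left_filter.
have lim2 : f r @[r --> a^'-] --> (0 : R).
  by apply: cvg_near_cst; near=> r; apply: f0; near: r; exact: nbhs_left_lt.
exact: (cvg_unique (@Rhausdorff R) lim1 lim2).
Unshelve. all: by end_near.
Qed.

Variables (k : R) (J : set R) (u ux : R -> R -> R).
Hypotheses (oJ : open J) (cu : continuous_H1_with J u ux).
Hypothesis evol : forall psi, test_function psi -> forall t, J t ->
  is_derive t (1 : R) (fun r => lint (fun x => u r x * helmholtz psi x))
    (flux k (u t) (ux t) psi).

Section FixedTest.
Variables (a b M : R) (phi : R -> R -> R).
Hypothesis tphi : sttest a b M phi.

Let tx := sttest_dx tphi.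
Let txx := sttest_dx tx.
Let txxx := sttest_dx txx.
Let tt := sttest_dt tphi.
Let ttxx := sttest_dx (sttest_dx tt).

Definition coef1 (phi : R -> R -> R) t x :=
  dt phi t x - dx (dx (dt phi)) t x + 2 * k * dx phi t x.
Definition coef2 (phi : R -> R -> R) t x :=
  3 * dx phi t x / 2 - dx (dx (dx phi)) t x / 2.
Definition coef3 (phi : R -> R -> R) t x := dx phi t x / 2.

Let density t := pairing (u t) (ux t) (coef1 phi t) (coef2 phi t) (coef3 phi t).

Lemma coef_coefficient t : [/\ coefficient M (coef1 phi t),
  coefficient M (coef2 phi t) & coefficient M (coef3 phi t)].
Proof.
have cx := sttest_coefficient t tx; have cxxx := sttest_coefficient t txxx.
split.
- apply: coefficientD; last exact: coefficientZ cx.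
  exact: coefficientB (sttest_coefficient t tt) (sttest_coefficient t ttxx).
- have := coefficientB (@coefficientZ _ M (3 / 2) _ cx) (@coefficientZ _ M 2^-1 _ cxxx).
  congr coefficient; apply/funext => x; rewrite /coef2.
  by move: (dx phi t x) (dx (dx (dx phi)) t x) => p q; field.
- have := @coefficientZ _ M 2^-1 _ cx.
  congr coefficient; apply/funext => x; rewrite /coef3.
  by move: (dx phi t x) => p; field.
Qed.

(** The time dependence of the test function adds the moment of its t-derivative
    to the flux; exchanging partial derivatives gives the integrand of the weak
    formulation. *)
Lemma moving_moment_derive t : J t ->
  is_derive t (1 : R) (fun r => lint (fun x => u r x * helmholtz (phi r) x)) (density t).
Proof.
move=> Jt; have Lt := H1_L2 cu Jt; have Ltx := H1_L2x cu Jt.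
have tpt := sttest_test t tphi.
have cH r : coefficient M (helmholtz (phi r)).
  exact: coefficientB (sttest_coefficient r tphi) (sttest_coefficient r txx).
have cHt : coefficient M (helmholtz (dt phi t)).
  exact: coefficientB (sttest_coefficient t tt) (sttest_coefficient t ttxx).
have mixed : dt (dx (dx phi)) = dx (dx (dt phi)) :=
  etrans (dt_dx_commute tx.1) (congr1 dx (dt_dx_commute tphi.1)).
have U q : dt (dx (dx phi)) = q ->
    uniform_derive (fun r => helmholtz (phi r)) t (fun x => dt phi t x - q t x).
  move=> <-.
  exact: (uniform_deriveB (sttest_uniform_derive t tphi) (sttest_uniform_derive t txx)).
have nearC : \forall r \near t, coefficient M (helmholtz (phi r)).
  by apply: filterE => r; exact: cH.
have D := @moment_derive R u (fun r => helmholtz (phi r)) (helmholtz (dt phi t)) t M _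
  (near_L2 oJ cu Jt) (H1_cvg oJ cu Jt) nearC cHt (U _ mixed) (evol tpt Jt).
have [_ c2 c3] := coef_coefficient t.
have c1 : coefficient M (fun x => 2 * k * derive1 (phi t) x).
  exact: (@coefficientZ _ M (2 * k) _ (sttest_coefficient t tx)).
have E : flux k (u t) (ux t) (phi t) + lint (fun x => u t x * helmholtz (dt phi t) x) =
  density t := pairing_add Lt Ltx c1 cHt c2 c3.
by rewrite E in D.
Qed.

Lemma density_continuous t : J t -> {for t, continuous density}.
Proof.
move=> Jt; have ux_ := sttest_uniform_cvg t tx.
have uxxx := sttest_uniform_cvg t txxx; have ut := sttest_uniform_cvg t tt.
have uttxx := sttest_uniform_cvg t ttxx.
have ext (f g : R -> R -> R) : f = g -> uniform_cvg (nbhs t) f (f t) ->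
    uniform_cvg (nbhs t) g (g t) by move=> ->.
apply: (@pairing_time_cvg R J u ux oJ cu t M (coef1 phi) (coef2 phi) (coef3 phi) Jt).
- by move=> r; have [] := coef_coefficient r.
- by move=> r; have [] := coef_coefficient r.
- by move=> r; have [] := coef_coefficient r.
- apply: (ext (fun s x => dt phi s x + -1 * dx (dx (dt phi)) s x + 2 * k * dx phi s x)).
    by apply/funext => s; apply/funext => x; rewrite /coef1 mulN1r.
  exact: (uniform_cvgD (uniform_cvgD ut (uniform_cvgZ (-1) uttxx)) (uniform_cvgZ (2 * k) ux_)).
- apply: (ext (fun s x => 3 / 2 * dx phi s x + - 2^-1 * dx (dx (dx phi)) s x)).
    apply/funext => s; apply/funext => x; rewrite /coef2.
    by move: (dx phi s x) (dx (dx (dx phi)) s x) => p q; field.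
  exact: (uniform_cvgD (uniform_cvgZ (3 / 2) ux_) (uniform_cvgZ (- 2^-1) uxxx)).
- apply: (ext (fun s x => 2^-1 * dx phi s x)).
    by apply/funext => s; apply/funext => x; rewrite /coef3 mulrC.
  exact: (uniform_cvgZ 2^-1 ux_).
Qed.

Lemma density_out t : ~ (a <= t <= b) -> density t = 0.
Proof.
move=> nt; have z (psi : R -> R -> R) : sttest a b M psi -> psi t = fun=> 0.
  by move=> [_ s]; exact: (stsupported_t s nt).
have z1 := z _ tt; have z2 := z _ ttxx; have z3 := z _ tx; have z4 := z _ txxx.
have E1 : coef1 phi t = fun=> 0.
  by apply/funext => x; rewrite /coef1 z1 z2 z3 mulr0 addr0 subrr.
have E2 : coef2 phi t = fun=> 0.
  by apply/funext => x; rewrite /coef2 z3 z4 mulr0 mul0r subrr.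
have E3 : coef3 phi t = fun=> 0 by apply/funext => x; rewrite /coef3 z3 mul0r.
rewrite /density E1 E2 E3 /pairing.
rewrite (_ : (fun x => _) = fun=> 0); last by apply/funext => x; rewrite !mulr0 !addr0.
by rewrite /lint Rintegral_cst//= mul0r.
Qed.

Lemma density_int : `[a, b] `<=` J -> \int[mu]_(t in J) density t = 0.
Proof.
move=> abJ; have -> : \int[mu]_(t in J) density t = \int[mu]_(t in `[a, b]) density t.
  rewrite [LHS]Rintegral_mkcond [RHS]Rintegral_mkcond; congr Rintegral.
  apply/funext => t; rewrite !patchE mem_setE in_itv/=.
  have [tab|/negP ntab] := boolP (a <= t <= b); last by rewrite density_out// if_same.
  by rewrite mem_set//; apply: abJ; rewrite /= in_itv.
have [ba|ab|E] := ltgtP b a.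
- by rewrite set_itv_ge ?Rintegral_set0// bnd_simp -ltNge.
- have Jab x : a <= x <= b -> J x by move=> xab; apply: abJ; rewrite /= in_itv.
  rewrite (FTC2_itv ab (fun x xab => moving_moment_derive (Jab x xab))
    (fun x xab => density_continuous (Jab x xab))).
  have edge s : (forall x, phi s x = 0) -> lint (fun x => u s x * helmholtz (phi s) x) = 0.
    move=> p0; have -> : phi s = fun=> 0 by apply/funext.
    have -> : helmholtz (fun=> 0 : R) = fun=> 0.
      apply/funext => x; rewrite /helmholtz sub0r; apply/eqP; rewrite oppr_eq0; apply/eqP.
      have d0 : derive1 (fun=> 0 : R) = fun=> 0.
        by apply/funext => y; exact: is_derive1E (is_derive_cst1 0 y).
      by rewrite derive1nS /= d0 d0.
    rewrite (_ : (fun x => _) = fun=> 0); last by apply/funext => x; rewrite mulr0.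
    by rewrite /lint Rintegral_cst//= mul0r.
  have phia x : phi a x = 0.
    apply: (@continuous_left_zero (phi ^~ x)).
      exact: is_derive_continuous (smooth2_is_derive_t a x tphi.1).
    by move=> t ta; apply: tphi.2 => -[/andP[]]; rewrite leNgt ta.
  have phib x : phi b x = 0.
    apply: (@continuous_right_zero (phi ^~ x)).
      exact: is_derive_continuous (smooth2_is_derive_t b x tphi.1).
    by move=> t bt; apply: tphi.2 => -[/andP[_]]; rewrite leNgt bt.
  by apply/eqP; rewrite subr_eq0; apply/eqP; exact: etrans (edge b phib) (esym (edge a phia)).
- by rewrite E set_itv1 Rintegral_set1.
Qed.

End FixedTest.

(** The inner integral of the weak formulation is the derivative of the moment
    against phi t, which vanishes at both ends of the support. *)
Lemma evolution_weak phi : spacetime_test_function J phi ->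
  \int[mu]_(t in J) \int[mu]_x
    (u t x * (dt phi t x - dx (dx (dt phi)) t x + 2 * k * dx phi t x)
     + u t x ^+ 2 * (3 * dx phi t x / 2 - dx (dx (dx phi)) t x / 2)
     + ux t x ^+ 2 * (dx phi t x / 2)) = 0.
Proof.
move=> [sphi [a [b [M [abJ supp]]]]].
exact: (@density_int a b M phi (conj sphi supp) abJ).
Qed.

End EvolutionWeak.

(** * Transforms of test functions *)

Section Fourier.
Context {R : realType}.
Local Notation mu := (@lebesgue_measure R).
Implicit Types (f g phi psi eta : R -> R).

Definition cauchy_kernel (x : R) : R := (1 + x ^+ 2)^-1.

Lemma cauchy_kernel_gt0 x : 0 < cauchy_kernel x.
Proof. by rewrite invr_gt0 ltr_pwDl// sqr_ge0. Qed.

Lemma cauchy_kernel_le1 x : cauchy_kernel x <= 1.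
Proof. by rewrite invf_le1 ?lerDl ?sqr_ge0// ltr_pwDl// sqr_ge0. Qed.

Lemma cauchy_kernel_continuous : continuous cauchy_kernel.
Proof. exact: continuous_oneDsqrV. Qed.

Lemma cauchy_kernel_summable : summable cauchy_kernel.
Proof.
have mc : measurable_fun setT cauchy_kernel.
  by apply: continuous_measurable_fun; exact: cauchy_kernel_continuous.
apply/integrableP; split; first exact/measurable_EFinP.
under eq_integral => x _.
  rewrite gee0_abs; last by rewrite lee_fin ltW// cauchy_kernel_gt0.
  over.
rewrite (@ge0_symfun_integralT _ cauchy_kernel)//.
- rewrite -set_itvcy (_ : (\int[mu]_(x in `[0%R, +oo[) (cauchy_kernel x)%:E = (pi / 2)%:E)%E).
    by rewrite -EFinM ltry.
  rewrite -integral0y_oneDsqr; apply: eq_integral => x _.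
  by [].
- by move=> x; rewrite ltW// cauchy_kernel_gt0.
- exact: cauchy_kernel_continuous.
- by move=> x; rewrite /= /cauchy_kernel sqrrN.
Qed.

Lemma lint_derive_test phi : test_function phi -> lint (derive1 phi) = 0.
Proof.
move=> tphi; have [sphi [M sM]] := tphi.
pose N := `|M| + 1.
have N0 : 0 < N by rewrite /N ltr_wpDl.
have MN : M < N by rewrite /N (le_lt_trans (ler_norm M))// ltrDl.
have dphi x : derivable phi x 1 by exact: (sphi 0%N).
have sdM : supported M (derive1 phi) by exact: supported_derive.
have -> : lint (derive1 phi) = \int[mu]_(x in `[- N, N]) derive1 phi x.
  rewrite [RHS]Rintegral_mkcond /lint; congr Rintegral; apply/funext => x.
  rewrite patchE mem_setE in_itv/= -ler_norml; case: ifPn => //.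
  by rewrite -ltNge => Nx; rewrite sdM// (lt_trans MN).
have NN : - N <= N by lra.
rewrite (FTC2_is_derive NN (fun x => smooth_is_derive x sphi)).
  rewrite !sM ?subrr// ?normrN gtr0_norm//.
apply: continuous_subspaceT; exact: (smooth_continuous (smooth_derive sphi)).
Qed.

(** These are cos_transform and sin_transform up to conversion, headed by the
    integral for which the algebraic rules are stated. *)
Definition lcos phi (x : R) := lint (fun xi => phi xi * cos (xi * x)).
Definition lsin phi (x : R) := lint (fun xi => phi xi * sin (xi * x)).

Lemma cos_meas (x : R) : measurable_fun setT (fun xi : R => cos (xi * x)).
Proof. exact: (continuous_measurable_fun (smooth_continuous (@smooth_cosM _ x))). Qed.

Lemma sin_meas (x : R) : measurable_fun setT (fun xi : R => sin (xi * x)).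
Proof. exact: (continuous_measurable_fun (smooth_continuous (@smooth_sinM _ x))). Qed.

Lemma summable_mul_bounded f g C : summable f -> measurable_fun setT g ->
  (forall x, `|g x| <= C) -> summable (fun x => f x * g x).
Proof.
move=> sf mg gC; apply: (le_summable _ (@summableZ _ C _ (summable_norm sf))).
  by apply: measurable_funM => //; exact: summable_meas.
by move=> x; rewrite normrM mulrC ler_wpM2r.
Qed.

Lemma lcos_summable f x : summable f -> summable (fun xi => f xi * cos (xi * x)).
Proof. by move=> sf; apply: (summable_mul_bounded sf (cos_meas x)) => xi; exact: cos_max. Qed.

Lemma lsin_summable f x : summable f -> summable (fun xi => f xi * sin (xi * x)).
Proof. by move=> sf; apply: (summable_mul_bounded sf (sin_meas x)) => xi; exact: sin_max. Qed.

Lemma lcos_continuous f : summable f -> continuous (lcos f).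
Proof.
move=> sf; apply: (lint_continuous (g := fun xi => `|f xi|)).
- by move=> x; exact: (summable_meas (lcos_summable x sf)).
- move=> xi x; apply: cvgMr.
  apply: (@continuous_comp _ _ _ (fun y => xi * y) cos); last exact: continuous_cos.
  by apply: cvgMr; exact: cvg_id.
- exact: summable_norm.
- by move=> x xi; rewrite normrM ler_piMr// cos_max.
Qed.

Lemma lsin_continuous f : summable f -> continuous (lsin f).
Proof.
move=> sf; apply: (lint_continuous (g := fun xi => `|f xi|)).
- by move=> x; exact: (summable_meas (lsin_summable x sf)).
- move=> xi x; apply: cvgMr.
  apply: (@continuous_comp _ _ _ (fun y => xi * y) sin); last exact: continuous_sin.
  by apply: cvgMr; exact: cvg_id.
- exact: summable_norm.
- by move=> x xi; rewrite normrM ler_piMr// sin_max.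
Qed.

Lemma lcos_bounded f x : summable f -> `|lcos f x| <= lint (fun xi => `|f xi|).
Proof.
move=> sf; apply: int_norm_le; [exact: lcos_summable|exact: summable_norm|].
by move=> xi; rewrite normrM ler_piMr// cos_max.
Qed.

Lemma lsin_bounded f x : summable f -> `|lsin f x| <= lint (fun xi => `|f xi|).
Proof.
move=> sf; apply: int_norm_le; [exact: lsin_summable|exact: summable_norm|].
by move=> xi; rewrite normrM ler_piMr// sin_max.
Qed.

Lemma derive_cosM (x xi : R) :
  is_derive xi (1 : R) (fun xi => cos (xi * x)) (- x * sin (xi * x)).
Proof.
have := @is_derive_comp1 _ cos (fun y => x * y + 0) xi _ _ (is_derive_cos _)
  (is_derive_affine x 0 xi).
rewrite addr0 mulNr -mulNr mulrC (mulrC x xi) mulrN -mulNr.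
by under [X in is_derive _ _ X]eq_fun do rewrite addr0 mulrC.
Qed.

Lemma derive_sinM (x xi : R) :
  is_derive xi (1 : R) (fun xi => sin (xi * x)) (x * cos (xi * x)).
Proof.
have := @is_derive_comp1 _ sin (fun y => x * y + 0) xi _ _ (is_derive_sin _)
  (is_derive_affine x 0 xi).
rewrite addr0 mulrC (mulrC x xi).
by under [X in is_derive _ _ X]eq_fun do rewrite addr0 mulrC.
Qed.

(** Two integrations by parts at once: the integral of the derivative of
    phi' cos (x .) + x phi sin (x .) vanishes. *)
Lemma lcos_derive2 phi x : test_function phi ->
  x ^+ 2 * lcos phi x = - lcos (derive1n 2 phi) x.
Proof.
move=> tphi; have tphi1 := test_function_derive tphi.
have tphi2 := test_function_derive tphi1.
pose F xi := derive1 phi xi * cos (xi * x) + phi xi * (x * sin (xi * x)).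
have tF : test_function F.
  apply: (test_functionD (test_functionM tphi1 (@smooth_cosM _ x))).
  exact: (test_functionM tphi (@smoothZ _ x _ (@smooth_sinM _ x))).
have dF xi : is_derive xi (1 : R) F
    (derive1n 2 phi xi * cos (xi * x) + x ^+ 2 * (phi xi * cos (xi * x))).
  have := is_deriveD1 (is_deriveM1 (smooth_is_derive xi tphi1.1) (derive_cosM x xi))
    (is_deriveM1 (smooth_is_derive xi tphi.1) (is_deriveZ1 x (derive_sinM x xi))).
  congr is_derive; rewrite -[derive1n 2 phi]/(derive1 (derive1 phi)).
  by move: (derive1 (derive1 phi) xi) (derive1 phi xi) => p q; ring.
have := lint_derive_test tF.
have -> : derive1 F = (fun xi => derive1n 2 phi xi * cos (xi * x) +
    x ^+ 2 * (phi xi * cos (xi * x))) by apply/funext => xi; exact: is_derive1E (dF xi).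
have s2 : summable (fun xi => derive1n 2 phi xi * cos (xi * x)).
  exact: (lcos_summable x (test_function_summable tphi2)).
have s0 := lcos_summable x (test_function_summable tphi).
rewrite (intD s2 (summableZ _ s0)) (intZ _ s0) addrC => /eqP.
by rewrite addr_eq0 => /eqP.
Qed.

Lemma lsin_derive2 phi x : test_function phi ->
  x ^+ 2 * lsin phi x = - lsin (derive1n 2 phi) x.
Proof.
move=> tphi; have tphi1 := test_function_derive tphi.
have tphi2 := test_function_derive tphi1.
pose F xi := derive1 phi xi * sin (xi * x) + phi xi * (- x * cos (xi * x)).
have tF : test_function F.
  apply: (test_functionD (test_functionM tphi1 (@smooth_sinM _ x))).
  exact: (test_functionM tphi (@smoothZ _ (- x) _ (@smooth_cosM _ x))).
have dF xi : is_derive xi (1 : R) F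
    (derive1n 2 phi xi * sin (xi * x) + x ^+ 2 * (phi xi * sin (xi * x))).
  have := is_deriveD1 (is_deriveM1 (smooth_is_derive xi tphi1.1) (derive_sinM x xi))
    (is_deriveM1 (smooth_is_derive xi tphi.1) (is_deriveZ1 (- x) (derive_cosM x xi))).
  congr is_derive; rewrite -[derive1n 2 phi]/(derive1 (derive1 phi)).
  by move: (derive1 (derive1 phi) xi) (derive1 phi xi) => p q; ring.
have := lint_derive_test tF.
have -> : derive1 F = (fun xi => derive1n 2 phi xi * sin (xi * x) +
    x ^+ 2 * (phi xi * sin (xi * x))) by apply/funext => xi; exact: is_derive1E (dF xi).
have s2 : summable (fun xi => derive1n 2 phi xi * sin (xi * x)).
  exact: (lsin_summable x (test_function_summable tphi2)).
have s0 := lsin_summable x (test_function_summable tphi).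
rewrite (intD s2 (summableZ _ s0)) (intZ _ s0) addrC => /eqP.
by rewrite addr_eq0 => /eqP.
Qed.

Lemma transform_decay (T : R -> R) C C' : (forall x, `|T x| <= C) ->
  (forall x, `|x ^+ 2 * T x| <= C') ->
  forall x, `|T x| <= (C + C') * cauchy_kernel x.
Proof.
move=> TC TC' x; have x0 : 0 < 1 + x ^+ 2 by rewrite ltr_pwDl// sqr_ge0.
rewrite ler_pdivlMr// mulrDr mulr1 lerD//.
by move: (TC' x); rewrite normrM ger0_norm ?sqr_ge0// mulrC.
Qed.

Lemma lcos_decay phi : test_function phi ->
  exists C, forall x, `|lcos phi x| <= C * cauchy_kernel x.
Proof.
move=> tphi; have s0 := test_function_summable tphi.
have s2 := test_function_summable (@test_function_derive1n _ 2 _ tphi).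
eexists; apply: transform_decay => x; first exact: lcos_bounded s0.
by rewrite lcos_derive2// normrN; exact: lcos_bounded.
Qed.

Lemma lsin_decay phi : test_function phi ->
  exists C, forall x, `|lsin phi x| <= C * cauchy_kernel x.
Proof.
move=> tphi; have s0 := test_function_summable tphi.
have s2 := test_function_summable (@test_function_derive1n _ 2 _ tphi).
eexists; apply: transform_decay => x; first exact: lsin_bounded s0.
by rewrite lsin_derive2// normrN; exact: lsin_bounded.
Qed.

Lemma decay_summable (T : R -> R) C : continuous T ->
  (forall x, `|T x| <= C * cauchy_kernel x) -> summable T.
Proof.
move=> cT TC; apply: le_summable TC; first exact: continuous_measurable_fun.
by apply: summableZ; exact: cauchy_kernel_summable.
Qed.

(** A bounded integrable function is square integrable. *)
Lemma decay_L2 (T : R -> R) C : continuous T ->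
  (forall x, `|T x| <= C * cauchy_kernel x) -> L2 T.
Proof.
move=> cT TC; have mT : measurable_fun setT T by exact: continuous_measurable_fun.
have C0 : 0 <= C.
  by have := le_trans (normr_ge0 _) (TC 0); rewrite pmulr_lge0// cauchy_kernel_gt0.
apply/L2P; split=> //; apply: (le_summable _ (@summableZ _ (C ^+ 2) _ cauchy_kernel_summable)).
  exact: measurable_funX.
move=> x; rewrite normrX; apply: (@le_trans _ _ ((C * cauchy_kernel x) ^+ 2)).
  by rewrite lerXn2r// nnegrE ?normr_ge0// mulr_ge0// ltW// cauchy_kernel_gt0.
rewrite exprMn ler_wpM2l ?sqr_ge0// expr2 ler_piMr// ?cauchy_kernel_le1//.
by rewrite ltW// cauchy_kernel_gt0.
Qed.

Lemma lcos_L2 phi : test_function phi -> L2 (lcos phi).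
Proof.
move=> tphi; have [C HC] := lcos_decay tphi.
exact: decay_L2 (lcos_continuous (test_function_summable tphi)) HC.
Qed.

Lemma lsin_L2 phi : test_function phi -> L2 (lsin phi).
Proof.
move=> tphi; have [C HC] := lsin_decay tphi.
exact: decay_L2 (lsin_continuous (test_function_summable tphi)) HC.
Qed.

Lemma lint_fubini (F : R -> R -> R) :
  measurable_fun setT (fun p : R * R => F p.1 p.2) ->
  (forall y, summable (F y)) -> (forall z, summable (F ^~ z)) ->
  summable (fun z => lint (fun y => `|F y z|)) ->
  lint (fun y => lint (F y)) = lint (fun z => lint (F ^~ z)).
Proof.
move=> mF sF1 sF2 sabs.
pose f (p : R * R) := (F p.1 p.2)%:E.
have mf : measurable_fun setT f by exact/measurable_EFinP.
have fin h : summable h -> (lint h)%:E = (\int[mu]_x (h x)%:E)%E.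
  by move=> sh; rewrite /lint /Rintegral fineK//; exact: integrable_fin_num.
have intf : (mu \x mu)%E.-integrable setT f.
  apply/integrable21ltyP => //.
  move/integrableP : sabs => [_].
  congr (_ < _)%E; apply: eq_integral => z _ /=.
  rewrite ger0_norm; last by apply: Rintegral_ge0.
  by rewrite fin//; exact: summable_norm.
have := Fubini intf.
rewrite /lint /Rintegral => E; congr fine.
rewrite (_ : (\int[mu]_x _)%E = (\int[mu]_x \int[mu]_y f (x, y))%E); last first.
  by apply: eq_integral => y _; exact: fin.
rewrite E; apply: eq_integral => z _.
exact/esym/(fin _ (sF2 z)).
Qed.

End Fourier.

(** * Injectivity of the L^2 Fourier transform *)

Section Autocorrelation.
Context {R : realType}.
Implicit Types f : R -> R.

Lemma near_unshift0 (t : R) (P : R -> Prop) : (\forall h \near (0 : R), P h) ->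
  \forall r \near t, P (r - t).
Proof.
move=> /nbhs_ballP[e /= e0 eP]; apply/nbhs_ballP; exists e => // r; rewrite /ball/= => rt.
by apply: eP; rewrite /ball/= sub0r normrN distrC.
Qed.

Definition autocorrelation f (z : R) := lint (fun y => f y * f (y + z)).

Lemma autocorrelation_summable f z : L2 f -> summable (fun y => f y * f (y + z)).
Proof. by move=> Lf; apply: L2_mul => //; exact: L2_preserving (preserving_shift z) Lf. Qed.

Lemma autocorrelation_bounded f z : L2 f -> `|autocorrelation f z| <= norm2 f ^+ 2.
Proof.
move=> Lf; have ph := preserving_shift z.
have := cauchy_schwarz Lf (L2_preserving ph Lf).
by rewrite (norm2_preserving ph (L2_meas Lf)) -expr2.
Qed.

Lemma autocorrelation0 f : autocorrelation f 0 = norm2 f ^+ 2.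
Proof.
rewrite norm2_sqr /autocorrelation; congr lint; apply/funext => y.
by rewrite addr0 expr2.
Qed.

Lemma autocorrelation_continuous f : L2 f -> continuous (autocorrelation f).
Proof.
move=> Lf z; apply/cvgrPdist_le => e e0.
have nf := norm2_ge0 f; have n1 : 0 < norm2 f + 1 by rewrite ltr_wpDl.
have e10 : 0 < e / (norm2 f + 1) by rewrite divr_gt0.
have := L2_translation Lf; move/cvgrPdist_le => /(_ _ e10).
move=> /(near_unshift0 z); apply: filterS => w /=.
rewrite sub0r normrN ger0_norm ?norm2_ge0// => H.
have pw := preserving_shift w; have pz := preserving_shift z.
have Lw := L2_preserving pw Lf; have Lz := L2_preserving pz Lf.
rewrite /autocorrelation -intB; [|exact: autocorrelation_summable|exact: autocorrelation_summable].
have -> : (fun x => f x * f (x + z) - f x * f (x + w)) =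
    (fun x => f x * (f (x + z) - f (x + w))) by apply/funext => x; rewrite mulrBr.
apply: le_trans (cauchy_schwarz Lf (L2B Lz Lw)) _.
rewrite norm2_distC.
have -> : norm2 (fun x => f (x + w) - f (x + z)) =
    norm2 (fun x => f (x + (w - z)) - f x).
  rewrite -(norm2_preserving (f := fun x => f (x + (w - z)) - f x) pz).
    by congr norm2; apply/funext => x; rewrite -addrA (addrC z) subrK.
  apply: measurable_funB; last exact: L2_meas.
  exact: (L2_meas (L2_preserving (preserving_shift (w - z)) Lf)).
rewrite ler_pdivlMr// in H; apply: le_trans H; rewrite mulrC.
by rewrite ler_wpM2l ?norm2_ge0// lerDl.
Qed.

End Autocorrelation.

Section Injectivity.
Context {R : realType}.
Local Notation mu := (@lebesgue_measure R).
Implicit Types (f phi : R -> R).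

Lemma lcos_shift f N x : summable f ->
  lcos (fun xi => f (xi + N)) x = cos (N * x) * lcos f x + sin (N * x) * lsin f x.
Proof.
move=> sf; have mf := summable_meas sf.
have sc := lcos_summable x sf; have ss := lsin_summable x sf.
have pN := preserving_shift (- N).
have m : measurable_fun setT (fun xi : R => f (xi + N) * cos (xi * x)).
  apply: measurable_funM; last exact: cos_meas.
  exact: (meas_preserving (preserving_shift N) mf).
rewrite /lcos /lsin -(lint_preserving pN m) -(intZ _ sc) -(intZ _ ss).
rewrite -intD; [|exact: summableZ|exact: summableZ].
congr lint; apply/funext => xi; rewrite subrK mulrBl cosB.
by move: (cos _) (sin _) (cos _) (sin _) => p q p' q'; ring.
Qed.

Lemma test_cosM (phi : R -> R) y : test_function phi ->
  test_function (fun xi => phi xi * cos (xi * y)).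
Proof. by move=> tphi; exact: test_functionM tphi (@smooth_cosM _ y). Qed.

Lemma test_sinM (phi : R -> R) y : test_function phi ->
  test_function (fun xi => phi xi * sin (xi * y)).
Proof. by move=> tphi; exact: test_functionM tphi (@smooth_sinM _ y). Qed.

(** Modulating a function translates its transform. *)
Lemma lcos_modulate phi y x : test_function phi ->
  lcos (fun xi => phi xi * cos (xi * y)) x + lsin (fun xi => phi xi * sin (xi * y)) x =
  lcos phi (x - y).
Proof.
move=> tphi.
have tc := test_cosM y tphi; have ts := test_sinM y tphi.
have sc := lcos_summable x (test_function_summable tc).
have ss := lsin_summable x (test_function_summable ts).
rewrite /lcos /lsin -(intD sc ss).
congr lint; apply/funext => xi; rewrite mulrBr cosB.
by move: (cos _) (sin _) (cos _) (sin _) => p q p' q'; ring.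
Qed.

Lemma lsin_modulate phi y x : test_function phi ->
  lsin (fun xi => phi xi * cos (xi * y)) x - lcos (fun xi => phi xi * sin (xi * y)) x =
  lsin phi (x - y).
Proof.
move=> tphi.
have tc := test_cosM y tphi; have ts := test_sinM y tphi.
have sc := lsin_summable x (test_function_summable tc).
have ss := lcos_summable x (test_function_summable ts).
rewrite /lcos /lsin -(intB sc ss).
congr lint; apply/funext => xi; rewrite mulrBr sinB.
by move: (cos _) (sin _) (cos _) (sin _) => p q p' q'; ring.
Qed.

Section Orthogonal.
Variable f : R -> R.
Hypotheses (Lf : L2 f) (forth : forall phi, test_function phi ->
  lint (fun x => f x * lcos phi x) = 0 /\ lint (fun x => f x * lsin phi x) = 0).

(** Modulated test functions are test functions, so orthogonality to all
    transforms is inherited by the translates of f. *)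
Lemma orthogonal_translates phi y : test_function phi ->
  lint (fun z => f (z + y) * lcos phi z) = 0.
Proof.
move=> tphi; have tc := test_cosM y tphi; have ts := test_sinM y tphi.
have py := preserving_shift (- y).
have m : measurable_fun setT (fun z : R => f (z + y) * lcos phi z).
  apply: measurable_funM; last exact: (L2_meas (lcos_L2 tphi)).
  exact: (meas_preserving (preserving_shift y) (L2_meas Lf)).
rewrite -(lint_preserving py m).
have [E1 _] := forth tc; have [_ E2] := forth ts.
have sum0 := intD (L2_mul Lf (lcos_L2 tc)) (L2_mul Lf (lsin_L2 ts)).
rewrite E1 E2 addr0 in sum0; rewrite -[RHS]sum0.
by congr lint; apply/funext => x; rewrite subrK -mulrDr lcos_modulate.
Qed.

(** The preceding identity, multiplied by f y and integrated in y. *)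
Lemma orthogonal_autocorrelation phi : test_function phi ->
  lint (fun z => lcos phi z * autocorrelation f z) = 0.
Proof.
move=> tphi; pose F y z := f y * (f (y + z) * lcos phi z).
have Lc := lcos_L2 tphi; have mf := L2_meas Lf.
pose g y := `|f y|.
have Lg : L2 g.
  apply/L2P; split; first exact: measurableT_comp.
  have := L2_summable_sqr Lf; rewrite /g.
  by under [X in _ -> summable X]eq_fun do rewrite real_normK ?num_real//.
have mF : measurable_fun setT (fun p : R * R => F p.1 p.2).
  apply: measurable_funM; first exact: (measurableT_comp mf measurable_fst).
  apply: measurable_funM; last exact: (measurableT_comp (L2_meas Lc) measurable_snd).
  exact: (measurableT_comp mf (measurable_funD measurable_fst measurable_snd)).
have swap (y z : R) : f (y + z) = f (z + y) by rewrite addrC.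
have sF1 y : summable (F y).
  apply: summableZ; under [X in summable X]eq_fun do rewrite swap.
  exact: (L2_mul (L2_preserving (preserving_shift y) Lf) Lc).
have sF2 z : summable (F ^~ z).
  have := @summableZ _ (lcos phi z) _ (autocorrelation_summable z Lf).
  by congr summable; apply/funext => y; rewrite /F; ring.
have absF z : lint (fun y => `|F y z|) = `|lcos phi z| * autocorrelation g z.
  rewrite -intZ; last exact: autocorrelation_summable.
  by congr lint; apply/funext => y; rewrite /F /g !normrM; ring.
have [C HC] := lcos_decay tphi.
have sabs : summable (fun z => lint (fun y => `|F y z|)).
  under [X in summable X]eq_fun do rewrite absF.
  have slc : summable (lcos phi).
    exact: (decay_summable (lcos_continuous (test_function_summable tphi)) HC).
  apply: (summable_mul_bounded (C := norm2 g ^+ 2) (summable_norm slc)).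
    exact: (continuous_measurable_fun (autocorrelation_continuous Lg)).
  by move=> z; exact: autocorrelation_bounded.
have := lint_fubini mF sF1 sF2 sabs.
have -> : (fun y => lint (F y)) = fun=> 0.
  apply/funext => y; rewrite intZ; last first.
    under [X in summable X]eq_fun do rewrite swap.
    exact: (L2_mul (L2_preserving (preserving_shift y) Lf) Lc).
  under [X in lint X]eq_fun do rewrite swap.
  by rewrite orthogonal_translates// mulr0.
rewrite {1}/lint Rintegral_cst//= mul0r => E; rewrite [RHS]E.
congr lint; apply/funext => z; rewrite -intZ; last exact: autocorrelation_summable.
by congr lint; apply/funext => y; rewrite /F; ring.
Qed.

End Orthogonal.

(** The test functions are second differences, with step N, of a second primitive
    of a bump eta: their cosine transforms are Fejer kernels of width 1/N, damped
    by the transform of eta. *)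
Lemma fejer_kernels : exists eta : R -> R, [/\ summable eta, lcos eta 0 = 1 &
  forall N, 0 < N -> exists2 phi, test_function phi &
    forall x, x ^+ 2 * lcos phi x = (2 - 2 * cos (N * x)) * lcos eta x].
Proof.
have [H [sH H0 H1 dH]] := @smooth_step_exists R.
pose eta := derive1 H.
have seta : smooth eta by exact: smooth_derive.
have eta_supp x : ~ (0 < x < 1) -> eta x = 0.
  move=> /negP; rewrite negb_and -!leNgt => /orP nx.
  exact: derive_step_supp.
have supp1 : supported 1 eta.
  move=> x x1; apply: eta_supp => /andP[x0 x1'].
  by move: x1; rewrite gtr0_norm// ltNge ltW.
have teta : test_function eta by apply/test_functionP; split=> //; exists 1.
have sume := test_function_summable teta.
exists eta; split=> //.
  rewrite /lcos; under [X in lint X]eq_fun do rewrite mulr0 cos0 mulr1.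
  rewrite (_ : lint eta = \int[mu]_(x in `[0, 1]) eta x); last first.
    rewrite [RHS]Rintegral_mkcond /lint; congr Rintegral; apply/funext => x.
    rewrite patchE mem_setE in_itv/=; case: ifPn => // /negP nx.
    by apply: eta_supp => /andP[x0 x1]; apply: nx; rewrite !ltW.
  rewrite (FTC2_is_derive ler01 (fun x => smooth_is_derive x sH)).
    by rewrite (H1 1 (lexx _)) (H0 0 (lexx _)) subr0.
  by apply: continuous_subspaceT; exact: smooth_continuous seta.
move=> N N0.
have [G dG G0] := primitive_exists (smooth_continuous sH) H0.
have sG : smooth G by exact: smooth_primitive dG sH.
have G1 x : 1 <= x -> G x = x + (G 1 - 1).
  move=> x1; have [c /andP[c1 _]] := MVT_is_derive x1 dG.
  by rewrite H1// mul1r => E; rewrite addrCA -E; ring.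
pose phi xi := G (xi + N) - 2 * G xi + G (xi - N).
have shift (g : R -> R) h : smooth g -> smooth (fun x => g (x + h)).
  by move=> sg; have := @smooth_affine _ g 1 h sg; under eq_fun do rewrite mul1r.
have sphi : smooth phi.
  exact: (smoothD (smoothB (shift _ N sG) (@smoothZ _ 2 _ sG)) (shift _ (- N) sG)).
have tphi : test_function phi.
  apply/test_functionP; split=> //; exists (N + 1) => x; rewrite /phi.
  have [x0|x0] := leP 0 x => xN.
    rewrite ger0_norm// in xN.
    have h1 : 1 <= x + N by lra.
    have h2 : 1 <= x by lra.
    have h3 : 1 <= x - N by lra.
    by rewrite (G1 _ h1) (G1 _ h2) (G1 _ h3); ring.
  rewrite ltr0_norm// in xN.
  have h1 : x + N <= 0 by lra.
  have h3 : x - N <= 0 by lra.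
  by rewrite (G0 _ h1) (G0 _ (ltW x0)) (G0 _ h3) mulr0 subr0 addr0.
exists phi => // x.
have ds (g : R -> R) h y : smooth g -> is_derive y (1 : R) (fun x => g (x + h)) (derive1 g (y + h)).
  move=> sg; have := smooth_is_derive y (shift _ h sg).
  by rewrite derive1_shift// => z; exact: (sg 0%N).
have d1 : derive1 phi = fun xi => H (xi + N) - 2 * H xi + H (xi - N).
  have HG : derive1 G = H by apply/funext => z; exact: is_derive1E (dG z).
  apply/funext => y; rewrite -HG; apply: is_derive1E.
  exact: (is_deriveD1 (is_deriveB1 (ds _ N y sG) (is_deriveZ1 2 (smooth_is_derive y sG)))
    (ds _ (- N) y sG)).
have d2 : derive1n 2 phi = fun xi => eta (xi + N) - 2 * eta xi + eta (xi - N).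
  rewrite -[derive1n 2 phi]/(derive1 (derive1 phi)) d1.
  apply/funext => y; apply: is_derive1E.
  exact: (is_deriveD1 (is_deriveB1 (ds _ N y sH) (is_deriveZ1 2 (smooth_is_derive y sH)))
    (ds _ (- N) y sH)).
rewrite lcos_derive2// d2.
have sN := summable_preserving (preserving_shift N) sume.
have sN' := summable_preserving (preserving_shift (- N)) sume.
have -> : lcos (fun xi => eta (xi + N) - 2 * eta xi + eta (xi - N)) x =
    lcos (fun xi => eta (xi + N)) x - 2 * lcos eta x + lcos (fun xi => eta (xi - N)) x.
  have s1 := lcos_summable x sN; have s2 := lcos_summable x sN'.
  have s3 := lcos_summable x sume.
  rewrite /lcos -(intZ _ s3) -(intB s1 (summableZ _ s3)) -intD//.
    by congr lint; apply/funext => xi; ring.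
  by apply: summableB => //; exact: summableZ.
rewrite !lcos_shift// mulNr cosN sinN.
by move: (cos _) (sin _) (lcos _ _) (lsin _ _) => p q p' q'; ring.
Qed.

(** The autocorrelation A of f is continuous and A 0 is the squared norm R0 of f.
    Near 0, where A is at least R0 / 2, the product of A with the Fejer kernel of
    width 1/N is nonnegative; on [pi / (2 N), pi / N] it is at least of order
    R0 N^2, so that its integral there grows like N.  Away from 0 the product is
    bounded by an integrable function independent of N.  As the total integral
    vanishes for all N, R0 = 0. *)
Lemma fourier_injective f : L2 f -> (forall phi, test_function phi ->
    lint (fun x => f x * lcos phi x) = 0 /\ lint (fun x => f x * lsin phi x) = 0) ->
  ae_equal f (fun=> 0).
Proof.
move=> Lf forth; apply: norm2_eq0 => //; apply/eqP; rewrite -sqrf_eq0; apply/eqP.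
apply: contrapT => /eqP R0n; set R0 := norm2 f ^+ 2 in R0n.
have R0_gt0 : 0 < R0 by rewrite lt_neqAle eq_sym R0n sqr_ge0.
have [eta [se eta0 kernels]] := fejer_kernels.
pose A := autocorrelation f.
have A0 : A 0 = R0 by exact: autocorrelation0.
have [r /= r0 rP] : exists2 r : R, 0 < r &
    forall z, `|z| <= r -> R0 / 2 <= A z /\ 2^-1 <= lcos eta z.
  have cA : {for 0, continuous A} by exact: autocorrelation_continuous.
  have ce : {for 0, continuous (lcos eta)} by exact: lcos_continuous.
  have R02 : R0 / 2 < A 0 by rewrite A0 ltr_pdivrMr// mulr_natr mulr2n ltrDl.
  have h2 : 2^-1 < lcos eta 0 by rewrite eta0 invf_lt1// ltr1n.
  have : \forall z \near (0 : R), R0 / 2 < A z /\ 2^-1 < lcos eta z.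
    near=> z; split; near: z; [exact: (cvgr_gt _ cA)|exact: (cvgr_gt _ ce)].
  move=> /nbhs_ballP[d /= d0 dP]; exists (d / 2); first by rewrite divr_gt0.
  move=> z zd; have [|h3 h4] := dP z; last by split; exact: ltW.
  by rewrite /ball/= sub0r normrN (le_lt_trans zd)// ltr_pdivrMr// mulr_natr mulr2n ltrDl.
pose B := lint (fun xi => `|eta xi|).
have B0 : 0 <= B by apply: Rintegral_ge0.
(* the product is at most 4 B R0 / z^2 where |z| > r *)
pose C1 := 4 * B * R0 * (1 + r ^- 2).
have r20 : 0 < r ^+ 2 by rewrite exprn_gt0.
have C10 : 0 <= C1.
  have rr : 0 <= 1 + r ^- 2 by rewrite addr_ge0// invr_ge0 ltW.
  apply: mulr_ge0 rr; apply: mulr_ge0 (ltW R0_gt0); exact: mulr_ge0.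
pose S := lint (@cauchy_kernel R).
have pi0 : 0 < pi :> R := pi_gt0 R.
(* the first bound puts pi / N below r, the second lets the mass near 0 win *)
pose N := Num.max (pi / r) (4 * pi * C1 * S / R0 + 1).
have N0 : 0 < N by rewrite lt_max divr_gt0.
have Nr : pi / N <= r.
  by rewrite ler_pdivrMr// mulrC -ler_pdivrMr// le_max lexx.
have [phi tphi K] := kernels N N0.
have int0 := orthogonal_autocorrelation Lf forth tphi.
pose I : R -> R := \1_(`[pi / (2 * N), pi / N]).
have IE z : I z = ((pi / (2 * N) <= z <= pi / N)%R)%:R.
  by rewrite /I indicE mem_setE in_itv.
have inner z : 0 < `|z| <= r -> 0 <= lcos phi z * A z.
  move=> /andP[z0 zr]; have [a1 a2] := rP z zr.
  have z20 : 0 < z ^+ 2 by rewrite exprn_even_gt0//= -normr_gt0.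
  have k1 : 0 <= 2 - 2 * cos (N * z) by have := cos_le1 (N * z); lra.
  have k2 : 0 <= lcos eta z by exact: le_trans a2.
  have k3 : 0 <= A z by apply: le_trans a1; rewrite divr_ge0// ltW.
  rewrite -(pmulr_rge0 _ z20) mulrA K.
  exact: mulr_ge0 (mulr_ge0 k1 k2) k3.
have lower z : R0 / 2 * (N ^+ 2 / pi ^+ 2) * I z - C1 * cauchy_kernel z <=
    lcos phi z * A z.
  have ck0 := cauchy_kernel_gt0 z.
  have ckC : 0 <= C1 * cauchy_kernel z by rewrite mulr_ge0// ltW.
  have [zr|rz] := leP `|z| r; last first.
    have z0 : z != 0 by rewrite -normr_gt0 (lt_trans r0).
    have z20 : 0 < z ^+ 2 by rewrite exprn_even_gt0.
    have -> : I z = 0.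
      rewrite IE; case: (boolP (_ <= z <= _)) => // /andP[z1 z2]; exfalso.
      have zpos : 0 < z by apply: lt_le_trans z1; rewrite divr_gt0// mulr_gt0.
      by move: rz; rewrite gtr0_norm// ltNge (le_trans z2).
    rewrite mulr0 sub0r; apply: lerNnormlW.
    rewrite normrM.
    have Kz : `|lcos phi z| <= 4 * B / z ^+ 2.
      rewrite ler_pdivlMr// mulrC.
      have -> : z ^+ 2 * `|lcos phi z| = `|2 - 2 * cos (N * z)| * `|lcos eta z|.
        by rewrite -normrM -K normrM (ger0_norm (sqr_ge0 z)).
      apply: (ler_pM (normr_ge0 _) (normr_ge0 _)); last exact: lcos_bounded.
      have := cos_le1 (N * z); have := cos_geN1 (N * z) => c1 c2.
      by rewrite ler_norml; apply/andP; split; lra.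
    have Az : `|A z| <= R0 by exact: autocorrelation_bounded.
    apply: le_trans (ler_pM (normr_ge0 _) (normr_ge0 _) Kz Az) _.
    rewrite /C1 (_ : 4 * B / z ^+ 2 * R0 = 4 * B * R0 * (z ^+ 2)^-1); last by ring.
    rewrite -[leRHS]mulrA; apply: ler_wpM2l.
      exact: mulr_ge0 (mulr_ge0 (ler0n _ 4) B0) (ltW R0_gt0).
    have rz2 : r ^+ 2 <= z ^+ 2.
      by rewrite -(real_normK (num_real z)) lerXn2r// ?nnegrE ltW.
    have z1 : 0 < 1 + z ^+ 2 by rewrite ltr_pwDl ?sqr_ge0.
    rewrite /cauchy_kernel ler_pdivlMr// mulrC ler_pdivrMr//.
    rewrite mulrDl mul1r addrC lerD2l mulrC ler_pdivlMr// mul1r.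
    exact: rz2.
  have [->|z0] := eqVneq z 0.
    have -> : I 0 = 0.
      rewrite IE; case: (boolP (_ <= 0 <= _)) => // /andP[z1 _]; exfalso.
      by move: z1; rewrite leNgt divr_gt0// mulr_gt0.
    rewrite mulr0 sub0r (@le_trans _ _ 0)//.
      by rewrite oppr_le0 mulr_ge0// ltW// cauchy_kernel_gt0.
    (* the value at 0 is a limit of the nearby nonnegative values *)
    have cKA : {for 0, continuous (fun z => lcos phi z * A z)}.
      apply: cvgM; last exact: autocorrelation_continuous.
      exact: (lcos_continuous (test_function_summable tphi)).
    have lim : lcos phi w * A w @[w --> 0^'+] --> lcos phi 0 * A 0.
      exact: cvg_at_right_filter cKA.
    rewrite -(cvg_lim (@Rhausdorff R) lim).
    apply: limr_ge; first by apply/cvg_ex; eexists; exact: lim.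
    near=> w; apply: inner; have w0 : 0 < w by near: w; exact: nbhs_right_gt.
    by rewrite gtr0_norm// w0; near: w; exact: nbhs_right_le.
  have z0' : 0 < `|z| by rewrite normr_gt0.
  have KA0 : 0 <= lcos phi z * A z by apply: inner; rewrite z0'.
  rewrite IE; case: (boolP (_ <= z <= _)) => [/andP[z1 z2]|_]; last first.
    by rewrite mulr0 sub0r (le_trans _ KA0)// oppr_le0.
  rewrite mulr1 (@le_trans _ _ (R0 / 2 * (N ^+ 2 / pi ^+ 2)))//.
    by rewrite gerBl.
  have zpos : 0 < z by apply: lt_le_trans z1; rewrite divr_gt0// mulr_gt0.
  have z20 : 0 < z ^+ 2 by rewrite exprn_gt0.
  have [a1 a2] := rP z zr.
  have cos0' : cos (N * z) <= 0.
    have -> : N * z = (N * z - pi) + pi by rewrite subrK.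
    rewrite cosDpi oppr_le0; apply: cos_ge0_pihalf.
    have h1 : pi / 2 <= N * z.
      by rewrite [leRHS]mulrC -ler_pdivrMr// -mulrA -invfM.
    have h2 : N * z <= pi by rewrite [leLHS]mulrC -ler_pdivlMr.
    by apply/andP; split; lra.
  have low : R0 / 2 <= z ^+ 2 * (lcos phi z * A z).
    have k1 : 2 <= 2 - 2 * cos (N * z) by lra.
    have k2 : 1 <= (2 - 2 * cos (N * z)) * lcos eta z.
      have h2 : 0 <= 2^-1 :> R by rewrite invr_ge0.
      by have := ler_pM (ler0n _ 2) h2 k1 a2; rewrite divff.
    have R02 : 0 <= R0 / 2 by rewrite divr_ge0// ltW.
    by rewrite mulrA K -[leLHS]mul1r; exact: (ler_pM ler01 R02 k2 a1).
  have : R0 / 2 / z ^+ 2 <= lcos phi z * A z by rewrite ler_pdivrMr// [leRHS]mulrC.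
  apply: le_trans; apply: ler_wpM2l; first by rewrite divr_ge0// ltW.
  have piN : 0 < pi / N by rewrite divr_gt0.
  have -> : N ^+ 2 / pi ^+ 2 = ((pi / N) ^+ 2)^-1 by rewrite -expr_div_n -exprVn invf_div.
  by rewrite lef_pV2 ?posrE ?exprn_gt0// lerXn2r// nnegrE ltW.
have sI : summable I by exact: summable_indic_itv.
have sck := @cauchy_kernel_summable R.
have [C HC] := lcos_decay tphi.
have slc := decay_summable (lcos_continuous (test_function_summable tphi)) HC.
have sKA : summable (fun z => lcos phi z * A z).
  apply: (summable_mul_bounded slc) => [|z]; last exact: autocorrelation_bounded.
  exact: (continuous_measurable_fun (autocorrelation_continuous Lf)).
have := int_le (summableB (@summableZ _ (R0 / 2 * (N ^+ 2 / pi ^+ 2)) _ sI)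
  (@summableZ _ C1 _ sck)) sKA lower.
rewrite int0 intB; [|exact: summableZ|exact: summableZ].
rewrite !intZ// -/S.
have -> : lint I = pi / (2 * N).
  rewrite /lint /Rintegral /I integral_indic// setIT.
  have E := lebesgue_measure_itv `[pi / (2 * N), pi / N]; rewrite [X in fine X]E /= {E}.
  rewrite lte_fin ifT; last first.
    by rewrite invfM mulrA ltr_pM2r ?invr_gt0// ltr_pdivrMr// mulr_natr mulr2n ltrDl.
  rewrite -EFinB/=; field; exact: lt0r_neq0.
apply/negP; rewrite -ltNge subr_gt0.
have -> : R0 / 2 * (N ^+ 2 / pi ^+ 2) * (pi / (2 * N)) = R0 * N / (4 * pi).
  move: pi0 N0; move: (pi) (N) => p n p0 n0.
  by field; rewrite (lt0r_neq0 n0) (lt0r_neq0 p0).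
rewrite ltr_pdivlMr ?mulr_gt0//.
have NS : 4 * pi * C1 * S / R0 < N.
  by rewrite lt_max; apply/orP; right; rewrite ltrDl.
rewrite ltr_pdivrMr// in NS; rewrite (mulrC R0); apply: le_lt_trans NS.
by rewrite le_eqVlt; apply/orP; left; apply/eqP; ring.
Unshelve. all: by end_near.
Qed.

End Injectivity.

(** * Sobolev norms *)

Section Sobolev.
Context {R : realType}.
Local Notation mu := (@lebesgue_measure R).
Implicit Types (f g a b : R -> R).

Lemma cos_sin_le1 (x : R) : `|cos x| <= 1 /\ `|sin x| <= 1.
Proof. by split; [exact: cos_max|exact: sin_max]. Qed.

Lemma fourier_L2P f a b : fourier_L2 f a b <-> [/\ L2 f, L2 a, L2 b &
  forall phi, test_function phi ->
    lint (fun xi => a xi * phi xi) = lint (fun x => f x * lcos phi x) /\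
    lint (fun xi => b xi * phi xi) = lint (fun x => f x * lsin phi x)].
Proof. by []. Qed.

Lemma fourier_L2_comb c d f a b g a' b' : fourier_L2 f a b -> fourier_L2 g a' b' ->
  fourier_L2 (fun x => c * f x + d * g x) (fun x => c * a x + d * a' x)
    (fun x => c * b x + d * b' x).
Proof.
move=> /fourier_L2P[Lf La Lb fou] /fourier_L2P[Lg La' Lb' fou']; apply/fourier_L2P.
have comb p q h : L2 p -> L2 q -> L2 h -> lint (fun x => (c * p x + d * q x) * h x) =
    c * lint (fun x => p x * h x) + d * lint (fun x => q x * h x).
  move=> Lp Lq Lh; have s1 := L2_mul Lp Lh; have s2 := L2_mul Lq Lh.
  rewrite -(intZ _ s1) -(intZ _ s2) -intD; [|exact: summableZ|exact: summableZ].
  by congr lint; apply/funext => x; ring.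
split; [by apply: L2D; exact: L2Z|by apply: L2D; exact: L2Z|by apply: L2D; exact: L2Z|].
move=> phi tphi; have Lphi := test_function_L2 tphi.
have [E1 E2] := fou _ tphi; have [E1' E2'] := fou' _ tphi; split.
  by rewrite (comb _ _ _ La La' Lphi) (comb _ _ _ Lf Lg (lcos_L2 tphi)) E1 E1'.
by rewrite (comb _ _ _ Lb Lb' Lphi) (comb _ _ _ Lf Lg (lsin_L2 tphi)) E2 E2'.
Qed.

(** Translation multiplies the transform a - i b by the character e^(i y xi). *)
Lemma fourier_L2_shift y f a b : fourier_L2 f a b ->
  fourier_L2 (fun x => f (x + y))
    (fun xi => a xi * cos (xi * y) + b xi * sin (xi * y))
    (fun xi => b xi * cos (xi * y) - a xi * sin (xi * y)).
Proof.
move=> /fourier_L2P[Lf La Lb fou]; apply/fourier_L2P.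
have Lcs p : L2 p -> L2 (fun xi => p xi * cos (xi * y)) /\ L2 (fun xi => p xi * sin (xi * y)).
  move=> Lp; split.
    apply: (L2_mul_bounded (C := 1) Lp (cos_meas _)) => xi.
    exact: (cos_sin_le1 (xi * y)).1.
  apply: (L2_mul_bounded (C := 1) Lp (sin_meas _)) => xi.
  exact: (cos_sin_le1 (xi * y)).2.
have [La1 La2] := Lcs _ La; have [Lb1 Lb2] := Lcs _ Lb.
have py := preserving_shift y; have pny := preserving_shift (- y).
split; [exact: (L2_preserving py Lf)|exact: L2D|exact: L2B|].
move=> phi tphi; have tc := test_cosM y tphi; have ts := test_sinM y tphi.
have sc := L2_mul Lf (lcos_L2 tc); have ss := L2_mul Lf (lsin_L2 ts).
have sc' := L2_mul Lf (lsin_L2 tc); have ss' := L2_mul Lf (lcos_L2 ts).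
have Lphi := test_function_L2 tphi.
have meas g : L2 g -> measurable_fun setT (fun x : R => f (x + y) * g x).
  move=> Lg; apply: measurable_funM; last exact: L2_meas.
  exact: (meas_preserving py (L2_meas Lf)).
have [Ec1 Ec2] := fou _ tc; have [Es1 Es2] := fou _ ts.
split.
- have -> : (fun xi => (a xi * cos (xi * y) + b xi * sin (xi * y)) * phi xi) =
      (fun xi => a xi * (phi xi * cos (xi * y)) + b xi * (phi xi * sin (xi * y))).
    by apply/funext => xi; move: (cos _) (sin _) => p q; ring.
  rewrite intD; [|exact: L2_mul La (test_function_L2 tc)|exact: L2_mul Lb (test_function_L2 ts)].
  rewrite Ec1 Es2 -(intD sc ss) -(lint_preserving pny (meas _ (lcos_L2 tphi))).
  by congr lint; apply/funext => x; rewrite subrK -mulrDr lcos_modulate.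
- have -> : (fun xi => (b xi * cos (xi * y) - a xi * sin (xi * y)) * phi xi) =
      (fun xi => b xi * (phi xi * cos (xi * y)) - a xi * (phi xi * sin (xi * y))).
    by apply/funext => xi; move: (cos _) (sin _) => p q; ring.
  rewrite intB; [|exact: L2_mul Lb (test_function_L2 tc)|exact: L2_mul La (test_function_L2 ts)].
  rewrite Ec2 Es1 -(intB sc' ss') -(lint_preserving pny (meas _ (lsin_L2 tphi))).
  by congr lint; apply/funext => x; rewrite subrK -mulrBr lsin_modulate.
Qed.

Variable s : R.

Definition Hs_weight a b (xi : R) := (1 + xi ^+ 2) `^ s * (a xi ^+ 2 + b xi ^+ 2).

Lemma Hs_weight_ge0 a b xi : 0 <= Hs_weight a b xi.
Proof. by rewrite mulr_ge0 ?powR_ge0// addr_ge0 ?sqr_ge0. Qed.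

Lemma Hs_weight_meas a b : L2 a -> L2 b -> measurable_fun setT (Hs_weight a b).
Proof.
move=> La Lb; apply: measurable_funM.
  apply: (measurableT_comp (measurable_powR s)).
  by apply: measurable_funD => //; exact: measurable_funX.
by apply: measurable_funD; apply: measurable_funX; exact: L2_meas.
Qed.

(** A bound on the squared H^s norm with explicit witnesses: no uniqueness of
    the transform is required to manipulate it. *)
Definition Hs_bound f (e : R) := exists a b,
  [/\ fourier_L2 f a b, summable (Hs_weight a b) & lint (Hs_weight a b) <= e].

Lemma Hs_bound_lt f e : (Hs_normsq s f < e%:E)%E -> Hs_bound f e.
Proof.
move=> /ereal_inf_lt[N [a [b [fou ->]]] lte].
have [_ La Lb _] := fou; exists a, b.
have sw : summable (Hs_weight a b).
  apply/integrableP; split; first by apply/measurable_EFinP; exact: Hs_weight_meas.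
  apply: le_lt_trans (lt_trans lte (ltry e)).
  under eq_integral do rewrite /= ger0_norm ?Hs_weight_ge0//.
  exact: lexx.
split=> //; rewrite -lee_fin /lint /Rintegral fineK; first exact: ltW.
by apply: integrable_fin_num => //; exact: sw.
Qed.

Lemma Hs_bound_le f e : Hs_bound f e -> (Hs_normsq s f <= e%:E)%E.
Proof.
move=> [a [b [fou sw le]]]; apply: ge_ereal_inf; eexists; first by exists a, b; split.
rewrite -[X in (X <= _)%E]fineK; last by apply: integrable_fin_num => //; exact: sw.
by rewrite lee_fin.
Qed.

Lemma Hs_normsq_ge0 f : (0 <= Hs_normsq s f)%E.
Proof.
apply/ereal_infP => _ [a [b [_ ->]]]; apply: integral_ge0 => xi _.
by rewrite lee_fin; exact: Hs_weight_ge0.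
Qed.

Lemma HsP f : Hs s f <-> exists e, Hs_bound f e.
Proof.
split=> [Hf|[e /Hs_bound_le le]]; last by apply: le_lt_trans le (ltry _).
have fn : Hs_normsq s f \is a fin_num by rewrite ge0_fin_numE ?Hs_normsq_ge0.
exists (fine (Hs_normsq s f) + 1); apply: Hs_bound_lt.
by rewrite -[X in (X < _)%E](fineK fn) lte_fin ltrDl.
Qed.

Lemma Hs_cvg0 {T} {F : set_system T} {FF : Filter F} (f : T -> R -> R) :
  Hs_normsq s (f t) @[t --> F] --> 0%E <->
  forall e, 0 < e -> \forall t \near F, Hs_bound (f t) e.
Proof.
split=> [cvg0 e e0|bound].
  have : \forall t \near F, (Hs_normsq s (f t) < e%:E)%E.
    exact: (cvg0 _ (nbhs_open_ereal_lt (f := fun=> e) e0)).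
  by apply: filterS => t; exact: Hs_bound_lt.
have fn e : 0 < e -> \forall t \near F,
    (Hs_normsq s (f t) \is a fin_num) /\ `|fine (Hs_normsq s (f t))| <= e.
  move=> e0; apply: filterS (bound _ e0) => t /Hs_bound_le le; have ge0 := Hs_normsq_ge0 (f t).
  have fin : Hs_normsq s (f t) \is a fin_num.
    by rewrite ge0_fin_numE//; exact: le_lt_trans le (ltry _).
  split=> //; move: le ge0; rewrite -(fineK fin) !lee_fin => le ge0.
  by rewrite ger0_norm.
apply/fine_cvgP; split; first by apply: filterS (fn 1 ltr01) => t [].
apply/cvgrPdist_le => e e0; apply: filterS (fn e e0) => t [_ /=].
by rewrite sub0r normrN.
Qed.

(** The transform of a translate has the same modulus. *)
Lemma Hs_weight_rotate a b y : Hs_weight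
    (fun xi => a xi * cos (xi * y) + b xi * sin (xi * y))
    (fun xi => b xi * cos (xi * y) - a xi * sin (xi * y)) = Hs_weight a b.
Proof.
apply/funext => xi; congr (_ * _); have := cos2Dsin2 (xi * y).
move: (cos _) (sin _) => p q pq.
have -> : (a xi * p + b xi * q) ^+ 2 + (b xi * p - a xi * q) ^+ 2 =
  (a xi ^+ 2 + b xi ^+ 2) * (p ^+ 2 + q ^+ 2) by ring.
by rewrite pq mulr1.
Qed.

Lemma Hs_bound_shift y f e : Hs_bound f e -> Hs_bound (fun x => f (x + y)) e.
Proof.
move=> [a [b [fou sw le]]]; have fou' := fourier_L2_shift y fou.
eexists; eexists; split; first exact: fou'; by rewrite Hs_weight_rotate.
Qed.

Lemma Hs_boundD f g e e' : Hs_bound f e -> Hs_bound g e' ->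
  Hs_bound (fun x => f x + g x) (2 * e + 2 * e').
Proof.
move=> [a [b [fou sw le]]] [a' [b' [fou' sw' le']]].
have := fourier_L2_comb 1 1 fou fou'.
have -> : (fun x => 1 * f x + 1 * g x) = (fun x => f x + g x).
  by apply/funext => x; rewrite !mul1r.
set A := (fun x => 1 * a x + _); set B := (fun x => 1 * b x + _) => F; exists A, B.
have [_ LA LB _] := F.
have s2 : summable (fun xi => 2 * Hs_weight a b xi + 2 * Hs_weight a' b' xi).
  by apply: summableD; exact: summableZ.
have wle xi : Hs_weight A B xi <= 2 * Hs_weight a b xi + 2 * Hs_weight a' b' xi.
  rewrite /Hs_weight -subr_ge0.
  have -> : 2 * ((1 + xi ^+ 2) `^ s * (a xi ^+ 2 + b xi ^+ 2)) +
      2 * ((1 + xi ^+ 2) `^ s * (a' xi ^+ 2 + b' xi ^+ 2)) -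
      (1 + xi ^+ 2) `^ s * (A xi ^+ 2 + B xi ^+ 2) =
      (1 + xi ^+ 2) `^ s * ((a xi - a' xi) ^+ 2 + (b xi - b' xi) ^+ 2).
    by rewrite /A /B; move: (_ `^ _) => w; ring.
  by rewrite mulr_ge0 ?powR_ge0// addr_ge0 ?sqr_ge0.
have sAB : summable (Hs_weight A B).
  apply: le_summable s2 _; first exact: Hs_weight_meas.
  by move=> xi; rewrite ger0_norm// Hs_weight_ge0.
split=> //; apply: le_trans (int_le sAB s2 wle) _.
rewrite intD; [|exact: summableZ|exact: summableZ].
by rewrite !intZ// lerD// ler_wpM2l.
Qed.

(** The squared H^s distance from f to its translate by h is the integral of
    the weight against 2 - 2 cos(h xi), to which dominated convergence applies. *)
Lemma Hs_translation f e0 e : Hs_bound f e0 -> 0 < e ->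
  \forall h \near (0 : R), Hs_bound (fun x => f (x + h) - f x) e.
Proof.
move=> [a [b [fou sw _]]] e_gt0; have [_ La Lb _] := fou.
pose W h xi := Hs_weight a b xi * (2 - 2 * cos (xi * h)).
have mW h : measurable_fun setT (W h).
  apply: measurable_funM; first exact: Hs_weight_meas.
  by apply: measurable_funB => //; apply: measurable_funM => //; exact: cos_meas.
have s4 : summable (fun xi => 4 * Hs_weight a b xi) by exact: summableZ.
have W4 h xi : `|W h xi| <= 4 * Hs_weight a b xi.
  rewrite normrM (ger0_norm (Hs_weight_ge0 a b xi)) mulrC ler_wpM2r ?Hs_weight_ge0//.
  have := cos_le1 (xi * h); have := cos_geN1 (xi * h) => c1 c2.
  by rewrite ler_norml; apply/andP; split; lra.
have cW xi : continuous (W ^~ xi).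
  move=> h; apply: cvgMr; apply: cvgB; first exact: cvg_cst.
  apply: cvgMr; apply: (@continuous_comp _ _ _ (fun h : R => xi * h) cos).
    by apply: cvgMr; exact: cvg_id.
  exact: continuous_cos.
have cvgW : lint (W h) @[h --> (0 : R)] --> lint (W 0).
  exact: (@lint_continuous _ W _ mW cW s4 W4 0).
move: cvgW; have -> : lint (W 0) = 0.
  rewrite /W; under [X in lint X]eq_fun do rewrite mulr0 cos0 mulr1 subrr mulr0.
  by rewrite /lint Rintegral_cst//= mul0r.
move=> /cvgrPdist_le /(_ _ e_gt0); apply: filterS => h.
rewrite sub0r normrN => We.
have := fourier_L2_comb 1 (-1) (fourier_L2_shift h fou) fou.
have -> : (fun x => 1 * f (x + h) + -1 * f x) = (fun x => f (x + h) - f x).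
  by apply/funext => x; rewrite mul1r mulN1r.
set A := (fun x => 1 * (a x * _ + _) + _); set B := (fun x => 1 * (b x * _ - _) + _) => F.
have WE : Hs_weight A B = W h.
  apply/funext => xi; rewrite /Hs_weight /W /Hs_weight /A /B -[RHS]mulrA; congr (_ * _).
  have := cos2Dsin2 (xi * h); move: (cos _) (sin _) => p q pq.
  transitivity ((a xi ^+ 2 + b xi ^+ 2) * (p ^+ 2 + q ^+ 2 + 1 - 2 * p)); first by ring.
  by rewrite pq.
exists A, B; rewrite WE; split=> //.
  exact: le_summable (mW h) s4 (W4 h).
by apply: le_trans We; exact: ler_norm.
Qed.

(** As for the L^2 norm; the squared norm of a sum costs a factor 2. *)
Lemma stopped_Hs (A : set R) u t0 c : A t0 -> continuous_Hs s A u ->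
  continuous_Hs s A (stopped t0 c u).
Proof.
move=> At0 cu t At.
have Am r : A r -> A (Num.min r t0) by move=> Ar; have [_|_] := leP r t0.
have [/HsP[M HM] _] := cu _ (Am _ At); split.
  by apply/HsP; exists M; exact: Hs_bound_shift HM.
apply/(@Hs_cvg0 _ _ _ (fun r x => stopped t0 c u r x - stopped t0 c u t x)) => e e0.
have e4 : 0 < e / 4 by rewrite divr_gt0.
have [_ /(@Hs_cvg0 _ _ _ (fun r x => u r x - u (Num.min t t0) x)) cum] := cu _ (Am _ At).
have N1 : \forall r \near within A (nbhs t),
    Hs_bound (fun x => u (Num.min r t0) x - u (Num.min t t0) x) (e / 4).
  exact: (min_within_cvg At0 At (cum _ e4)).
have N2 : \forall r \near within A (nbhs t),
    Hs_bound (fun x => u (Num.min t t0) (x + (c * Num.max (t - t0) 0 -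
      c * Num.max (r - t0) 0)) - u (Num.min t t0) x) (e / 4).
  exact: (@delay_cvg _ t0 c A t _ (Hs_translation HM e4)).
apply: filterS2 N1 N2 => r B1 B2.
set ar := c * Num.max (r - t0) 0; set at_ := c * Num.max (t - t0) 0.
have := Hs_boundD (Hs_bound_shift (- ar) B1) (Hs_bound_shift (- at_) B2).
have -> : 2 * (e / 4) + 2 * (e / 4) = e by field.
congr Hs_bound; apply/funext => x; rewrite /stopped -/ar -/at_.
have -> : x - at_ + (at_ - ar) = x - ar by ring.
by rewrite addrA subrK.
Qed.

(** By duality the pairing of f with a transform is the pairing of its own
    transform with the test function, and the weight is at least 1. *)
Lemma Hs_bound_pairing f e phi : 1 <= s -> Hs_bound f e -> test_function phi ->
  `|lint (fun x => f x * lcos phi x)| <= Num.sqrt e * norm2 phi /\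
  `|lint (fun x => f x * lsin phi x)| <= Num.sqrt e * norm2 phi.
Proof.
move=> s1 [a [b [/fourier_L2P[_ La Lb fou] sw le]]] tphi.
have Lphi := test_function_L2 tphi.
have w1 (xi : R) : 1 <= (1 + xi ^+ 2) `^ s.
  have h : 1 <= 1 + xi ^+ 2 by rewrite lerDl sqr_ge0.
  exact: le_trans h (le1r_powR h s1).
have na p : L2 p -> (forall xi, p xi ^+ 2 <= Hs_weight a b xi) -> norm2 p <= Num.sqrt e.
  move=> Lp pw; apply: ler_wsqrtr; apply: le_trans le.
  exact: (int_le (L2_summable_sqr Lp) sw pw).
have [<- <-] := fou _ tphi; split.
  apply: le_trans (cauchy_schwarz La Lphi) _; rewrite ler_wpM2r ?norm2_ge0//.
  apply: na => // xi; rewrite -[leLHS]mul1r; apply: ler_pM => //; first exact: sqr_ge0.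
  by rewrite lerDl sqr_ge0.
apply: le_trans (cauchy_schwarz Lb Lphi) _; rewrite ler_wpM2r ?norm2_ge0//.
apply: na => // xi; rewrite -[leLHS]mul1r; apply: ler_pM => //; first exact: sqr_ge0.
by rewrite lerDr sqr_ge0.
Qed.

End Sobolev.

(** * Translates of momentum bounds *)

Section MomentumShift.
Context {R : realType}.

(** The measure of the translate is the image measure. *)
Lemma momentum_ge_shift (C h : R) (f : R -> R) : measurable_fun setT f -> momentum_ge C f ->
  momentum_ge C (fun x => f (x + h)).
Proof.
move=> mf [nu [fin_nu nuE]].
pose phi : measurableTypeR R -> measurableTypeR R := fun x => x - h.
have mphi : measurable_fun setT phi by exact: (preserving_shift (- h)).1.
pose pushed : {measure set (measurableTypeR R) -> \bar R} :=
  @pushforward _ _ (measurableTypeR R) (measurableTypeR R) R nu phi.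
pose nu' := pushed mphi.
exists nu'; split=> [A cA|psi tpsi].
  rewrite /nu'/= /pushforward; apply: fin_nu.
  have -> : phi @^-1` A = (fun x => x + h) @` A.
    apply/seteqP; split=> x /=; first by move=> Ax; exists (phi x) => //; rewrite subrK.
    by move=> [y Ay <-]; rewrite /phi addrK.
  apply: continuous_compact cA; apply: continuous_subspaceT => x.
  by apply: cvgD; [exact: cvg_id|exact: cvg_cst].
have tpsi' := test_function_shift (- h) tpsi.
have := nuE _ tpsi'.
have ph := preserving_shift h; have pnh := preserving_shift (- h).
have mg : measurable_fun setT (fun x : R => psi x - derive1n 2 psi x).
  apply: measurable_funB; first exact: test_function_meas.
  by apply: test_function_meas; exact: test_function_derive1n.
pose F (x : R) : R := f (x + h) * (psi x - derive1n 2 psi x).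
have E1 : lint F = lint (fun x => f x * (psi (x - h) - derive1n 2 (fun x => psi (x - h)) x)).
  have m : measurable_fun setT F by apply: measurable_funM => //; exact: meas_preserving ph mf.
  apply: etrans (esym (lint_preserving pnh m)) _.
  apply: (congr1 (@lint R)).
  apply/funext => x.
  rewrite /F.
  have aff := @derive1n_affine _ 2 psi 1 (- h) tpsi.1.
  have psiE : (fun x => psi (- h + 1 * x)) = (fun x => psi (x - h)).
    by apply/funext => y; rewrite mul1r addrC.
  have E : derive1n 2 (fun x => psi (x - h)) x = derive1n 2 psi (x - h).
    rewrite -psiE; apply: etrans (congr1 (@^~ x) aff) _.
    by rewrite expr1n !mul1r (addrC (- h)).
  by rewrite E; congr (f _ * _); rewrite subrK.
have E2 : lint psi = lint (fun x => psi (x - h)).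
  exact: esym (lint_preserving pnh (test_function_meas tpsi)).
have push (g : R -> \bar R) : measurable_fun setT g -> (forall x, (0 <= g x)%E) ->
    (\int[nu']_x g x = \int[nu]_x g (phi x))%E.
  move=> mg' g0; have := @ge0_integral_pushforward _ _ _ _ _ phi mphi nu setT g measurableT mg'
    (fun x _ => g0 x).
  rewrite preimage_setT => H.
  exact: H.
have E3 : \int[nu']_x psi x = \int[nu]_x psi (x - h).
  have mE : measurable_fun setT (EFin \o psi).
    by apply/measurable_EFinP; exact: test_function_meas.
  apply: (congr1 fine).
  apply: etrans (integralE _ _ _) _.
  apply: etrans _ (esym (integralE _ _ _)).
  have P1 := push _ (measurable_funepos mE) (fun x => funepos_ge0 _ x).
  have P2 := push _ (measurable_funeneg mE) (fun x => funeneg_ge0 _ x).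
  apply: etrans (congr2 (fun p q : \bar R => (p - q)%E) P1 P2) _.
  apply: (congr2 (fun p q : \bar R => (p - q)%E)).
    by apply: eq_integral => x _; rewrite /= unlock.
  by apply: eq_integral => x _; rewrite /= unlock.
move=> E; rewrite E3; apply: etrans _ E.
have H := f_equal2 (fun p q : R => p + C * q) E1 E2.
exact: H.
Qed.

Lemma stopped_keeps_momentum (t0 c : R) u : 0 <= t0 -> (forall t, 0 <= t -> L2 (u t)) ->
  keeps_momentum_bounds u (stopped t0 c u).
Proof.
move=> t00 Lu T C Hu t /andP[t_ge0 tT].
have m0 : 0 <= Num.min t t0 by rewrite le_min t_ge0.
have mT : Num.min t t0 <= T by rewrite ge_min tT.
apply: momentum_ge_shift; first by apply: L2_meas; exact: Lu.
by apply: Hu; rewrite m0.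
Qed.

End MomentumShift.

(** * Rigidity *)

Section Rigidity.
Context {R : realType}.
Implicit Types (f U : R -> R).

(** Far translates of an L^2 function are almost disjointly supported, so a
    nonzero one is not invariant under any translation. *)
Lemma translation_invariant_eq0 f h : L2 f -> h != 0 ->
  ae_equal (fun x => f (x + h)) f -> ae_equal f (fun=> 0).
Proof.
move=> Lf h0 inv; apply: norm2_eq0 => //; apply/eqP; rewrite eq_le norm2_ge0 andbT.
apply/ler_addgt0Pl => e e0; rewrite addr0.
have e3 : 0 < e / 3 by rewrite divr_gt0.
have [M [g [mg gM sg fg]]] := L2_truncation Lf e3.
have Lg : L2 g := supported_L2 mg sg gM.
have invn n : ae_equal (fun x => f (x + n%:R * h)) f.
  elim: n => [|n IH].
    by under [X in ae_equal X]eq_fun do rewrite mul0r addr0; exact: ae_equal_refl.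
  apply: ae_equal_trans inv.
  have := ae_preserving (preserving_shift h) IH.
  by apply: filterS => x /= <-; rewrite -natr1 mulrDl mul1r addrA addrAC.
pose n := Num.truncn (2 * `|M| / `|h|); pose H := n.+1%:R * h.
have HM : 2 * `|M| < `|H|.
  rewrite /H normrM ger0_norm// -ltr_pdivrMr ?normr_gt0//.
  by rewrite truncnS_gt.
have pH := preserving_shift H.
have LfH := L2_preserving pH Lf; have LgH := L2_preserving pH Lg.
have ffH0 : norm2 (fun x => f x - f (x + H)) = 0.
  apply: norm2_ae0; first exact: L2B.
  by apply: filterS (invn n.+1) => x /= ->; rewrite subrr.
have le1 : norm2 g <= norm2 (fun x => g x - g (x + H)).
  apply: ler_wsqrtr; apply: int_le; [exact: L2_summable_sqr|by apply: L2_summable_sqr; exact: L2B|].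
  move=> x; have [->|gx] := eqVneq (g x) 0; first by rewrite expr0n sqr_ge0.
  have xM : `|x| <= M by rewrite leNgt; apply/negP => /sg /eqP; rewrite (negbTE gx).
  rewrite (sg (x + H)) ?subr0//.
  have xM' := le_trans xM (ler_norm M); have := ler_norm M.
  have := ler_normD (x + H) (- x); rewrite addrAC subrr add0r normrN => h1 h2; lra.
have le2 : norm2 (fun x => g x - g (x + H)) <= e / 3 + e / 3.
  have T1 := norm2_triangle Lg LgH Lf; have T2 := norm2_triangle Lf LgH LfH.
  have E : norm2 (fun x => f (x + H) - g (x + H)) = norm2 (fun x => f x - g x).
    apply: (norm2_preserving (f := fun x => f x - g x) pH).
    by apply: measurable_funB => //; exact: L2_meas.
  rewrite norm2_distC in fg; rewrite ffH0 add0r E (norm2_distC f g) in T2.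
  by apply: le_trans T1 _; apply: lerD => //; exact: le_trans T2 _.
have T3 := norm2D (L2B Lf Lg) Lg.
have FE : (fun x => f x - g x + g x) = f by apply/funext => x; rewrite subrK.
rewrite FE in T3; apply: le_trans T3 _.
have -> : e = e / 3 + (e / 3 + e / 3) by field.
by apply: lerD fg _; exact: le_trans le1 le2.
Qed.

(** If from each time of J on, u travels with a speed fixed by that time, then
    u is a single travelling wave: two different speeds would make the profile
    invariant under a nonzero translation, hence null. *)
Lemma rigid_motion (J A : set R) (u : R -> R -> R) (c : R -> R) tstar :
  (forall t, J t -> L2 (u t)) -> J tstar -> J `<=` A ->
  (forall t, J t -> exists2 t', J t' & t < t') ->
  (forall t t', J t' -> A t -> 0 < t -> t <= t' -> J t) ->
  (forall t0 t, J t0 -> A t -> t0 <= t ->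
    ae_equal (u t) (fun x => u t0 (x - c t0 * (t - t0)))) ->
  exists c0 U, L2 U /\ forall t, A t -> 0 < t -> ae_equal (u t) (fun x => U (x - c0 * t)).
Proof.
move=> Lu Jstar JA later Jdown moves.
have back t0 t : J t0 -> A t -> t0 <= t ->
    ae_equal (u t0) (fun x => u t (x + c t0 * (t - t0))).
  move=> J0 At le; have := ae_preserving (preserving_shift (c t0 * (t - t0))) (moves _ _ J0 At le).
  by apply: filterS => x /= ->; rewrite addrK.
have split_times t : A t -> 0 < t -> (tstar <= t) \/ (t <= tstar /\ J t).
  move=> At t0; have [le|/ltW le] := leP tstar t; [by left|right; split=> //].
  exact: Jdown Jstar At t0 le.
have [same|] := pselect (forall t, J t -> c t = c tstar).
  exists (c tstar), (fun x => u tstar (x + c tstar * tstar)); split.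
    exact: L2_preserving (preserving_shift _) (Lu _ Jstar).
  move=> t At t0; have [le|[le Jt]] := split_times t At t0.
    apply: ae_equal_trans (moves _ _ Jstar At le) _.
    by apply: aeW => x; congr (u tstar _); ring.
  apply: ae_equal_trans (back _ _ Jt (JA _ Jstar) le) _.
  by apply: aeW => x; congr (u tstar _); rewrite (same t Jt); ring.
move=> /existsNP[t1 /not_implyP[Jt1 /eqP cne]].
have [t0 [t2 [J0 J2 lt02 c02]]] : exists t0 t2, [/\ J t0, J t2, t0 < t2 & c t0 != c t2].
  have [lt|lt|E] := ltgtP t1 tstar; first by exists t1, tstar.
    by exists tstar, t1; rewrite eq_sym.
  by rewrite E eqxx in cne.
have [t3 J3 lt23] := later _ J2.
have zero0 : ae_equal (u t0) (fun=> 0).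
  have A3 := JA _ J3.
  apply: (@translation_invariant_eq0 _ ((c t0 - c t2) * (t3 - t2)) (Lu _ J0)).
    by rewrite mulf_neq0// subr_eq0// gt_eqF.
  have E1 := moves _ _ J0 A3 (ltW (lt_trans lt02 lt23)).
  have E2 := moves _ _ J2 A3 (ltW lt23).
  have E3 := ae_preserving (preserving_shift (- (c t2 * (t3 - t2))))
    (moves _ _ J0 (JA _ J2) (ltW lt02)).
  have E4 : ae_equal (fun x => u t0 (x - c t0 * (t3 - t0)))
      (fun x => u t0 (x - c t2 * (t3 - t2) - c t0 * (t2 - t0))).
    exact: (ae_equal_trans (ae_equal_trans (ae_equal_sym E1) E2) E3).
  have := ae_preserving (preserving_shift (c t0 * (t3 - t0))) E4.
  apply: filterS => x /=; rewrite addrK => ->; congr (u t0 _); ring.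
exists 0, (fun=> 0); split.
  by have := L2Z 0 (Lu _ J0); under [X in L2 X]eq_fun do rewrite mul0r.
move=> t At tpos; have [le|/ltW le] := leP t0 t.
  apply: ae_equal_trans (moves _ _ J0 At le) _.
  exact: (ae_preserving (preserving_shift (- (c t0 * (t - t0)))) zero0).
have Jt := Jdown _ _ J0 At tpos le.
apply: ae_equal_trans (back _ _ Jt (JA _ J0) le) _.
exact: (ae_preserving (preserving_shift (c t * (t0 - t))) zero0).
Qed.

(** The initial datum is reached only in a weak sense, against Fourier
    transforms of test functions; these suffice to identify an L^2 function. *)
Lemma initial_profile (A : set R) (u : R -> R -> R) U c :
  L2 U -> L2 (u 0) -> (forall t, A t -> L2 (u t)) ->
  (forall d, 0 < d -> exists2 r, A r & 0 < r < d) ->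
  (forall t, A t -> 0 < t -> ae_equal (u t) (fun x => U (x - c * t))) ->
  (forall phi e, test_function phi -> 0 < e -> \forall r \near within A (nbhs (0 : R)),
    `|lint (fun x => (u r x - u 0 x) * lcos phi x)| <= e /\
    `|lint (fun x => (u r x - u 0 x) * lsin phi x)| <= e) ->
  ae_equal (u 0) U.
Proof.
move=> LU L0 Lu small trav weak.
have LD := L2B LU L0.
have key g : L2 g -> (forall e, 0 < e -> \forall r \near within A (nbhs (0 : R)),
    `|lint (fun x => (u r x - u 0 x) * g x)| <= e) ->
    lint (fun x => (U x - u 0 x) * g x) = 0.
  move=> Lg H; apply/eqP; rewrite -normr_le0; apply/ler_addgt0Pl => e e0; rewrite addr0.
  have e2 : 0 < e / 2 by rewrite divr_gt0.
  have G1 : 0 < norm2 g + 1 by rewrite ltr_wpDl ?norm2_ge0.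
  have e3 : 0 < e / 2 / (norm2 g + 1) by rewrite divr_gt0.
  have shift0 : - (c * r) @[r --> (0 : R)] --> (0 : R).
    rewrite -[X in _ --> X]oppr0 -[X in _ --> - X](mulr0 c); apply: cvgN.
    by apply: cvgMr; exact: cvg_id.
  have near1 : \forall r \near (0 : R),
      norm2 (fun x => U (x + - (c * r)) - U x) <= e / 2 / (norm2 g + 1).
    have := cvg_comp _ _ shift0 (L2_translation LU).
    move/cvgrPdist_le => /(_ _ e3); apply: filterS => r /=.
    by rewrite sub0r normrN ger0_norm ?norm2_ge0.
  have /nbhs_ballP[d /= d0 dP] := near1.
  have /nbhs_ballP[d' /= d'0 dP'] := H _ e2.
  have dd : 0 < Num.min d d' by rewrite lt_min d0.
  have [r Ar /andP[r0]] := small _ dd; rewrite lt_min => /andP[rd rd'].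
  have br : ball (0 : R) d r by rewrite /ball/= sub0r normrN gtr0_norm.
  have br' : ball (0 : R) d' r by rewrite /ball/= sub0r normrN gtr0_norm.
  have B1 := dP _ br; have B2 := dP' _ br' Ar.
  have pr := preserving_shift (- (c * r)); have LUr := L2_preserving pr LU.
  have E : lint (fun x => (u r x - u 0 x) * g x) =
      lint (fun x => (U (x - c * r) - u 0 x) * g x).
    apply: int_ae_eq.
    - apply: measurable_funM; last exact: L2_meas.
      by apply: measurable_funB; apply: L2_meas => //; exact: Lu.
    - by apply: measurable_funM; [apply: measurable_funB; apply: L2_meas|exact: L2_meas].
    - by apply: filterS (trav _ Ar r0) => x /= ->.
  have s1 := L2_mul (L2B LUr L0) Lg; have s2 := L2_mul (L2B LUr LU) Lg.
  have -> : lint (fun x => (U x - u 0 x) * g x) =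
      lint (fun x => (U (x - c * r) - u 0 x) * g x) -
      lint (fun x => (U (x - c * r) - U x) * g x).
    by rewrite -(intB s1 s2); congr lint; apply/funext => x; ring.
  rewrite -E (splitr e); apply: le_trans (ler_normB _ _) _; apply: lerD => //.
  apply: le_trans (cauchy_schwarz (L2B LUr LU) Lg) _.
  rewrite ler_pdivlMr// in B1; apply: le_trans B1.
  by rewrite ler_wpM2l ?norm2_ge0// lerDl.
have D0 : ae_equal (fun x => U x - u 0 x) (fun=> 0).
  apply: fourier_injective LD _ => phi tphi; split.
    by apply: key (lcos_L2 tphi) _ => e e0; apply: filterS (weak _ _ tphi e0) => r [].
  by apply: key (lsin_L2 tphi) _ => e e0; apply: filterS (weak _ _ tphi e0) => r [].
by apply: filterS D0 => x /eqP; rewrite subr_eq0 => /eqP ->.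
Qed.

End Rigidity.

(** * Symmetric solutions are travelling waves *)

Section StoppedSolution.
Context {R : realType}.
Implicit Types (J : set R) (u : R -> R -> R) (lambda : R -> R).

(** Continuing a symmetric solution from any time on as a wave travelling at
    the speed of its axis again yields a weak solution. *)
Lemma stopped_weak_solution k J u lambda t0 : open J -> J t0 ->
  weak_solution k J u -> (forall t, J t -> derivable lambda t 1) ->
  (forall t, J t -> ae_equal (u t) (fun x => u t (2 * lambda t - x))) ->
  weak_solution k J (stopped t0 (derive1 lambda t0) u).
Proof.
move=> oJ Jt0 [ux [cu weak]] ld sym.
have evol := weak_evolution oJ cu weak.
have profile psi (tpsi : test_function psi) := symmetric_profile oJ cu evol ld sym Jt0 tpsi.
have cv := stopped_H1 (derive1 lambda t0) Jt0 cu.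
exists (stopped t0 (derive1 lambda t0) ux); split; first exact: cv.
have evolv psi : test_function psi -> forall t, J t -> is_derive t (1 : R)
    (fun r => lint (fun x => stopped t0 (derive1 lambda t0) u r x * helmholtz psi x))
    (flux k (stopped t0 (derive1 lambda t0) u t) (stopped t0 (derive1 lambda t0) ux t) psi).
  by move=> tpsi t Jt; exact: (stopped_evolution cu Jt0 evol profile tpsi Jt).
exact: (evolution_weak oJ cv evolv).
Qed.

(** A symmetric solution that coincides with all its continuations as
    travelling waves is a travelling wave. *)
Lemma traveling_of_stopped (J A : set R) u (c : R -> R) tstar :
  (forall t, A t -> L2 (u t)) -> J tstar -> J `<=` A -> A 0 ->
  (forall t, A t -> 0 <= t) -> (forall t, J t -> 0 < t) ->
  (forall t, J t -> exists2 t', J t' & t < t') ->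
  (forall t t', J t' -> 0 < t -> t <= t' -> J t) ->
  (forall t0 t, J t0 -> A t -> ae_equal (stopped t0 (c t0) u t) (u t)) ->
  (forall phi e, test_function phi -> 0 < e -> \forall r \near within A (nbhs (0 : R)),
    `|lint (fun x => (u r x - u 0 x) * lcos phi x)| <= e /\
    `|lint (fun x => (u r x - u 0 x) * lsin phi x)| <= e) ->
  traveling_wave A u.
Proof.
move=> Lu Jstar JA A0 Age0 J0 later Jdown uniq weak.
have moves t0 t : J t0 -> A t -> t0 <= t ->
    ae_equal (u t) (fun x => u t0 (x - c t0 * (t - t0))).
  by move=> Jt0 At le; have := ae_equal_sym (uniq _ _ Jt0 At); rewrite stopped_after.
have [c0 [U [LU trav]]] := rigid_motion (fun t Jt => Lu _ (JA _ Jt)) Jstar JA later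
  (fun t t' Jt' _ => Jdown t t' Jt') moves.
exists c0, U => t At; have := Age0 _ At; rewrite le_eqVlt => /predU1P[t0|]; last exact: trav.
rewrite -t0; under [X in ae_equal _ X]eq_fun do rewrite mulr0 subr0.
apply: (initial_profile (A := A) (c := c0) LU (Lu _ A0) Lu _ trav weak) => d d0.
have m0 : 0 < Num.min tstar d by rewrite lt_min J0.
have m2 : Num.min tstar d / 2 < Num.min tstar d.
  by rewrite ltr_pdivrMr// mulr_natr mulr2n ltrDl.
have h0 : 0 < Num.min tstar d / 2 by rewrite divr_gt0.
move: (m2); rewrite lt_min => /andP[mt md].
exists (Num.min tstar d / 2); last by rewrite h0.
exact: JA (Jdown _ _ Jstar h0 (ltW mt)).
Qed.

Lemma Hs_L2 (s : R) (f : R -> R) : Hs s f -> L2 f.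
Proof. by move=> /HsP[e [a [b [[]]]]]. Qed.

Lemma Hs_weak_initial (s : R) (A : set R) u (phi : R -> R) e :
  1 <= s -> A 0 -> continuous_Hs s A u ->
  test_function phi -> 0 < e -> \forall r \near within A (nbhs (0 : R)),
    `|lint (fun x => (u r x - u 0 x) * lcos phi x)| <= e /\
    `|lint (fun x => (u r x - u 0 x) * lsin phi x)| <= e.
Proof.
move=> s1 A0 cu tphi e0.
have n1 : 0 < norm2 phi + 1 by rewrite ltr_wpDl ?norm2_ge0.
have e1 : 0 < e / (norm2 phi + 1) by rewrite divr_gt0.
have e2 : 0 < (e / (norm2 phi + 1)) ^+ 2 by rewrite exprn_gt0.
have [_ /(@Hs_cvg0 _ _ _ _ _ (fun r x => u r x - u 0 x)) cu0] := cu _ A0.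
have small : Num.sqrt ((e / (norm2 phi + 1)) ^+ 2) * norm2 phi <= e.
  rewrite sqrtr_sqr gtr0_norm// mulrAC ler_pdivrMr//.
  by rewrite ler_wpM2l ?lerDl// ltW.
apply: filterS (cu0 _ e2) => r B; have [B1 B2] := Hs_bound_pairing s1 B tphi.
by split; [exact: le_trans B1 small|exact: le_trans B2 small].
Qed.

(** Convergence in norm implies convergence of the pairings. *)
Lemma H1_weak_initial (A : set R) u (phi : R -> R) e : A 0 -> continuous_H1 A u ->
  test_function phi -> 0 < e -> \forall r \near within A (nbhs (0 : R)),
    `|lint (fun x => (u r x - u 0 x) * lcos phi x)| <= e /\
    `|lint (fun x => (u r x - u 0 x) * lsin phi x)| <= e.
Proof.
move=> A0 [ux cu] tphi e0.
have Lu t : A t -> L2 (u t) by move=> /cu[[]].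
have nearA : \forall r \near within A (nbhs (0 : R)), A r by exact: withinT.
have LD : \forall r \near within A (nbhs (0 : R)), L2 (fun x => u r x - u 0 x).
  by apply: filterS nearA => r Ar; apply: L2B; exact: Lu.
have [_ cu0 _] := cu _ A0.
have cu1 : norm2 (fun x => u r x - u 0 x) @[r --> within A (nbhs (0 : R))] --> (0 : R).
  exact/(L2norm_cvg0 LD).
pose n := norm2 (lcos phi) + norm2 (lsin phi) + 1.
have n0 : 0 < n by rewrite ltr_wpDl// addr_ge0 ?norm2_ge0.
have e1 : 0 < e / n by rewrite divr_gt0.
have := cu1; move/cvgrPdist_le => /(_ _ e1) near_small.
apply: filterS2 LD near_small => r Lr; rewrite sub0r normrN ger0_norm ?norm2_ge0//.
rewrite ler_pdivlMr// => B.
have half g : L2 g -> norm2 g <= n -> `|lint (fun x => (u r x - u 0 x) * g x)| <= e.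
  move=> Lg gn; apply: le_trans (cauchy_schwarz Lr Lg) _; apply: le_trans B.
  by rewrite ler_wpM2l ?norm2_ge0.
split; apply: half.
- exact: lcos_L2.
- by rewrite /n -addrA lerDl addr_ge0 ?norm2_ge0.
- exact: lsin_L2.
- by rewrite /n addrAC lerDr addr_ge0 ?norm2_ge0.
Qed.

End StoppedSolution.

Theorem theorem3p3 (R : realType) (k : R) (u0 : R -> R) (u : R -> R -> R) :
  (forall s T : R, 3 / 2 < s -> Hs s u0 ->
    0 < T -> unique_Hs_solution k s T u0 u ->
    x_symmetric `]0, T[ u -> traveling_wave `[0, T] u)
  /\
  (H1 u0 -> momentum_ge 0 u0 ->
    unique_global_solution k u0 u ->
    x_symmetric `]0, +oo[ u -> traveling_wave `[0, +oo[ u).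
Proof.
split=> [s T s32 _ T0 [[cu weak init] uniq] [lambda [ld sym]]|
         _ _ [[cu weak init] uniq] [lambda [ld sym]]].
- have s1 : 1 <= s by lra.
  have Lu t : `[0, T]%classic t -> L2 (u t) by move=> /cu[/Hs_L2].
  have A0 : `[0, T]%classic (0 : R) by rewrite /= in_itv/= lexx ltW.
  have JA : `]0, T[%classic `<=` `[0, T]%classic.
    by move=> t /=; rewrite !in_itv/= => /andP[/ltW -> /ltW ->].
  apply: (@traveling_of_stopped _ `]0, T[ `[0, T] u (derive1 lambda) (T / 2) Lu _ JA A0).
  + by rewrite /= in_itv/= divr_gt0//= ltr_pdivrMr// mulr_natr mulr2n ltrDl.
  + by move=> t /=; rewrite in_itv/= => /andP[].
  + by move=> t /=; rewrite in_itv/= => /andP[].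
  + move=> t /=; rewrite in_itv/= => /andP[t0 tT]; exists ((t + T) / 2); last by lra.
    by rewrite /= in_itv/=; apply/andP; split; lra.
  + move=> t t' /=; rewrite !in_itv/= => /andP[_ t'T] -> tt'.
    exact: le_lt_trans tt' t'T.
  + move=> t0 t Jt0 At; have A0' := JA _ Jt0.
    have t00 : 0 <= t0 by move: A0'; rewrite /= in_itv/= => /andP[].
    apply: uniq; last by move: At; rewrite /= in_itv.
    split; [exact: stopped_Hs| |by rewrite stopped_before].
    have oJ : open `]0, T[%classic by exact: interval_open.
    apply: (stopped_weak_solution oJ Jt0 weak) => [r /ld[] //|]; exact: sym.
  + by move=> phi e; exact: (Hs_weak_initial s1 A0 cu).
- have [ux cux] := cu.
  have Lu t : `[0, +oo[%classic t -> L2 (u t) by move=> /cux[[]].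
  have A0 : `[0, +oo[%classic (0 : R) by rewrite /= ?in_itv/= ?lexx.
  have JA : (`]0, +oo[%classic : set R) `<=` `[0, +oo[%classic.
    by move=> t /=; rewrite !in_itv/= !andbT => /ltW.
  apply: (@traveling_of_stopped _ `]0, +oo[ `[0, +oo[ u (derive1 lambda) 1 Lu _ JA A0).
  + by rewrite /= ?in_itv/= ltr01.
  + by move=> t /=; rewrite ?in_itv/= ?andbT.
  + by move=> t /=; rewrite ?in_itv/= ?andbT.
  + move=> t /=; rewrite ?in_itv/= ?andbT => t0; exists (t + 1); last by rewrite ltrDl.
    by rewrite /= ?in_itv/= ?andbT addr_gt0.
  + by move=> t t' _ t0 _; rewrite /= ?in_itv/= t0.
  + move=> t0 t Jt0 At; have A0' := JA _ Jt0.
    have t00 : 0 <= t0 by move: A0'; rewrite /= ?in_itv/= ?andbT.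
    apply: uniq; last by move: At; rewrite /= ?in_itv/= ?andbT.
      split; [by eexists; exact: (stopped_H1 _ A0' cux)| |by rewrite stopped_before].
      have oJ : open (`]0, +oo[%classic : set R) by exact: interval_open.
      apply: (stopped_weak_solution oJ Jt0 weak) => [r /ld[] //|]; exact: sym.
    by apply: stopped_keeps_momentum => // r r0; apply: Lu; rewrite /= ?in_itv/= r0.
  + by move=> phi e; exact: (H1_weak_initial A0 cu).
Qed.
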